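(* Let $m\ge2$, $n=2m$, $\mathbb{F}=\mathbb{C}$ and $G=\mathrm{SU}(2,2m;\mathbb{C})$. If $c\in(0,1]$, then (1) $\rho(h)\asymp h$ for $h\in H_{[c]}$; and (2) $\mathrm{SU}(2,2m;\mathbb{C})/H_{[c]}$ has a tessellation.
   Context: Tessellations: a discrete subgroup $\Gamma$ of a Lie group $G$ is a crystallographic group for $G/H$ if $\Gamma$ acts properly discontinuously on $G/H$ (for every compact $C\subset G/H$, the set $\{\gamma\in\Gamma : C\cap\gamma C\ne\emptyset\}$ is finite) and $\Gamma\backslash G/H$ is compact. $G/H$ has a tessellation if there exists a crystallographic group for $G/H$. The group: let $J$ be the $(n+2)\times(n+2)$ matrix with $J_{1,n+2}=J_{2,n+1}=J_{n+1,2}=J_{n+2,1}=1$, with the identity in the middle $(n-2)\times(n-2)$ block (rows and columns $3,\dots,n$), and zeros elsewhere. $\mathrm{SU}(2,n;\mathbb{C})=\{g\in\mathrm{SL}(n+2,\mathbb{C}) : gJg^\dagger=J\}$ ($^\dagger$ = conjugate-transpose), a realization of $\mathrm{SU}(2,n)$. $A$ is the group of diagonal matrices in $G$ with positive real entries and $N$ is the group of upper-triangular matrices in $G$ with $1$'s on the diagonal. For $\phi\in\mathbb{C}$ write $\phi=\operatorname{Re}\phi+\operatorname{Im}\phi$ with $\operatorname{Im}\phi\in i\mathbb{R}$ (the imaginary part of $a+bi$ is $bi$). For $c\in(0,1]$, $H_{[c]}$ is the connected subgroup of $AN$ whose (real) Lie algebra is the set of all matrices $$\begin{pmatrix} t&\phi&x&\eta&\mathsf{x}\\0&0&0&0&-\overline{\eta}\\0&0&0&0&-x^\dagger\\0&0&0&0&-\overline{\phi}\\0&0&0&0&-t\end{pmatrix},\qquad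 \eta=\operatorname{Re}\phi+c\operatorname{Im}\phi,$$ with $t\in\mathbb{R}$, $\phi\in\mathbb{C}$, $x\in\mathbb{C}^{n-2}$ (row vector), $\mathsf{x}\in i\mathbb{R}$. Norms: $\|h\|=\max_{j,k}|h_{j,k}|$; $\rho(h)=h\wedge h$ acting on $\mathbb{C}^{n+2}\wedge\mathbb{C}^{n+2}$, and $\|\rho(h)\|$ is the maximum absolute value of the determinants of all $2\times2$ submatrices of $h$. ''$\rho(h)\asymp h$ for $h\in X$'' means there is a constant $C\geq 1$ such that $C^{-1}\|h\|\le\|\rho(h)\|\le C\|h\|$ for all $h\in X$ with $\|h\|$ sufficiently large. *)

(* Defs.v *)
From HB Require Import structures.
From mathcomp Require Import all_boot all_order all_algebra complex.
From mathcomp Require Import all_classical all_reals all_analysis.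

Set Implicit Arguments.
Unset Strict Implicit.
Unset Printing Implicit Defensive.

Import Order.TTheory GRing.Theory Num.Theory Num.Def.
Import numFieldNormedType.Exports.
Local Open Scope classical_set_scope.
Local Open Scope ring_scope.
Local Open Scope sesquilinear_scope.
Local Open Scope complex_scope.
Local Open Scope quotient_scope.

(* The usual topology and norm of the complex field R[i]; the library provides
   them only for an abstract numClosedFieldType. *)
HB.instance Definition _ (R : realType) := GRing.ComAlgebra.copy R[i] R[i]^o.
HB.instance Definition _ (R : realType) := Vector.copy R[i] R[i]^o.
HB.instance Definition _ (R : realType) := NormedModule.copy R[i] R[i]^o.
HB.instance Definition _ (R : realType) := Num.ClosedField.on R[i].

HB.mixin Record Group_isTopologicalGroup G & Group G & Topological G := {
  mulg_continuous : continuous (fun xy : G * G => (xy.1 * xy.2)%g);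
  invg_continuous : continuous (fun x : G => (x^-1)%g)
}.

#[short(type="topologicalGroupType")]
HB.structure Definition TopologicalGroup :=
  { G of Group_isTopologicalGroup G & Group G & Topological G }.

Section Tessellations.
Variable G : topologicalGroupType.
Implicit Types (g x y : G) (S H Gamma : set G).

Definition is_subgroup S :=
  [/\ S 1%g, forall x y, S x -> S y -> S (x * y)%g
    & forall x, S x -> S (x^-1)%g].

Definition generated_subgroup S : set G := smallest is_subgroup S.

Definition lcoset H x : set G := [set (x * h)%g | h in H].

Definition same_lcoset H : rel G := fun x y => `[< lcoset H x = lcoset H y >].

Fact same_lcoset_equiv H : equiv_class_of (same_lcoset H).
Proof.
split=> [x|x y|y x z]; first exact/asboolP.
- by apply/asboolP/asboolP => ->.
- by move=> /asboolP xy /asboolP yz; apply/asboolP; rewrite xy.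
Qed.

Canonical same_lcoset_equivRel H := EquivRelPack (same_lcoset_equiv H).

(* G/H, with the quotient topology *)
Definition coset_space H : topologicalType :=
  quotient_topology {eq_quot (same_lcoset H)}.

Definition coset_proj H (x : G) : coset_space H :=
  \pi_({eq_quot (same_lcoset H)})%qT x.

(* The action of G on G/H by left translation; it does not depend on the
   choice of the representative of p as soon as H is a subgroup. *)
Definition translate H g (p : coset_space H) : coset_space H :=
  coset_proj H (g * repr (p : {eq_quot (same_lcoset H)}))%g.

Definition orbit_of Gamma H (p : coset_space H) : set (coset_space H) :=
  [set translate g p | g in Gamma].

Definition same_orbit Gamma H : rel (coset_space H) :=
  fun p q => `[< orbit_of Gamma p = orbit_of Gamma q >].

Fact same_orbit_equiv Gamma H : equiv_class_of (@same_orbit Gamma H).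
Proof.
split=> [x|x y|y x z]; first exact/asboolP.
- by apply/asboolP/asboolP => ->.
- by move=> /asboolP xy /asboolP yz; apply/asboolP; rewrite xy.
Qed.

Canonical same_orbit_equivRel Gamma H := EquivRelPack (same_orbit_equiv Gamma H).

(* Gamma\G/H, with the quotient topology *)
Definition double_coset_space Gamma H : topologicalType :=
  quotient_topology {eq_quot (@same_orbit Gamma H)}.

Definition discrete_subgroup Gamma :=
  is_subgroup Gamma /\ Gamma `<=` isolated Gamma.

Definition acts_properly_discontinuously Gamma H :=
  forall K : set (coset_space H), compact K ->
    finite_set [set g | Gamma g /\ K `&` translate g @` K !=set0].

Definition crystallographic Gamma H :=
  [/\ discrete_subgroup Gamma, acts_properly_discontinuously Gamma H
    & compact [set: double_coset_space Gamma H]].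

Definition has_tessellation H := exists Gamma, crystallographic Gamma H.

End Tessellations.

Section SpecialUnitary.
Variables (R : realType) (n : nat).
Local Notation C := R[i].
Local Notation M := 'M[C]_n.+2.

(* Rows and columns are numbered from 0 to n+1. *)
Definition Jform : M :=
  \matrix_(i, j) (if (2 <= i < n)%N then i == j
                  else (i + j == n.+1)%N)%:R.

Definition SU_set : set M :=
  [set g | g *m Jform *m g ^t* = Jform /\ \det g = 1].

Definition SU : Type := set_type SU_set.

HB.instance Definition _ := SubChoice.copy SU (set_type SU_set).
HB.instance Definition _ := Topological.copy SU (set_type SU_set).

Lemma SU_unit (g : M) : SU_set g -> g \in unitmx.
Proof. by case=> _ dg; rewrite unitmxE dg unitr1. Qed.

Lemma SU_set1 : SU_set 1%:M.
Proof. by split; rewrite ?det1// mul1mx trmx1 map_mx1 mulmx1. Qed.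

Lemma SU_setM (g h : M) : SU_set g -> SU_set h -> SU_set (g *m h).
Proof.
move=> [gJ dg] [hJ dh]; split; last by rewrite det_mulmx dg dh mulr1.
by rewrite trmx_mul map_mxM !mulmxA -(mulmxA g) -(mulmxA g) hJ gJ.
Qed.

Lemma SU_setV (g : M) : SU_set g -> SU_set (invmx g).
Proof.
move=> Sg; have ug := SU_unit Sg; case: Sg => gJ dg.
split; last by rewrite det_inv dg invr1.
rewrite -{1}gJ !mulmxA mulVmx// mul1mx -mulmxA -map_mxM -trmx_mul.
by rewrite mulVmx// trmx1 map_mx1 mulmx1.
Qed.

Lemma SUP (g : SU) : SU_set (\val g).
Proof. exact: set_valP. Qed.

Definition SU_of (g : M) (Sg : SU_set g) : SU := SigSub (mem_set Sg).
Definition SU_one : SU := SU_of SU_set1.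
Definition SU_mul (g h : SU) : SU := SU_of (SU_setM (SUP g) (SUP h)).
Definition SU_inv (g : SU) : SU := SU_of (SU_setV (SUP g)).

Fact SU_mulA : associative SU_mul.
Proof. by move=> x y z; apply: val_inj; rewrite /= mulmxA. Qed.
Fact SU_mul1g : left_id SU_one SU_mul.
Proof. by move=> x; apply: val_inj; rewrite /= mul1mx. Qed.
Fact SU_mulg1 : right_id SU_one SU_mul.
Proof. by move=> x; apply: val_inj; rewrite /= mulmx1. Qed.
Fact SU_mulVg : left_inverse SU_one SU_inv SU_mul.
Proof. by move=> x; apply: val_inj; rewrite /= mulVmx// SU_unit//; exact: SUP. Qed.
Fact SU_mulgV : right_inverse SU_one SU_inv SU_mul.
Proof. by move=> x; apply: val_inj; rewrite /= mulmxV// SU_unit//; exact: SUP. Qed.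

HB.instance Definition _ :=
  isGroup.Build SU SU_mulA SU_mul1g SU_mulg1 SU_mulVg SU_mulgV.


Fact SU_continuous (T : topologicalType) (f : T -> SU) :
  (forall i j, continuous (fun x => \val (f x) i j)) -> continuous f.
Proof.
move=> cf x A [_ [[B oB <-] Bfx] BA].
have [P /= Pfx PB] : nbhs (\val (f x)) B by rewrite nbhsE; exists B.
have : nbhs x [set y | forall i j, P i j (\val (f y) i j)].
  apply: filter_forall => i; apply: filter_forall => j.
  exact: (cf i j x _ (Pfx i j)).
by apply: filterS => y Py; apply: BA; exact: PB.
Qed.

Fact SU_coord_continuous i j : continuous (fun g : SU => \val g i j : C).
Proof.
move=> g; apply: (@continuous_comp _ _ _ (val : SU -> M) (fun A : M => A i j)).
  exact: initial_continuous.
exact: (@coord_continuous C).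
Qed.

Fact SU_mul_continuous :
  continuous (fun xy : SU * SU => (xy.1 * xy.2)%g).
Proof.
apply: SU_continuous => i j.
rewrite [X in continuous X](_ : _ = fun xy : SU * SU =>
  \sum_k \val xy.1 i k * \val xy.2 k j); last first.
  by apply/funext => xy; rewrite /= mxE.
apply: continuous_big => [|k _ xy]; first exact: add_continuous.
apply: (@cvgM C).
  apply: (@continuous_comp _ _ _ fst (fun g : SU => \val g i k : C)).
    exact: cvg_fst.
  exact: SU_coord_continuous.
apply: (@continuous_comp _ _ _ snd (fun g : SU => \val g k j : C)).
  exact: cvg_snd.
exact: SU_coord_continuous.
Qed.

Fact SU_inv_continuous : continuous (fun x : SU => (x^-1)%g).
Proof.
apply: SU_continuous => i j.
rewrite [X in continuous X](_ : _ =
  fun x : SU => cofactor (\val x) j i); last first.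
  apply/funext => x; have Sx := SUP x; rewrite /= /invmx SU_unit//.
  by case: Sx => _ ->; rewrite invr1 scale1r mxE.
move=> x; apply: (@cvgM C).
- exact: (@nbhs_filter SU).
- exact: (@cst_continuous SU C).
apply: continuous_big => [|s _]; first exact: add_continuous.
move=> y; apply: (@cvgM C).
- exact: (@nbhs_filter SU).
- exact: (@cst_continuous SU C).
apply: continuous_big => [|k _]; first exact: mul_continuous.
rewrite [X in continuous X](_ : _ = fun g : SU =>
  \val g (lift j k) (lift i (perm.fun_of_perm s k))); last by apply/funext => g; rewrite !mxE.
exact: SU_coord_continuous.
Qed.

HB.instance Definition _ :=
  Group_isTopologicalGroup.Build SU SU_mul_continuous SU_inv_continuous.

Definition expmx (X : M) : M :=
  lim (series (fun k => (k`!%:R : C)^-1 *: X ^+ k) @ \oo).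

(* The connected Lie subgroup with (real) Lie algebra L, i.e. the subgroup
   generated by exp L. For L inside the Lie algebra of AN, where A is the group
   of positive diagonal matrices and N the group of unipotent upper-triangular
   ones, it is automatically a subgroup of AN. *)
Definition connected_subgroup (L : set M) : set SU :=
  generated_subgroup [set g : SU | exists2 X, L X & \val g = expmx X].

Definition Hmx (t : R) (phi eta : C) (x : (n - 2).-tuple C) (s : C) : M :=
  \matrix_(i, j)
    (if (i == 0 :> nat)%N then
       if (j == 0 :> nat)%N then t%:C
       else if (j == 1 :> nat)%N then phi
       else if (j < n)%N then x`_(j - 2)
       else if (j == n :> nat)%N then eta
       else s
     else if (j == n.+1 :> nat)%N then
       if (i == 1 :> nat)%N then - conjC eta
       else if (i < n)%N then - conjC x`_(i - 2)
       else if (i == n :> nat)%N then - conjC phi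
       else - t%:C
     else 0).

Definition H_lie (c : R) : set M :=
  [set X | exists t phi x s,
     X = Hmx t phi (complex.Re phi +i* (c * complex.Im phi)) x (s *i)].

Definition Hc (c : R) : set SU := connected_subgroup (H_lie c).

(* The library norm on 'M[C]_(m, n) used below is the maximum of the absolute
   values of the entries (mx_norm); its values are real elements of C. *)

(* rho h is the matrix of h /\ h in the basis of the vectors e_j /\ e_k of the
   exterior square, j < k; its entries are the 2 x 2 minors of h. *)
Definition wedge_index := [set jk : 'I_n.+2 * 'I_n.+2 | (jk.1 < jk.2)%N]%SET.

Definition minor2 (h : M) (p q : 'I_n.+2 * 'I_n.+2) : C :=
  h p.1 q.1 * h p.2 q.2 - h p.1 q.2 * h p.2 q.1.

Definition rho (h : M) : 'M[C]_#|wedge_index| :=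
  \matrix_(p, q) minor2 h (enum_val p) (enum_val q).

Definition rho_asymp (X : set M) :=
  exists2 K : R, 1 <= K & exists r : R, forall h, X h -> r%:C <= `|h| ->
    (K^-1)%:C * `|h| <= `|rho h| <= K%:C * `|h|.

End SpecialUnitary.

(* Main.v *)
(* The group H_[c] is the set of products [unip w z *m dg n a] with [w] in a real
   subspace W. Their entries are explicit: every 2 x 2 minor is O(|h|), and the
   minors involving the first row or the last column dominate |h|.

   For the tessellation, let j be an antilinear map with j^2 = -1 that is compatible
   with J; its commutant is a copy of Sp(1, m). The minors of a matrix g commuting
   with j dominate |g|^2, whereas those of h in H_[c] are O(|h|), so this Sp(1, m)
   acts properly on G/H_[c]. Conversely, every conjugate g^-1 j g can be moved by
   H_[c] to a structure commuting with J, hence unitary; the three moves needed only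
   use how W meets the isotropic vectors. Therefore a cocompact discrete subgroup of
   Sp(1, m) is crystallographic.

   Such a subgroup is the stabilizer of a Z[sqrt 2, i]-lattice on which J becomes
   diag(-2 sqrt 2, -2 sqrt 2, 1, ..., 1, 2, 2), a form whose Galois conjugate is
   positive definite. For cocompactness, the quadratic form |k E g|^2 + |k E2|^2
   on integer vectors k is at least 1 away from 0, because x and its Galois
   conjugate cannot both be small, and its determinant does not depend on g; hence
   it has a reduced basis of bounded vectors. The Gram matrices of that basis then
   have entries in a fixed finite subset of Z[sqrt 2, i]. *)

Require Import Defs.
From HB Require Import structures.
From mathcomp Require Import all_boot all_order all_algebra complex.
From mathcomp Require Import all_classical all_reals all_analysis.
From mathcomp Require Import zify ring lra.
Set Implicit Arguments.
Unset Strict Implicit.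
Unset Printing Implicit Defensive.
Import Order.TTheory GRing.Theory Num.Theory Num.Def.
Import numFieldNormedType.Exports.
Local Open Scope classical_set_scope.
Local Open Scope ring_scope.
Local Open Scope sesquilinear_scope.
Local Open Scope quotient_scope.

(** * Hermite reduction of positive definite quadratic forms on integer rows *)

Section LatticeReduction.
Variable R : realType.
Implicit Types (N : nat).

Local Notation ri := (map_mx (intr : int -> R)).

(** Matrices act on row vectors from the right. If γ commutes with the fixed structure [Q], then
    [actq Q (γ x) = actq Q x]; thus [actq Q x] only depends on the coset of x modulo Sp(1, m), and
    the double cosets of Sp(1, m) and H_[c] become orbits of H_[c] on quaternionic structures. A
    decomposition of G as Sp(1, m) K H_[c] is never formed: once h makes [actq Q (x h)] unitary,
    lattice reduction is run on x h itself, since a unitary structure is enough to bound the Gram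
    matrices. The irrationality sqrt 2 is what makes a cocompact group possible. An indefinite form
    over Z[i] in so many variables represents 0, by Meyer's theorem, so it gives no uniform lower
    bound on the lattice. A Galois conjugate that is positive definite restores the bound, and it
    also makes bounded sets of lattice data finite. The parameter c > 0 enters twice: the hermitian
    form is positive definite on W, which keeps minors linear in |h|, and two real 2 x 2
    determinants do not vanish, which makes the moves of structures solvable. *)

Definition qform N (S : 'M[R]_N) (v : 'rV[R]_N) : R := (v *m S *m v^T) 0 0.

Lemma qformZ N (S : 'M[R]_N) a v : qform S (a *: v) = a ^+ 2 * qform S v.
Proof.
by rewrite /qform -scalemxAl linearZ /= -scalemxAr -scalemxAl !mxE mulrA.
Qed.

Lemma qform_congr N (S U : 'M[R]_N) v : qform (U *m S *m U^T) v = qform S (v *m U).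
Proof. by rewrite /qform trmx_mul !mulmxA. Qed.

Lemma nearest_int (x : R) : exists c : int, (c%:~R + x) ^+ 2 <= 4^-1.
Proof.
exists (- Num.floor (x + 2^-1)); have /andP[] := floor_itv (x + 2^-1).
rewrite [X in _ < X]rmorphD /= rmorphN /= => lo hi.
have h1 : - 2^-1 <= - (Num.floor (x + 2^-1))%:~R + x by lra.
have h2 : - (Num.floor (x + 2^-1))%:~R + x <= 2^-1 by lra.
nra.
Qed.

(** The Smith normal form of a single row has one diagonal entry, so only the first row of the right
    factor survives. *)
Lemma primitive_row N (k : 'rV[int]_N.+1) : exists e (U : 'M[int]_N.+1),
  U \in unitmx /\ k = e *: row 0 U.
Proof.
have [L _ [U Uu [d _ ->]]] := int_Smith_normal_form k.
exists (L 0 0 * d`_0), U; split=> //.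
apply/rowP => j; rewrite !mxE (bigD1 0)//= [X in _ + X]big1 ?addr0 => [|i i0].
  by rewrite !mxE big_ord1 !mxE eqxx mulr1n.
rewrite !mxE big_ord1 !mxE (_ : (_ == _ :> nat) = false) ?mulr0n ?mulr0 ?mul0r//.
by apply/negbTE; rewrite eq_sym.
Qed.

Lemma det_mx0 N (A : 'M[R]_N) : N = 0%N -> \det A = 1.
Proof. by case: N A => // A _; rewrite det_mx00. Qed.

Section Schur.
Variables (N : nat) (a : R) (b : 'rV[R]_N) (S : 'M[R]_N).
Hypothesis a0 : a != 0.
Local Notation S2 := (S - a^-1 *: (b^T *m b)).

Lemma det_schur : \det (block_mx a%:M b b^T S) = a * \det S2.
Proof.
have := det_mulmx (block_mx 1%:M 0 (- a^-1 *: b^T) 1%:M) (block_mx a%:M b b^T S).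
rewrite mulmx_block !mul1mx !mul0mx !addr0 mul_mx_scalar scalerA mulrN divff//.
rewrite scaleN1r addNr -scalemxAl addrC scaleNr det_ublock det_lblock !det1 !mul1r.
by rewrite det_mx11 !mxE eqxx mulr1n => <-.
Qed.

(** Completing the square: the Schur complement is the form induced on the quotient by the first
    basis vector. *)
Lemma qform_schur (c : R) v : qform (block_mx a%:M b b^T S) (row_mx c%:M v) =
  a * (c + a^-1 * (b *m v^T) 0 0) ^+ 2 + qform S2 v.
Proof.
rewrite /qform tr_row_mx mul_row_block mul_row_col mulmxDl tr_scalar_mx.
have -> : v *m b^T = (b *m v^T)^T by rewrite trmx_mul trmxK.
rewrite [b *m v^T]mx11_scalar; set y := (b *m v^T) 0 0.
rewrite mulmxDl mulmxBr mulmxBl -scalemxAr -scalemxAl -!mulmxA.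
rewrite (_ : v *m (b^T *m (b *m v^T)) = (y ^+ 2)%:M); last first.
  rewrite mulmxA (_ : v *m b^T = (b *m v^T)^T); last by rewrite trmx_mul trmxK.
  by rewrite [b *m v^T]mx11_scalar -/y tr_scalar_mx -scalar_mxM expr2.
rewrite mulmxA [b *m v^T]mx11_scalar -/y tr_scalar_mx -!scalar_mxM !mxE eqxx !mulr1n.
by field.
Qed.

End Schur.

(* Hermite's induction: an almost shortest vector is completed to a basis, and
   the remaining vectors are size-reduced against it. *)
Lemma reduced_basis N (mu D : R) : 0 < mu -> exists K : R,
  forall S : 'M[R]_N, S^T = S ->
    (forall k : 'rV[int]_N, k != 0 -> mu <= qform S (ri k)) -> \det S <= D ->
  exists2 U : 'M[int]_N, U \in unitmx & forall i, qform S (ri (row i U)) <= K.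
Proof.
elim: N mu D => [|N IH] mu D mu0.
  by exists 0 => S _ _ _; exists 1%:M; [exact: unitmx1|case].
(* The complement [S2] will be at least 2/3 a - 1/4 a = 5/12 a on nonzero rows: a is at most 3/2 of
   the infimum, and a size-reduced lift adds at most a / 4. Its determinant is that of S divided by
   a, hence the bound [|D| / mu]. *)
have mu'0 : 0 < 5 / 12 * mu by rewrite mulr_gt0// divr_gt0.
have [K' HK'] := IH (5 / 12 * mu) (`|D| / mu) mu'0.
exists (`|D| + 4 * `|K'|) => S Ssym Smin Sdet.
pose A := [set qform S (ri k) | k in [set k : 'rV[int]_N.+1 | k != 0]] : set R.
have A0 : A !=set0.
  exists (qform S (ri (const_mx 1))), (const_mx 1) => //=.
  by apply/eqP => /rowP/(_ 0); rewrite !mxE.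
have Amu : lbound A mu by move=> _ [k k0 <-]; exact: Smin.
have infA : has_inf A by split => //; exists mu.
have lmu : mu <= inf A by apply: lb_le_inf.
have linf (k : 'rV[int]_N.+1) : k != 0 -> inf A <= qform S (ri k).
  by move=> k0; apply: ge_inf; [exists mu|exists k].
(* A value within a factor 3/2 of the infimum is enough, so attainment is not an issue. Replacing k
   by its primitive part divides the value by e^2 >= 1. *)
have [|_ [k k0 <-] hk] := @inf_adherent _ A (2^-1 * inf A) _ infA; first by lra.
have [e [U [Uu kU]]] := primitive_row k.
have r0 : row 0 U != 0 by apply: contraNneq k0 => r0; rewrite kU r0 scaler0.
set a := qform S (ri (row 0 U)).
have ainf : inf A <= a by apply: linf.
have ha : a <= 3 / 2 * inf A.
  have e0 : e != 0 by apply: contraNneq k0 => e0; rewrite kU e0 scale0r.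
  have e1 : 1 <= (e%:~R : R) ^+ 2.
    by rewrite -rmorphXn /= ler1z -gtz0_ge1 exprn_even_gt0.
  move: hk; rewrite kU map_mxZ qformZ -/a => hk.
  have : a <= (e%:~R : R) ^+ 2 * a by nra.
  lra.
have a0 : 0 < a by lra.
pose T : 'M[R]_(1 + N) := ri U *m S *m (ri U)^T.
have Tq (x : 'rV[int]_(1 + N)) : qform T (ri x) = qform S (ri (x *m U)).
  by rewrite qform_congr map_mxM.
have Tsym : T^T = T by rewrite /T !trmx_mul trmxK Ssym mulmxA.
have Tdet : \det T = \det S.
  rewrite /T !det_mulmx det_tr mulrAC det_map_mx -rmorphM /=.
  move: Uu; rewrite unitmxE qualifE /= => /orP[] /eqP ->;
  by rewrite ?mulrNN mulr1 rmorph1 mul1r.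
pose b : 'rV[R]_N := ursubmx T; pose S1 : 'M[R]_N := drsubmx T.
have Tul : ulsubmx T = a%:M.
  rewrite [LHS]mx11_scalar; congr (_%:M); rewrite 2!mxE lshift0 /a /qform map_row.
  by rewrite -row_mul /T !mxE; apply: eq_bigr => i _; rewrite !mxE.
have Tbl : T = block_mx a%:M b b^T S1.
  by rewrite -[LHS]submxK Tul -/b -/S1; congr block_mx; rewrite /b trmx_ursub Tsym.
pose S2 := S1 - a^-1 *: (b^T *m b).
have an0 : a != 0 by rewrite gt_eqF.
have nz (c : int) (v : 'rV[int]_N) : v != 0 -> row_mx c%:M v *m U != 0.
  apply: contra_neq => h; have : row_mx c%:M v = 0 :> 'rV_(1 + N).
    by rewrite -[LHS](mulmxK Uu) h mul0mx.
  by move=> h1; rewrite -[v](row_mxKr c%:M) h1 linear0.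
have near (v : 'rV[int]_N) : exists c : int,
    qform S (ri (row_mx c%:M v *m U)) <= a / 4 + qform S2 (ri v).
  have [c hc] := nearest_int (a^-1 * (b *m (ri v)^T) 0 0); exists c.
  rewrite -Tq map_row_mx map_scalar_mx Tbl qform_schur// lerD2r.
  by rewrite ler_pM2l.
have S2min (v : 'rV[int]_N) : v != 0 -> 5 / 12 * a <= qform S2 (ri v).
  move=> v0; have [c hc] := near v; have := linf _ (nz c v v0); lra.
have [|v v0||U2 U2u HU2] := HK' S2.
- rewrite /S2 linearB /= linearZ /= trmx_mul trmxK; congr (_ - _).
  by rewrite /S1 trmx_drsub Tsym.
- by apply: le_trans (S2min _ v0); lra.
- rewrite -(ler_pM2l a0) -(det_schur b S1 an0) -Tbl Tdet mulrA ler_pdivlMr//.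
  apply: (@le_trans _ _ (`|D| * mu)).
    by rewrite ler_pM2r//; apply: le_trans Sdet _; exact: ler_norm.
  by rewrite mulrC ler_wpM2r//; lra.
have [c hc] : {c : 'I_N -> int & forall i,
    qform S (ri (row_mx (c i)%:M (row i U2) *m U)) <= a / 4 + K'}.
  apply: (@choice _ _ (fun i ci => qform S (ri (row_mx ci%:M (row i U2) *m U)) <= a / 4 + K')).
  by move=> i; have [c hc] := near (row i U2); exists c; have := HU2 i; lra.
pose V : 'M[int]_(1 + N) := block_mx 1%:M 0 (\col_i c i) U2.
exists (V *m U).
  by rewrite unitmx_mul Uu andbT unitmxE (@det_lblock _ 1 N) det1 mul1r -unitmxE.
(* For N = 0 the value a is the determinant. Otherwise a reduced row of the complement is nonzero,
   so 5/12 a is at most its value, which is at most K'. *)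
have aK : a <= `|D| + 12 / 5 * `|K'|.
  have := normr_ge0 D; have := normr_ge0 K'; have := ler_norm K'; have := ler_norm D.
  move=> DD KK K0 D0.
  have [N0|N0] := posnP N.
    have : \det T = a by rewrite Tbl det_schur// det_mx0 ?mulr1.
    by rewrite Tdet; lra.
  have : row (Ordinal N0) U2 != 0.
    apply: contraL U2u => /eqP r00; rewrite unitmxE (expand_det_row _ (Ordinal N0)) big1 ?unitr0//.
    by move=> j _; have /rowP/(_ j) := r00; rewrite !mxE => ->; rewrite mul0r.
  by move=> /S2min h; have := HU2 (Ordinal N0); lra.
move=> i; rewrite row_mul; have := normr_ge0 K'; have := ler_norm K'.
move: (split_ordP (i : 'I_(1 + N))) => [j ->|j ->] KK K0.
  rewrite (ord1 j) /V block_mxEv (@rowKu _ 1 N) row_row_mx row1.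
  rewrite row0 (_ : row_mx _ _ = delta_mx 0 0 :> 'rV_(1 + N)); last first.
    apply/rowP => l; rewrite !mxE.
    by case: split_ordP => l' ->; rewrite !mxE ?(ord1 l') ?eqxx.
  by rewrite -rowE -/a; lra.
rewrite /V block_mxEv (@rowKd _ 1 N) row_row_mx.
rewrite (_ : row j (\col_i c i) = (c j)%:M); first by have := hc j; lra.
by apply/rowP => l; rewrite !mxE (ord1 l) eqxx.
Qed.

End LatticeReduction.

(** * Topology of G/H and of its quotient by a subgroup *)

Section CosetSpaces.
Variables (G : topologicalGroupType) (H : set G).
Hypothesis Hgrp : is_subgroup H.
Implicit Types (x y g : G) (Gamma B : set G).

Lemma coset_projP x y :
  coset_proj H x = coset_proj H y <-> exists2 h, H h & y = (x * h)%g.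
Proof.
have [H1 HM HV] := Hgrp.
split=> [/eqmodP /asboolP xy|[h Hh ->]].
  have : lcoset H x y by rewrite xy; exists 1%g => //; rewrite mulg1.
  by case=> h Hh <-; exists h.
apply/eqmodP/asboolP/seteqP; split=> _ [k Hk <-].
- by exists (h^-1 * k)%g; [exact/HM/Hk/HV|rewrite mulgA mulgK].
- by exists (h * k)%g; [exact: HM|rewrite mulgA].
Qed.

Lemma translate_proj g x : translate g (coset_proj H x) = coset_proj H (g * x)%g.
Proof.
have : coset_proj H x = coset_proj H (repr (coset_proj H x : {eq_quot (same_lcoset H)})).
  by rewrite /coset_proj reprK.
by move=> /coset_projP[h Hh E]; apply/esym/coset_projP; exists h; rewrite // E mulgA.
Qed.

Lemma coset_proj_surj (p : coset_space H) : exists x, p = coset_proj H x.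
Proof.
by exists (repr (p : {eq_quot (same_lcoset H)})); rewrite /coset_proj reprK.
Qed.

Lemma coset_proj_continuous : continuous (coset_proj H).
Proof. exact: pi_continuous. Qed.

Lemma mulgr_continuous g : continuous (fun x => (x * g)%g).
Proof.
move=> x; apply: (@continuous_comp _ _ _ (fun y => (y, g)) (fun z : G * G => (z.1 * z.2)%g)).
  by apply: cvg_pair => /=; [exact: cvg_id|exact: cvg_cst].
exact: mulg_continuous.
Qed.

Lemma coset_proj_open B : open B -> open (coset_proj H @` B).
Proof.
move=> oB; rewrite [open _](_ : _ = open (coset_proj H @^-1` (coset_proj H @` B)))//.
rewrite (_ : _ @^-1` _ = \bigcup_(h in H) ((fun x => (x * h)%g) @^-1` B)).
  by apply: bigcup_open => h _; apply: open_comp => // x _; exact: mulgr_continuous.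
have [_ _ HV] := Hgrp.
apply/seteqP; split=> x /=; first by move=> [y By /esym/coset_projP[h Hh yx]]; exists h; rewrite //= -yx.
by move=> [h Hh /= Bxh]; exists (x * h)%g => //; apply/esym/coset_projP; exists h.
Qed.

Variable B : nat -> set G.
Hypothesis Bopen : forall k, open (B k).
Hypothesis Bincr : forall k l, (k <= l)%N -> B k `<=` B l.
Hypothesis Bcover : forall x, exists k, B k x.

(** The images of the [B k] are open and increase to G/H. If none contained K, the sets left over in
    K would generate a proper filter; a cluster point of it lies in some image, which is a
    neighbourhood missing a member of the filter. Thus compact subsets of G/H lift to bounded
    subsets of G. *)
Lemma compact_coset_exhausted (K : set (coset_space H)) :
  compact K -> exists k, K `<=` coset_proj H @` B k.
Proof.
move=> cK; apply: contrapT => /forallNP noB.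
pose F := filter_from [set: nat] (fun k => K `\` (coset_proj H @` B k)).
have FF : ProperFilter F.
  apply: filter_from_proper; last first.
    by move=> k _; have /existsNP[p /not_implyP[Kp Np]] := noB k; exists p.
  apply: filter_from_filter; first by exists 0%N.
  move=> k l _ _; exists (maxn k l) => // p [Kp Np]; split; split=> // -[x Bx xp];
    apply: Np; exists x => //; apply: (Bincr _ Bx); [exact: leq_maxl|exact: leq_maxr].
have [|p [_ clp]] := cK F FF; first by exists 0%N => // p [].
have [x xp] := coset_proj_surj p; have [k Bkx] := Bcover x.
have [||q [[_ Nq] Bq]] := clp (K `\` (coset_proj H @` B k)) (coset_proj H @` B k).
- by exists k.
- by apply: open_nbhs_nbhs; split; [exact: coset_proj_open|exists x].
- exact: Nq.
Qed.

Lemma properly_discontinuous_exhausted Gamma :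
  (forall k, finite_set [set g | Gamma g /\
     exists c1 c2 h, [/\ B k c1, B k c2, H h & c2 = (g * c1 * h)%g]]) ->
  acts_properly_discontinuously Gamma H.
Proof.
move=> fin K /compact_coset_exhausted[k KB].
apply: sub_finite_set (fin k) => g [Gg [_ [/KB[c2 Bc2 <-]]]].
move=> [_ /KB[c1 Bc1 <-]]; rewrite translate_proj => /coset_projP[h Hh E].
by split=> //; exists c1, c2, h.
Qed.

Lemma double_coset_compact Gamma (D : set G) : is_subgroup Gamma -> compact D ->
  (forall x, exists g h, [/\ Gamma g, H h & D (g * x * h)%g]) ->
  compact [set: double_coset_space Gamma H].
Proof.
move=> [G1 GM GV] cD xD.
pose f (x : G) : double_coset_space Gamma H :=
  \pi_({eq_quot (@same_orbit G Gamma H)})%qT (coset_proj H x).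
rewrite (_ : setT = f @` D); last first.
  apply/seteqP; split=> // q _; rewrite -[q]reprK.
  have [x ->] := coset_proj_surj (repr q).
  have [g [h [Gg Hh Dx]]] := xD x; exists (g * x * h)%g => //.
  apply/eqmodP/asboolP.
  have -> : coset_proj H (g * x * h)%g = coset_proj H (g * x)%g.
    by apply/esym/coset_projP; exists h.
  apply/seteqP; split=> _ [k Gk <-]; rewrite translate_proj.
  - by exists (k * g)%g; [exact: GM|rewrite translate_proj mulgA].
  - exists (k * g^-1)%g; first exact/GM/GV.
    by rewrite translate_proj -mulgA mulKg.
apply: continuous_compact => //; apply: continuous_subspaceT => x.
apply: (@continuous_comp _ _ _ (coset_proj H)); first exact: coset_proj_continuous.
exact: pi_continuous.
Qed.

End CosetSpaces.

(** * Compactness of bounded subsets of SU *)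

Section ComplexTopology.
Variable R : realType.
Local Notation C := R[i].
Local Open Scope complex_scope.

Definition mxbd p q (b : C) (A : 'M[C]_(p, q)) := forall i j, `|A i j| <= b.

Lemma mxbd_mul p q r a b (A : 'M[C]_(p, q)) (B : 'M[C]_(q, r)) :
  mxbd a A -> mxbd b B -> mxbd (q%:R * (a * b)) (A *m B).
Proof.
move=> Aa Bb i j; rewrite mxE (le_trans (ler_norm_sum _ _ _))//.
rewrite mulr_natl -[X in _ *+ X]card_ord -sumr_const; apply: ler_sum => k _.
by rewrite normrM ler_pM.
Qed.

Lemma real_complex_continuous : continuous (fun x : R => x%:C).
Proof.
move=> x; apply/cvgrPdist_lt => /= e e0.
have eE : e = (complex.Re e)%:C.
  by rewrite [LHS]complexE (_ : complex.Im e = 0) ?mulr0 ?addr0//; move: e0; rewrite ltcE => /andP[/eqP].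
have e'0 : 0 < complex.Re e by rewrite -ltcR -eE.
near=> y; rewrite -rmorphB /= normc_def /= expr0n /= addr0 sqrtr_sqr eE ltcR.
by near: y; exact: cvgr_dist_lt.
Unshelve. all: by end_near.
Qed.

Lemma normr_ge_Im (z : C) : `|complex.Im z|%:C <= `|z|.
Proof.
by rewrite normc_def lecR -sqrtr_sqr ler_wsqrtr// lerDr sqr_ge0.
Qed.

Lemma cvgCM T (F : set_system T) {FF : Filter F} (f g : T -> C) (a b : C) :
  f x @[x --> F] --> a -> g x @[x --> F] --> b ->
  f x * g x @[x --> F] --> a * b.
Proof. exact: (@cvgM C). Qed.

Lemma cvgCD T (F : set_system T) {FF : Filter F} (f g : T -> C) (a b : C) :
  f x @[x --> F] --> a -> g x @[x --> F] --> b ->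
  f x + g x @[x --> F] --> a + b.
Proof. exact: (@cvgD C C). Qed.

Lemma cvgCcst T (F : set_system T) {FF : Filter F} (a : C) : a @[_ --> F] --> a.
Proof. exact: (@cvg_cst C). Qed.

Lemma cvgC_sum T (F : set_system T) {FF : Filter F} (I : finType) (f : I -> T -> C)
    (a : I -> C) : (forall i, f i x @[x --> F] --> a i) ->
  \sum_i f i x @[x --> F] --> \sum_i a i.
Proof.
move=> fa; apply: cvg_big => [|i _]; first exact: add_continuous.
exact: fa.
Qed.

Lemma cvgC_prod T (F : set_system T) {FF : Filter F} (I : finType) (f : I -> T -> C)
    (a : I -> C) : (forall i, f i x @[x --> F] --> a i) ->
  \prod_i f i x @[x --> F] --> \prod_i a i.
Proof.
move=> fa; apply: cvg_big => [|i _]; first exact: mul_continuous.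
exact: fa.
Qed.

Lemma cvg_complex T (F : set_system T) {FF : Filter F} (f : T -> C) (a b : R) :
  complex.Re (f x) @[x --> F] --> a -> complex.Im (f x) @[x --> F] --> b ->
  (f x @[x --> F] --> a +i* b) /\ (conjC (f x) @[x --> F] --> conjC (a +i* b)).
Proof.
move=> fa fb.
have fa' : (complex.Re (f x))%:C @[x --> F] --> a%:C.
  by apply: continuous_cvg fa; exact: real_complex_continuous.
have fb' : (complex.Im (f x))%:C @[x --> F] --> b%:C.
  by apply: continuous_cvg fb; exact: real_complex_continuous.
split.
  rewrite [f](_ : _ = fun x => (complex.Re (f x))%:C + 'i%C * (complex.Im (f x))%:C).
    rewrite (_ : a +i* b = a%:C + 'i%C * b%:C); last by simpc.
    exact: cvgCD fa' (cvgCM (@cvgCcst T F FF 'i%C) fb').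
  by apply/funext => x; rewrite -complexE.
rewrite [X in X @ _](_ : _ =
    fun x => (complex.Re (f x))%:C + (- 'i%C) * (complex.Im (f x))%:C).
  rewrite (_ : conjC _ = a%:C + (- 'i%C) * b%:C); last by simpc.
  exact: cvgCD fa' (cvgCM (@cvgCcst T F FF (- 'i%C)) fb').
by apply/funext => x; case: (f x) => u v /=; simpc.
Qed.

Lemma fmap_ultra T U (F : set_system T) (f : T -> U) :
  UltraFilter F -> UltraFilter (f @ F).
Proof.
move=> FF; split=> [|G GF FG]; first exact: fmap_proper_filter.
apply/seteqP; split=> // A GA.
have [//|FnA] := in_ultra_setVsetC (f @^-1` A) FF.
have GnA : G (~` A) by exact: FG.
by case: (filter_ex (filterI GA GnA)) => x [].
Qed.

Lemma ultra_bounded_cvg T (F : set_system T) {FF : UltraFilter F} (f : T -> R) (b : R) :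
  F [set x | `|f x| <= b] -> exists2 l, f x @[x --> F] --> l & `|l| <= b.
Proof.
move=> Fb.
have := @segment_compact R (- b) b; rewrite compact_ultra => /(_ (f @ F)).
case=> [||l []].
- exact: fmap_ultra.
- change (F (f @^-1` `[- b, b]%classic)).
  by apply: filterS Fb => x /=; rewrite in_itv /= ler_norml.
- by rewrite /= in_itv /= -ler_norml; exists l.
Qed.

(** Along an ultrafilter on the box every real and imaginary part converges, as it stays in a
    compact segment, and the equations of SU pass to the limit. The limits of the conjugate entries
    are carried along because the adjoint occurs in these equations. *)
Lemma SU_box_compact n (b : R) : compact [set g : SU R n |
  forall i j, `|complex.Re (\val g i j)| <= b /\ `|complex.Im (\val g i j)| <= b].
Proof.
rewrite compact_ultra => F FF Fb.
have lim (i j : 'I_n.+2) : exists z : C,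
    [/\ \val (g : SU R n) i j @[g --> F] --> z,
        conjC (\val (g : SU R n) i j) @[g --> F] --> conjC z &
        `|complex.Re z| <= b /\ `|complex.Im z| <= b].
  have [x fx xb] : exists2 l, complex.Re (\val (g : SU R n) i j) @[g --> F] --> l & `|l| <= b.
    by apply: ultra_bounded_cvg; apply: (filterS _ Fb) => g gb /=; case: (gb i j).
  have [y fy yb] : exists2 l, complex.Im (\val (g : SU R n) i j) @[g --> F] --> l & `|l| <= b.
    by apply: ultra_bounded_cvg; apply: (filterS _ Fb) => g gb /=; case: (gb i j).
  have [fz fzc] := cvg_complex fx fy; exists (x +i* y).
  by split; [exact: fz|exact: fzc|split; [exact: xb|exact: yb]].
have /choice[A0 hA] : forall ij : 'I_n.+2 * 'I_n.+2, exists z : C,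
    [/\ \val (g : SU R n) ij.1 ij.2 @[g --> F] --> z,
        conjC (\val (g : SU R n) ij.1 ij.2) @[g --> F] --> conjC z &
        `|complex.Re z| <= b /\ `|complex.Im z| <= b].
  by move=> [i j]; exact: lim.
pose A : 'M[C]_n.+2 := \matrix_(i, j) A0 (i, j).
have Ac i j : \val (g : SU R n) i j @[g --> F] --> A i j.
  by rewrite mxE; have [h _ _] := hA (i, j); exact: h.
have Acc i j : conjC (\val (g : SU R n) i j) @[g --> F] --> conjC (A i j).
  by rewrite mxE; have [_ h _] := hA (i, j); exact: h.
have cst_lim (f : SU R n -> C) (u v : C) : (forall g, f g = u) -> f g @[g --> F] --> v -> v = u.
  move=> fu fv; have fE : f = fun=> u by exact/funext.
  have fu' : f g @[g --> F] --> u by rewrite fE; exact: cvgCcst.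
  exact: (@cvg_unique _ (@norm_hausdorff C C) (f @ F) _ _ _ fv fu').
have SA : SU_set A.
  split.
    apply/matrixP => i j.
    apply: (cst_lim (fun g => (\val g *m Jform R n *m (\val g)^t*) i j)).
      by move=> g; case: (SUP g) => ->.
    rewrite mxE [X in X @ _](_ : _ = fun g : SU R n => \sum_k
      (\val g *m Jform R n) i k * (\val g)^t* k j); last by apply/funext => g; rewrite mxE.
    apply: cvgC_sum => k.
    apply: cvgCM; last first.
      rewrite (_ : (A^t*) k j = conjC (A j k)); last by rewrite mxE mxE.
      rewrite [X in X @ _](_ : _ = fun g : SU R n => conjC (\val g j k)).
        exact: Acc.
      by apply/funext => g; rewrite mxE mxE.
    rewrite mxE [X in X @ _](_ : _ = fun g : SU R n => \sum_l
      \val g i l * Jform R n l k); last by apply/funext => g; rewrite mxE.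
    apply: cvgC_sum => l.
    exact: (cvgCM (Ac i l) (@cvgCcst _ F _ _)).
  apply: (cst_lim (fun g => \det (\val g))); first by move=> g; case: (SUP g).
  apply: cvgC_sum => s.
  apply: cvgCM; first exact: cvgCcst.
  by apply: cvgC_prod => k; exact: Ac.
exists (SU_of SA); split.
  by move=> i j /=; rewrite mxE; case: (hA (i, j)).
move=> B [_ [[B' oB' <-] B'A] B'B]; apply: (filterS B'B).
have [P /= PA PB] : nbhs A B' by rewrite nbhsE; exists B'.
have : F [set g : SU R n | forall i j, P i j (\val g i j)].
  apply: filter_forall => i; apply: filter_forall => j.
  exact: (Ac i j _ (PA i j)).
by apply: filterS => g Pg; exact: PB.
Qed.

Lemma mxbd_compact n (b : C) :
  exists2 D : set (SU R n), compact D & forall g : SU R n, mxbd b (\val g) -> D g.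
Proof.
eexists; first exact: (@SU_box_compact n (complex.Re b)).
move=> g gb i j; rewrite -!lecR (RRe_real (ger0_real (le_trans _ (gb i j))))//.
split; apply: le_trans (gb i j); [exact: normc_ge_Re|exact: normr_ge_Im].
Qed.

End ComplexTopology.

(** * A criterion for crystallographic groups in terms of matrix entries *)

Section TessellationCriterion.
Variables (R : realType) (n : nat).
Local Notation C := R[i].

Definition SU_ball (k : nat) : set (SU R n) :=
  [set g : SU R n | forall i j, `|\val g i j| < k%:R].

Lemma SU_ball_open k : open (SU_ball k).
Proof.
rewrite openE => g gk.
have : nbhs g [set y : SU R n | forall i j, `|\val y i j| < k%:R]; last exact.
have ff := @nbhs_filter (SU R n) g.
apply: (@filter_forall _ _ _ (nbhs g) ff) => i.
apply: (@filter_forall _ _ _ (nbhs g) ff) => j.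
exact: (@cvgr_norm_lt C C _ _ ff _ _ (@SU_coord_continuous R n i j g) k%:R (gk i j)).
Qed.

Lemma SU_ballS k l : (k <= l)%N -> SU_ball k `<=` SU_ball l.
Proof. by move=> kl g gk i j; rewrite (lt_le_trans (gk i j))// ler_nat. Qed.

Lemma complex_nat_bound (z : C) : exists k : nat, `|z| < k%:R.
Proof.
have [k hk] : exists k : nat, complex.Re `|z| < k%:R.
  by exists (Num.bound (complex.Re `|z|)); rewrite archi_boundP// normc_def sqrtr_ge0.
exists k; rewrite -(RRe_real (normr_real z)) (_ : k%:R = real_complex R k%:R) ?ltcR//.
by rewrite rmorph_nat.
Qed.

Lemma mxbd_exists p q (A : 'M[C]_(p, q)) : exists k : nat, forall i j, `|A i j| < k%:R.
Proof.
have /choice[f hf] : forall ij : 'I_p * 'I_q, exists k : nat, `|A ij.1 ij.2| < k%:R.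
  by move=> ij; exact: complex_nat_bound.
exists (\max_ij f ij)%N => i j; apply: (lt_le_trans (hf (i, j))).
by rewrite ler_nat; exact: (leq_bigmax (i, j)).
Qed.

(** A ball around g contains finitely many other elements of Gamma; they form a closed set, whose
    removal leaves a neighbourhood of g. *)
Lemma SU_isolated (Gamma : set (SU R n)) :
  (forall b : C, finite_set [set g | Gamma g /\ mxbd b (\val g)]) ->
  Gamma `<=` isolated Gamma.
Proof.
move=> fin g Gg; split; first exact: mem_set.
have [k gk] := mxbd_exists (\val g).
pose S := [set x | Gamma x /\ mxbd k%:R (\val x)] `\ g.
have finS : finite_set S by apply: finite_setD; exact: fin.
have closed1 (x : SU R n) : closed [set x].
  rewrite -openC openE => y /= yx.
  have /existsNP[i /existsNP[j yxij]] : ~ (forall i j, \val y i j = \val x i j).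
    by move=> /matrixP/val_inj.
  have yx0 : 0 < `|\val y i j - \val x i j| by rewrite normr_gt0 subr_eq0; exact/eqP.
  have := @SU_coord_continuous R n i j y; move/cvgrPdist_lt => /(_ _ yx0).
  by apply: filterS => z; rewrite /= => + zx; rewrite zx ltxx.
have clS : closed S.
  rewrite (_ : S = \bigcup_(x in S) [set x]); first exact: closed_bigcup.
  by apply/seteqP; split=> x Sx; [exists x|case: Sx => y Sy ->].
exists (SU_ball k `&` ~` S).
  apply: filterI; apply: open_nbhs_nbhs; split=> //; first exact: SU_ball_open.
    by rewrite openC.
  by case=> _; exact.
apply/seteqP; split=> [x [[xk Ux] Gx]|_ -> //].
  apply: contrapT => xg; apply: Ux; split=> //; split=> // i j.
  exact/ltW/xk.
by split=> //; split=> // -[_]; exact.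
Qed.

(** All topology is disposed of here: entrywise balls are open, exhaust SU and lie in compact sets,
    so what remains are bounds on entries. Finiteness in balls gives discreteness and, combined with
    the properness bound, proper discontinuity; bounded representatives of the double cosets give
    compactness. *)
Lemma crystallographic_criterion (Gamma H : set (SU R n)) :
  is_subgroup H -> is_subgroup Gamma ->
  (forall b : C, finite_set [set g | Gamma g /\ mxbd b (\val g)]) ->
  (forall b : C, exists b' : C, forall g c1 c2 h : SU R n, Gamma g -> H h ->
     mxbd b (\val c1) -> mxbd b (\val c2) -> c2 = (g * c1 * h)%g ->
     mxbd b' (\val g)) ->
  (exists b : C, forall x : SU R n, exists g h : SU R n,
     [/\ Gamma g, H h & mxbd b (\val (g * x * h)%g)]) ->
  crystallographic Gamma H.
Proof.
move=> Hgrp Ggrp fin proper [b cocompact]; split.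
- by split=> //; exact: SU_isolated.
- apply: (properly_discontinuous_exhausted Hgrp SU_ball_open SU_ballS).
    by move=> x; exact: mxbd_exists.
  move=> k; have [b' hb'] := proper k%:R.
  apply: sub_finite_set (fin b') => g /= [Gg [c1 [c2 [h [B1 B2 Hh E]]]]].
  by split=> //; apply: (hb' g c1 c2 h) => // i j; apply: ltW; [exact: B1|exact: B2].
- have [D cD bD] := @mxbd_compact R n b.
  apply: (double_coset_compact Hgrp Ggrp cD) => x.
  by have [g [h [Gg Hh gxh]]] := cocompact x; exists g, h; split=> //; exact: bD.
Qed.

End TessellationCriterion.

(** * The hermitian form, its unipotent isometries and its dilations *)

Section Horospherical.
Variables (C : numClosedFieldType) (n : nat).
Local Notation M := 'M[C]_n.+2.
Local Notation V := 'rV[C]_n.+2.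
Implicit Types (v w : V) (z a : C) (i j : 'I_n.+2).

(** The involution of which [J] is the permutation matrix; multiplication by [J] thus only permutes
    rows or columns. *)
Definition tau i : 'I_n.+2 := if (2 <= i < n)%N then i else rev_ord i.

Lemma tauK : involutive tau.
Proof.
move=> i; rewrite {2}/tau; case: ifPn => [hi|hi]; first by rewrite /tau hi.
rewrite /tau ifF ?rev_ordK//=; apply/negbTE; move: hi; rewrite !negb_and -!leqNgt.
by have := ltn_ord i; lia.
Qed.

Definition Jmx : M := \matrix_(i, j) (j == tau i)%:R.
Local Notation J := Jmx.
Local Notation o1 := (Ordinal (isT : 1 < n.+2)%N).
Local Notation on := (tau o1).

Lemma tau0 : tau ord0 = ord_max.
Proof. by rewrite /tau /=; apply: val_inj => /=; rewrite subn1. Qed.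

Lemma tau_max : tau ord_max = ord0.
Proof. by rewrite -tau0 tauK. Qed.

Lemma val_on : (0 < n)%N -> val on = n.
Proof. by rewrite /tau /= => n0; lia. Qed.

Lemma tau_mid i : (2 <= i < n)%N -> tau i = i.
Proof. by rewrite /tau => ->. Qed.

Lemma Jform_tau i j : J i j = (j == tau i)%:R.
Proof. by rewrite mxE. Qed.

Lemma mulmxJ p (A : 'M[C]_(p, n.+2)) (i : 'I_p) j : (A *m J) i j = A i (tau j).
Proof.
rewrite mxE (bigD1 (tau j))//= big1 ?addr0 => [|k kj].
  by rewrite Jform_tau tauK eqxx mulr1.
by rewrite Jform_tau -(inj_eq (inv_inj tauK)) tauK eq_sym (negPf kj) mulr0.
Qed.

Lemma mulJmx p (A : 'M[C]_(n.+2, p)) i (j : 'I_p) : (J *m A) i j = A (tau i) j.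
Proof.
rewrite mxE (bigD1 (tau i))//= big1 ?addr0 => [|k kj].
  by rewrite Jform_tau eqxx mul1r.
by rewrite Jform_tau (negPf kj) mul0r.
Qed.

Lemma JJ : J *m J = 1%:M.
Proof. by apply/matrixP => i j; rewrite mulJmx Jform_tau tauK mxE eq_sym. Qed.

Lemma conjJ : map_mx conjC J = J.
Proof. by apply/matrixP => i j; rewrite mxE Jform_tau rmorph_nat. Qed.

Lemma J_unit : J \in unitmx.
Proof. by case: (mulmx1_unit JJ). Qed.

Lemma adj_mul p q r (A : 'M[C]_(p, q)) (B : 'M[C]_(q, r)) :
  (A *m B)^t* = B^t* *m A^t*.
Proof. by rewrite trmx_mul map_mxM. Qed.

Lemma adjK p q (A : 'M[C]_(p, q)) : (A^t*)^t* = A.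
Proof. by apply/matrixP => i j; rewrite !mxE conjCK. Qed.

Definition herm v w : C := (v *m J *m w^t*) 0 0.

Lemma hermE v w : v *m J *m w^t* = (herm v w)%:M.
Proof. exact: mx11_scalar. Qed.

Lemma herm_sum v w : herm v w = \sum_i v 0 (tau i) * conjC (w 0 i).
Proof. by rewrite /herm mxE; apply: eq_bigr => i _; rewrite mulmxJ !mxE. Qed.

Lemma herm_conj v w : herm w v = conjC (herm v w).
Proof.
rewrite !herm_sum rmorph_sum /= (reindex_inj (inv_inj tauK)) /=.
by apply: eq_bigr => i _; rewrite tauK rmorphM /= conjCK mulrC.
Qed.

Lemma hermDl u v w : herm (u + v) w = herm u w + herm v w.
Proof. by rewrite /herm !mulmxDl mxE. Qed.
Lemma hermZl a v w : herm (a *: v) w = a * herm v w.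
Proof. by rewrite /herm -!scalemxAl mxE. Qed.
Lemma hermDr u v w : herm w (u + v) = herm w u + herm w v.
Proof. by rewrite !(herm_conj _ w) hermDl rmorphD. Qed.
Lemma hermZr a v w : herm w (a *: v) = conjC a * herm w v.
Proof. by rewrite !(herm_conj _ w) hermZl rmorphM. Qed.
Lemma hermNl v w : herm (- v) w = - herm v w.
Proof. by rewrite -scaleN1r hermZl mulN1r. Qed.
Lemma hermNr v w : herm w (- v) = - herm w v.
Proof. by rewrite -scaleN1r hermZr rmorphN rmorph1 mulN1r. Qed.

Definition e0 : V := delta_mx 0 ord0.
Definition eM : V := delta_mx 0 ord_max.
Definition hcol w : 'cV[C]_n.+2 := J *m w^t*.
Local Notation E := (e0^T : 'cV[C]_n.+2).

Lemma mulE v : v *m E = (v 0 ord0)%:M.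
Proof.
rewrite [LHS]mx11_scalar; congr (_%:M).
rewrite mxE (bigD1 ord0)//= big1 ?addr0 => [|i i0]; rewrite !mxE ?eqxx ?mulr1//.
by rewrite (negPf i0) mulr0.
Qed.

Lemma mul_hcol v w : v *m hcol w = (herm v w)%:M.
Proof. by rewrite /hcol mulmxA hermE. Qed.

Lemma hcol_eM : hcol eM = E.
Proof.
apply/matrixP => i j; rewrite mulJmx !mxE (ord1 j) eqxx /= rmorph_nat.
by rewrite -(inj_eq (inv_inj tauK)) tauK tau_max.
Qed.

Lemma herm_eM v : herm v eM = v 0 ord0.
Proof.
by have := mul_hcol v eM; rewrite hcol_eM mulE => /matrixP/(_ 0 0); rewrite !mxE eqxx !mulr1n.
Qed.

Lemma herm_e0 v : herm v e0 = v 0 ord_max.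
Proof. by rewrite herm_sum (bigD1 ord0)//= big1 ?addr0 => [|i i0]; rewrite !mxE ?tau0 ?(negPf i0) eqxx ?rmorph0 ?rmorph1 ?mulr0 ?mulr1. Qed.

(** The Eichler transformation attached to the isotropic vector [eM]: its first row is (1, w, z)
    when w is orthogonal to [e0] and [eM]. For such w and with real part of z equal to
    [- herm w w / 2], these are the isometries forming the Heisenberg group; [unipD] shows its
    cocycle, [herm]. *)
Definition unip w z : M := 1%:M + E *m w - hcol w *m eM + z *: (E *m eM).

Lemma mul_unip p (A : 'M[C]_(p, n.+2)) w z :
  A *m unip w z = A + A *m E *m w - A *m hcol w *m eM + z *: (A *m E *m eM).
Proof. by rewrite /unip mulmxDr mulmxBr mulmxDr mulmx1 -scalemxAr !mulmxA. Qed.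

Lemma row_unip v w z : v *m unip w z =
  v + v 0 ord0 *: w - herm v w *: eM + (z * v 0 ord0) *: eM.
Proof. by rewrite mul_unip mulE mul_hcol !mul_scalar_mx scalerA. Qed.

Definition mid w := w 0 ord0 = 0 /\ w 0 ord_max = 0.

Lemma eMmax : eM 0 ord_max = 1. Proof. by rewrite mxE !eqxx. Qed.
Lemma eM0 : eM 0 ord0 = 0. Proof. by rewrite mxE. Qed.
Lemma e00 : e0 0 ord0 = 1. Proof. by rewrite mxE !eqxx. Qed.
Lemma e0max : e0 0 ord_max = 0. Proof. by rewrite mxE. Qed.
Lemma herm_eMl v : herm eM v = conjC (v 0 ord0).
Proof. by rewrite herm_conj herm_eM. Qed.
Lemma herm_e0l v : herm e0 v = conjC (v 0 ord_max).
Proof. by rewrite herm_conj herm_e0. Qed.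

Lemma mx_rowP p q (A B : 'M[C]_(p, q)) : (forall v : 'rV_p, v *m A = v *m B) -> A = B.
Proof. by move=> AB; apply/row_matrixP => i; rewrite !rowE. Qed.

Lemma unipD w z w' z' : mid w -> mid w' ->
  unip w z *m unip w' z' = unip (w + w') (z + z' - herm w w').
Proof.
move=> [w0 wM] [w'0 w'M]; apply: mx_rowP => v; rewrite mulmxA !row_unip.
set v1 := v + _ - _ + _.
have -> : v1 0 ord0 = v 0 ord0 by rewrite /v1 !mxE w0 /=; ring.
have -> : herm v1 w' = herm v w' + v 0 ord0 * herm w w'.
  by rewrite /v1 !(hermDl, hermNl, hermZl) herm_eMl w'0 rmorph0; ring.
by rewrite /v1 hermDr; apply/rowP => j; rewrite !mxE; ring.
Qed.

Lemma unip00 : unip 0 0 = 1%:M.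
Proof.
apply: mx_rowP => v; rewrite row_unip mulmx1 scaler0 mul0r scale0r !addr0.
by rewrite -[X in herm v X](scale0r 0) hermZr rmorph0 mul0r scale0r subr0.
Qed.

Definition dg a : M := 1%:M + (a - 1) *: (E *m e0) + (a^-1 - 1) *: (eM^T *m eM).

Lemma mulEM v : v *m eM^T = (v 0 ord_max)%:M.
Proof.
rewrite [LHS]mx11_scalar; congr (_%:M).
rewrite mxE (bigD1 ord_max)//= big1 ?addr0 => [|i i0]; rewrite !mxE ?eqxx ?mulr1//.
by rewrite (negPf i0) mulr0.
Qed.

Lemma row_dg v a : v *m dg a =
  v + ((a - 1) * v 0 ord0) *: e0 + ((a^-1 - 1) * v 0 ord_max) *: eM.
Proof.
rewrite /dg !mulmxDr mulmx1 -!scalemxAr !mulmxA mulE mulEM !mul_scalar_mx.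
by rewrite !scalerA.
Qed.

Lemma dgM a b : a != 0 -> b != 0 -> dg a *m dg b = dg (a * b).
Proof.
move=> a0 b0; apply: mx_rowP => v; rewrite mulmxA !row_dg; apply/rowP => j.
rewrite !mxE !eqxx /= !mulr1 !mulr0 !addr0 invfM.
by field; rewrite a0 b0.
Qed.

Lemma dg1 : dg 1 = 1%:M.
Proof. by rewrite /dg invr1 subrr !scale0r !addr0. Qed.

Lemma dg_unip a w z : a != 0 -> conjC a = a -> mid w ->
  dg a *m unip w z = unip (a *: w) (a ^+ 2 * z) *m dg a.
Proof.
move=> a0 aR [w0 wM]; apply: mx_rowP => v; rewrite !mulmxA !(row_unip, row_dg).
rewrite hermZr !(hermDl, hermZl) herm_e0l herm_eMl w0 wM !rmorph0 !mulr0 !addr0 aR.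
apply/rowP => j; rewrite !mxE !eqxx w0 wM /= !mulr1 !mulr0 !addr0.
by field.
Qed.

(** The coordinates scaled by a and by its inverse are paired with each other by the form. *)
Lemma herm_dg a v w : a != 0 -> conjC a = a -> herm (v *m dg a) (w *m dg a) = herm v w.
Proof.
move=> a0 aR; rewrite !row_dg !(hermDl, hermZl, hermDr, hermZr, herm_eM, herm_eMl, herm_e0, herm_e0l).
rewrite !mxE !eqxx /= !rmorphM /= !rmorphB /= fmorphV /= aR !rmorph1 !rmorph0.
by field.
Qed.

Lemma herm_unip w z u v : mid w -> z + conjC z = - herm w w ->
  herm (u *m unip w z) (v *m unip w z) = herm u v.
Proof.
move=> [w0 wM] zz; have zc : conjC z = - herm w w - z by rewrite -zz; ring.
rewrite !row_unip !(hermDl, hermNl, hermZl, hermDr, hermNr, hermZr, herm_eM, herm_eMl).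
rewrite w0 eM0 !rmorphM /= zc.
rewrite (herm_conj v w) !mxE /= !rmorphN /= !rmorphM /= !rmorph0.
by ring.
Qed.

Lemma hermP (A : M) : (forall u v, herm (u *m A) (v *m A) = herm u v) -> A *m J *m A^t* = J.
Proof.
move=> hA; apply/matrixP => i j.
have := hA (delta_mx 0 i) (delta_mx 0 j).
rewrite /herm adj_mul !mulmxA -[_ *m A *m J]mulmxA -[_ *m (A *m J) *m _]mulmxA -!rowE.
rewrite (_ : (delta_mx 0 j)^t* = delta_mx j 0 :> 'cV[C]_n.+2); last first.
  by apply/matrixP => k l; rewrite !mxE rmorph_nat andbC.
by rewrite -!colE !mxE.
Qed.

Lemma det_unip w z : mid w -> \det (unip w z) = 1.
Proof.
move=> [w0 wM]; have utrig : is_trig_mx (unip w z)^T.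
  apply/is_trig_mxP => i j ij; rewrite mxE.
  have -> : unip w z j i = ((delta_mx 0 j : V) *m unip w z) 0 i by rewrite -rowE [RHS]mxE.
  rewrite row_unip !mxE !eqxx /=.
  have ij' : (i == j) = false by apply/negbTE; rewrite neq_ltn ij.
  have j0 : (ord0 == j) = false by apply/negbTE; rewrite neq_ltn /= (leq_ltn_trans _ ij).
  have iM : (i == ord_max) = false by apply/negbTE; rewrite neq_ltn /= (leq_trans ij)// -ltnS.
  by rewrite ij' j0 iM !(mulr0, mul0r, addr0, subr0).
rewrite -det_tr det_trig// big1 // => i _; rewrite mxE.
have -> : unip w z i i = ((delta_mx 0 i : V) *m unip w z) 0 i by rewrite -rowE [RHS]mxE.
rewrite row_unip !mxE !eqxx /=.
have [<-|i0] := eqVneq ord0 i; first by rewrite w0 !mulr0 !addr0 subr0.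
case: (eqVneq i ord_max) => [iM|iM]; last by rewrite !(mulr0, mul0r, addr0, subr0).
by rewrite iM -/eM herm_eMl w0 rmorph0 /=; ring.
Qed.

Lemma diag_corner (x y : C) : x *: (E *m e0) + y *: (eM^T *m eM) =
  diag_mx (\row_i (if i == ord0 then x else if i == ord_max then y else 0)).
Proof.
rewrite !trmx_delta !mul_delta_mx; apply/matrixP => i j; rewrite !mxE.
have [<-|ij] := eqVneq i j; rewrite ?mulr1n ?mulr0n.
  have [->|i0] := eqVneq i ord0; first by rewrite /=; ring.
  by case: eqVneq => _ /=; ring.
have [i0|i0] := eqVneq i ord0.
  by rewrite -i0 (eq_sym j i) (negPf ij) i0 /=; ring.
have [iM|iM] := eqVneq i ord_max; last by rewrite /=; ring.
by rewrite -iM (eq_sym j i) (negPf ij) /=; ring.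
Qed.

Lemma dg_diag a : dg a =
  diag_mx (\row_i (if i == ord0 then a else if i == ord_max then a^-1 else 1)).
Proof.
rewrite /dg -addrA diag_corner; apply/matrixP => i j; rewrite !mxE.
have [_|_] := eqVneq i j; rewrite ?mulr1n ?mulr0n ?addr0//.
by case: eqP => _; [|case: eqP => _]; ring.
Qed.

Lemma det_dg a : a != 0 -> \det (dg a) = 1.
Proof.
move=> a0; rewrite dg_diag det_diag big_ord_recl /= big_ord_recr /= !mxE /=.
rewrite (_ : lift _ _ == ord_max) ?mulfV ?mulr1//; last by rewrite -val_eqE.
rewrite big1 => [|i _]; last first.
  rewrite mxE /= (_ : (lift _ _ == ord_max) = false)// -val_eqE /= /bump /=.
  by have := ltn_ord i; lia.
by rewrite mul1r mulfV.
Qed.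

End Horospherical.

(** * Moving a quaternionic structure to one that commutes with J *)

Section QuaternionicStructures.
Variables (C : numClosedFieldType) (n : nat).
Hypothesis n_gt1 : (1 < n)%N.
Local Notation M := 'M[C]_n.+2.
Local Notation V := 'rV[C]_n.+2.
Local Notation J := (Jmx C n).
Local Notation e0 := (e0 C n).
Local Notation eM := (eM C n).
Implicit Types (v w u : V) (P h : M).

(* [P] encodes the antilinear map [jmap P], a quaternionic structure that is
   compatible with the hermitian form [J]. *)
Definition quat P := P *m J *m P^t* = J /\ map_mx conjC P *m P = - 1%:M.

Definition jmap P v : V := map_mx conjC v *m P.

Lemma map_conjK p q (A : 'M[C]_(p, q)) : map_mx conjC (map_mx conjC A) = A.
Proof. by apply/matrixP => i j; rewrite !mxE conjCK. Qed.

Section Jmap.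
Variable P : M.
Local Notation j := (jmap P).

Lemma jmapD u v : j (u + v) = j u + j v.
Proof. by rewrite /jmap map_mxD mulmxDl. Qed.
Lemma jmapZ a v : j (a *: v) = conjC a *: j v.
Proof. by rewrite /jmap map_mxZ scalemxAl. Qed.
Lemma jmapN v : j (- v) = - j v.
Proof. by rewrite -scaleN1r jmapZ rmorphN rmorph1 scaleN1r. Qed.

Hypothesis quatP : quat P.

Lemma jmapK v : j (j v) = - v.
Proof.
have [_ PP] := quatP.
by rewrite /jmap map_mxM map_conjK -mulmxA PP mulmxN mulmx1.
Qed.

Lemma herm_jmap v w : herm (j v) (j w) = conjC (herm v w).
Proof.
have [PJ _] := quatP; rewrite /jmap /herm adj_mul !mulmxA.
rewrite -[_ *m P *m J]mulmxA -[_ *m (P *m J) *m _]mulmxA PJ.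
rewrite -/(herm _ _) -/(herm v w) !herm_sum rmorph_sum /=; apply: eq_bigr => k _.
by rewrite !mxE rmorphM.
Qed.

(** Applying j to both arguments of [herm (j v) v] conjugates the value, while j^2 = -1 turns it
    into minus its conjugate. *)
Lemma herm_jmap_self v : herm (j v) v = 0.
Proof.
have := herm_jmap (j v) v; rewrite jmapK hermNl (herm_conj (j v) v) => /eqP.
by rewrite eq_sym -subr_eq0 opprK -mulr2n mulrn_eq0 /= conjC_eq0 => /eqP.
Qed.

End Jmap.

(** The structure h^-1 j h, for h acting on rows from the right: [jmap_act] says that h intertwines
    [jmap P] with [jmap (actq P h)]. *)
Definition actq P h : M := map_mx conjC (invmx h) *m P *m h.

Lemma jmap_act P h v : h \in unitmx -> jmap (actq P h) (v *m h) = jmap P v *m h.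
Proof.
by move=> hu; rewrite /jmap /actq map_mxM !mulmxA -[_ *m map_mx _ (invmx h)]mulmxA -map_mxM mulmxV// map_mx1 mulmx1.
Qed.

Lemma actqM P h k : h \in unitmx -> k \in unitmx -> actq (actq P h) k = actq P (h *m k).
Proof.
move=> hu ku; rewrite /actq; have -> : invmx (h *m k) = invmx k *m invmx h.
  have hku : h *m k \in unitmx by rewrite unitmx_mul hu.
  by rewrite -[RHS](mulmxK hku) mulmxA -[_ *m invmx h *m h]mulmxA mulVmx// mulmx1 mulVmx// mul1mx.
by rewrite map_mxM !mulmxA.
Qed.

Lemma quat_act P h : h *m J *m h^t* = J -> quat P -> h \in unitmx -> quat (actq P h).
Proof.
move=> hJ qP hu; have [PJ PP] := qP.
have hVJ : invmx h *m J *m (invmx h)^t* = J.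
  by rewrite -{1}hJ !mulmxA mulVmx// mul1mx -mulmxA -adj_mul mulVmx// trmx1 map_mx1 mulmx1.
split.
  rewrite /actq !adj_mul !mulmxA -[_ *m h *m J]mulmxA -[_ *m (h *m J) *m _]mulmxA hJ.
  rewrite -[_ *m P *m J]mulmxA -[_ *m (P *m J) *m _]mulmxA PJ.
  have := congr1 (map_mx conjC) hVJ; rewrite !map_mxM.
  have -> : map_mx conjC J = J by apply/matrixP => i j; rewrite !mxE rmorph_nat.
  move=> {2}<-; congr (_ *m _ *m _).
  by apply/matrixP => i j; rewrite !mxE.
rewrite /actq !map_mxM map_conjK !mulmxA -[_ *m map_mx conjC h *m _]mulmxA -map_mxM mulmxV//.
by rewrite map_mx1 mulmx1 -[_ *m map_mx conjC P *m P]mulmxA PP mulmxN mulmx1 mulNmx mulVmx.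
Qed.

Variable W : set V.
Hypothesis Wmid : forall w, W w -> mid w.
Hypothesis Wsolve : forall u y, mid u -> herm u u = 0 -> u != 0 ->
  exists2 w, W w & herm u w = y.
Hypothesis Wtransverse : forall u q, mid u -> mid q -> herm u u = 0 -> u != 0 ->
  exists k : C, W (q + k *: u).

Lemma unip_isom w z : mid w -> z + conjC z = - herm w w ->
  unip w z *m J *m (unip w z)^t* = J.
Proof. by move=> mw zz; apply: hermP => u v; exact: herm_unip. Qed.

Lemma unip_unit w z : mid w -> unip w z \in unitmx.
Proof. by move=> mw; rewrite unitmxE det_unip// unitr1. Qed.

Lemma dg_isom (a : C) : a != 0 -> conjC a = a -> dg n a *m J *m (dg n a)^t* = J.
Proof. by move=> a0 aR; apply: hermP => u v; exact: herm_dg. Qed.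

Lemma dg_unit (a : C) : a != 0 -> dg n a \in unitmx.
Proof. by move=> a0; rewrite unitmxE det_dg// unitr1. Qed.

Lemma herm_half w : - (herm w w / 2) + conjC (- (herm w w / 2)) = - herm w w.
Proof.
by rewrite rmorphN rmorphM /= fmorphV rmorph_nat -herm_conj; field.
Qed.

Lemma herm_std u : herm u (u *m J) = \sum_i `|u 0 i| ^+ 2.
Proof.
by rewrite herm_sum (reindex_inj (inv_inj (@tauK n))) /=; apply: eq_bigr => i _; rewrite mulmxJ !tauK normCK.
Qed.

Lemma herm_JJ u v : herm (u *m J) (v *m J) = herm u v.
Proof.
by rewrite !herm_sum (reindex_inj (inv_inj (@tauK n))) /=; apply: eq_bigr => i _; rewrite !mulmxJ !tauK.
Qed.

Lemma row_unip_eM w z : mid w -> eM *m unip w z = eM.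
Proof.
by move=> [w0 _]; rewrite row_unip herm_eMl w0 eM0 rmorph0 mulr0 !scale0r subr0 !addr0.
Qed.

Lemma row_unip_mid v w z : v 0 ord0 = 0 -> v *m unip w z = v - herm v w *: eM.
Proof. by move=> v0; rewrite row_unip v0 mulr0 !scale0r !addr0. Qed.

Lemma subZmxE p q (A B : 'M[C]_(p, q)) a i k : (A - a *: B) i k = A i k - a * B i k.
Proof. by rewrite !mxE. Qed.

(** Since j eM is orthogonal to eM, it is a middle vector u plus y eM. The move by w subtracts
    [herm u w] times eM from it, so [Wsolve] can cancel the last coordinate. The vector u is
    isotropic because j eM is. *)
Lemma quat_move_middle P : quat P -> exists w, W w /\
  exists u, [/\ mid u, u != 0 & jmap (actq P (unip w (- (herm w w / 2)))) eM = u].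
Proof.
move=> qP; pose u0 := jmap P eM; pose y := u0 0 ord_max; pose u := u0 - y *: eM.
have u00 : u0 0 ord0 = 0 by rewrite -herm_eM; exact: herm_jmap_self.
have mu : mid u.
  by split; rewrite subZmxE ?eM0 ?eMmax ?u00 ?mulr0 ?mulr1 ?subr0// subrr.
have uu : herm u u = 0.
  rewrite /u !(hermDl, hermDr, hermNl, hermNr, hermZl, hermZr) herm_eM !herm_eMl eM0 u00.
  rewrite herm_jmap// herm_eM eM0 !rmorph0; ring.
(* Otherwise j eM = y eM, and j^2 = -1 would give |y|^2 = -1. *)
have u_neq0 : u != 0.
  apply/eqP => /eqP; rewrite subr_eq0 => /eqP u0E.
  have := jmapK qP eM; rewrite -/u0 u0E jmapZ -/u0 u0E scalerA => /rowP/(_ ord_max).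
  rewrite !mxE !eqxx mulr1 => h; have := mul_conjC_ge0 y; rewrite mulrC h.
  by rewrite oppr_ge0 ler10.
have [w Ww hw] := Wsolve y mu uu u_neq0.
exists w; split=> //; exists u; split=> //.
have mw := Wmid Ww.
rewrite -{1}(row_unip_eM (- (herm w w / 2)) mw) jmap_act ?unip_unit// -/u0.
rewrite row_unip_mid//; congr (_ - _ *: _).
rewrite -hw /u !(hermDl, hermNl, hermZl) herm_eMl.
by case: mw => -> _; rewrite rmorph0; ring.
Qed.

(** The dilation fixes middle vectors and divides eM by a, so j eM becomes a u; the choice of a is
    the inverse of the Euclidean norm of u, which is what [herm u (u *m J)] measures. *)
Lemma quat_normalize P u : quat P -> mid u -> u != 0 -> jmap P eM = u ->
  exists2 a, 0 < a & let u' := a *: u in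
    herm u' (u' *m J) = 1 /\ jmap (actq P (dg n a)) eM = u'.
Proof.
move=> qP [u0 uM] u_neq0 jP.
have uJ : 0 < herm u (u *m J).
  rewrite herm_std lt_def sumr_ge0 ?andbT => [|i _]; last by rewrite exprn_ge0.
  apply: contra_neq u_neq0 => /psumr_eq0P h; apply/rowP => i.
  have /eqP := h (fun i _ => exprn_ge0 2 (normr_ge0 _)) i isT.
  by rewrite expf_eq0 /= normr_eq0 mxE => /eqP.
pose a := (sqrtC (herm u (u *m J)))^-1.
have a0 : 0 < a by rewrite invr_gt0 sqrtC_gt0.
have aR : conjC a = a by apply/CrealP; rewrite gtr0_real.
have an0 : a != 0 by rewrite gt_eqF.
exists a => //=; split.
  rewrite -scalemxAl hermZl hermZr aR mulrA -expr2 exprVn sqrtCK.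
  by rewrite mulVf// gt_eqF.
have eMa : eM *m dg n a = a^-1 *: eM.
  rewrite row_dg eM0 eMmax mulr0 scale0r addr0 mulr1.
  by rewrite -{1}[eM]scale1r -scalerDl; congr (_ *: _); ring.
have := jmap_act P eM (dg_unit an0); rewrite eMa jmapZ jP row_dg u0 uM.
rewrite !mulr0 !scale0r !addr0 fmorphV /= aR => /(congr1 (fun x => a *: x)).
by rewrite scalerA divff// scale1r.
Qed.

(** If j commutes with J and j eM = u, then j e0 = u J, so j (u J) = - e0: this is the target. The
    defect q = e0 + j (u J) has zero first coordinate, and its middle part is what w has to be, up
    to a multiple of u. *)
Lemma quat_move_first P u : quat P -> mid u -> herm u (u *m J) = 1 -> jmap P eM = u ->
  exists w z, [/\ W w, z + conjC z = - herm w w,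
    jmap (actq P (unip w z)) eM = u & jmap (actq P (unip w z)) (u *m J) = - e0].
Proof.
move=> qP mu uJ1 jf; have [u0 uM] := mu.
have ju : jmap P u = - eM by rewrite -jf jmapK.
have uu : herm u u = 0 by rewrite -{1}jf -jf herm_jmap// herm_eM eM0 rmorph0.
have u_neq0 : u != 0.
  by apply: contra_eq_neq uJ1 => ->; rewrite mul0mx -(scale0r 0) hermZl mul0r eq_sym oner_eq0.
have uJ0 : (u *m J) 0 ord0 = 0 by rewrite mulmxJ tau0.
have uJM : (u *m J) 0 ord_max = 0 by rewrite mulmxJ tau_max.
have uJu : herm (u *m J) u = 1 by rewrite herm_conj uJ1 rmorph1.
pose p := jmap P (u *m J); pose q := e0 + p; pose b := q 0 ord_max.
pose q0 := q - b *: eM.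
have p0 : p 0 ord0 = -1.
  rewrite -herm_eM -[eM]opprK -ju hermNr herm_jmap// uJu rmorph1//.
have pM : p 0 ord_max = b by rewrite /b !mxE /= add0r.
have pu : herm p u = 0 by rewrite -jf herm_jmap// herm_eM uJ0 rmorph0.
have pp : herm p p = 0 by rewrite herm_jmap// herm_JJ uu rmorph0.
have uJp : herm (u *m J) p = 0 by rewrite herm_conj herm_jmap_self// rmorph0.
have q00 : q 0 ord0 = 0 by rewrite mxE e00 p0 subrr.
have mq0 : mid q0.
  by split; rewrite subZmxE ?eM0 ?eMmax ?q00 ?mulr0 ?mulr1 ?subr0// subrr.
have q0u : herm q0 u = 0.
  rewrite /q0 /q !(hermDl, hermNl, hermZl) herm_eMl herm_e0l pu u0 uM !rmorph0; ring.
have q0q0 : herm q0 q0 = b + conjC b.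
  rewrite /q0 /q !(hermDl, hermNl, hermZl, hermDr, hermNr, hermZr).
  rewrite pp !(herm_eM, herm_eMl, herm_e0, herm_e0l) p0 pM !(eM0, eMmax, e00, e0max).
  rewrite !rmorphN /= !(rmorph0, rmorph1); ring.
have uJq0 : herm (u *m J) q0 = 0.
  by rewrite /q0 /q !(hermDr, hermNr, hermZr) herm_e0 uJM uJp herm_eM uJ0; ring.
(* Adding k u costs nothing: u is isotropic and orthogonal to q0, so j eM stays u and [herm w w]
   stays b + conj b, which is compatible with z = - conj b. The multiple of u that appears in j (u
   J) is compensated by the eM-component that u J acquires. *)
have [k [w [Wk wE]]] : exists k w, W w /\ w = q0 + k *: u.
  by have [k Wk] := Wtransverse mu mq0 uu u_neq0; exists k, (q0 + k *: u).
have mw := Wmid Wk; have [w0 wM] := mw.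
have wu : herm w u = 0 by rewrite wE hermDl hermZl q0u uu; ring.
have uw : herm u w = 0 by rewrite herm_conj wu rmorph0.
have ww : herm w w = b + conjC b.
  by rewrite {2}wE hermDr hermZr wu wE hermDl hermZl (herm_conj q0 u) q0u q0q0 rmorph0; ring.
have zz : - conjC b + conjC (- conjC b) = - herm w w.
  by rewrite ww rmorphN /= conjCK; ring.
have hu : unip w (- conjC b) \in unitmx by exact: unip_unit.
have j3f : jmap (actq P (unip w (- conjC b))) eM = u.
  rewrite -{1}(row_unip_eM (- conjC b) mw) jmap_act// jf row_unip_mid// uw.
  by rewrite scale0r subr0.
exists w, (- conjC b); split=> //.
have := jmap_act P (u *m J) hu; rewrite row_unip_mid// jmapD jmapN jmapZ j3f -/p.
have -> : herm (u *m J) w = conjC k by rewrite wE hermDr hermZr uJq0 uJu; ring.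
rewrite conjCK => /eqP; rewrite subr_eq => /eqP ->.
have -> : p = w - k *: u + b *: eM - e0.
  by rewrite wE /q0 /q; apply/rowP => i; rewrite !mxE; ring.
rewrite !(mulmxDl, mulNmx) -!scalemxAl row_unip_eM// [e0 *m _]row_unip !row_unip_mid//.
rewrite uw ww e00 herm_e0l wM rmorph0 scale0r subr0 subr0.
by apply/rowP => i; rewrite !mxE; ring.
Qed.

Local Notation o1 := (Ordinal (isT : 1 < n.+2)%N).
Local Notation on := (tau o1).

Lemma herm_delta v k : herm v (delta_mx 0 k) = v 0 (tau k).
Proof.
rewrite herm_sum (bigD1 k)//= big1 ?addr0 => [|i ik]; rewrite !mxE ?eqxx ?rmorph1 ?mulr1//.
by rewrite (negPf ik) rmorph0 mulr0.
Qed.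

Lemma o1_on : (o1 == on) = false.
Proof. by apply/negbTE; rewrite -val_eqE val_on ?(ltnW n_gt1)//= neq_ltn n_gt1. Qed.

(** J is the product of the reflections in two orthogonal vectors of square -2; they span its
    eigenspace for -1, the negative plane of the form. *)
Lemma mulJ_reflections v : let d1 := eM - e0 in
  let d2 : V := delta_mx 0 o1 - delta_mx 0 on in
  v *m J = v + herm v d1 *: d1 + herm v d2 *: d2.
Proof.
move=> d1 d2; rewrite /d1 /d2 !hermDr !hermNr herm_eM herm_e0 !herm_delta tauK.
apply/rowP => i; rewrite mulmxJ !mxE eqxx /=.
have vn : val on = n by exact/val_on/ltnW.
have [/andP[i2 ilt]|imid] := boolP (2 <= i < n)%N.
  rewrite tau_mid ?i2//.
  have -> : (i == ord_max) = false by apply/negbTE; rewrite -val_eqE /=; lia.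
  have -> : (i == ord0) = false by apply/negbTE; rewrite -val_eqE /=; lia.
  have -> : (i == o1) = false by apply/negbTE; rewrite -val_eqE /=; lia.
  have -> : (i == on) = false by apply/negbTE; rewrite -val_eqE vn /=; lia.
  by rewrite /=; ring.
have o1n := o1_on.
have onM : (on == ord_max) = false by apply/negbTE; rewrite -val_eqE vn /=; lia.
have on0 : (on == ord0) = false by apply/negbTE; rewrite -val_eqE vn /=; lia.
have [->|i0] := eqVneq i ord0.
  rewrite tau0 (_ : (ord0 == o1) = false)// (eq_sym _ on) on0 /=; ring.
have [->|iM] := eqVneq i ord_max.
  rewrite tau_max (_ : (ord_max == o1) = false) ?(eq_sym _ on) ?onM /=; first by ring.
  by apply/negbTE; rewrite -val_eqE /=; lia.
have [->|i1] := eqVneq i o1.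
  by rewrite o1n /=; ring.
have [->|iN] := eqVneq i on.
  by rewrite tauK /=; ring.
move: imid i0 iM i1 iN; rewrite -!val_eqE vn /=; have := ltn_ord i; lia.
Qed.

(** It suffices that j preserves the negative plane of J. Now j d1 = u - u J is a combination of d1
    and d2 by [mulJ_reflections], and only the d2-term remains because u is a middle vector; then
    j^2 = -1 determines j d2. *)
Lemma quat_commutes P u : quat P -> mid u -> herm u (u *m J) = 1 ->
  jmap P eM = u -> jmap P (u *m J) = - e0 -> P *m J = J *m P.
Proof.
move=> qP mu uJ1 jf juJ.
have je : jmap P e0 = u *m J by rewrite -[e0]opprK jmapN -juJ jmapK// opprK.
pose d1 := eM - e0; pose d2 : V := delta_mx 0 o1 - delta_mx 0 on.
have JE v : v *m J = v + herm v d1 *: d1 + herm v d2 *: d2 by exact: mulJ_reflections.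
pose k := - herm u d2.
have jd1 : jmap P d1 = k *: d2.
  rewrite /d1 jmapD jmapN jf je JE /k.
  have -> : herm u d1 = 0.
    by case: mu => u0 uM; rewrite /d1 hermDr hermNr herm_eM herm_e0 u0 uM subrr.
  by rewrite scale0r addr0 opprD addrA subrr sub0r scaleNr.
have d11 : herm d1 d1 = - 2.
  rewrite /d1 !(hermDl, hermDr, hermNl, hermNr) !(herm_eM, herm_e0).
  by rewrite eM0 e00 eMmax e0max; ring.
have d22 : herm d2 d2 = - 2.
  rewrite {2}/d2 hermDr hermNr !herm_delta tauK !mxE !eqxx /= (eq_sym on) o1_on /=; ring.
have kk : k * conjC k = 1.
  have c2 : conjC (- 2) = - 2 :> C by rewrite rmorphN /= rmorph_nat.
  have := herm_jmap qP d1 d1; rewrite jd1 hermZl hermZr d11 d22 c2 mulrA => /eqP.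
  by rewrite -[X in _ == X]mul1r (inj_eq (mulIf _)) ?oppr_eq0 ?pnatr_eq0// => /eqP.
have jd2 : jmap P d2 = - k *: d1.
  have := jmapK qP d1; rewrite jd1 jmapZ => /(congr1 (fun x => k *: x)).
  by rewrite scalerA kk scale1r scalerN -scaleNr.
apply: mx_rowP => v; rewrite -[v]map_conjK !mulmxA -/(jmap P _).
set x := map_mx conjC v.
have xJ : map_mx conjC x *m J = map_mx conjC (x *m J).
  rewrite map_mxM; congr (_ *m _); apply/matrixP => i j; rewrite !mxE rmorph_nat//.
rewrite xJ -/(jmap P _) !JE !jmapD !jmapZ jd1 jd2.
have -> : herm (jmap P x) d1 = - k * conjC (herm x d2).
  rewrite -(herm_jmap qP) jd2 hermZr rmorphN /= mulrA mulrNN kk mul1r//.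
have -> : herm (jmap P x) d2 = k * conjC (herm x d1).
  by rewrite -(herm_jmap qP) jd1 hermZr mulrA kk mul1r.
by apply/rowP => i; rewrite !mxE; ring.
Qed.

Lemma quat_normal_form P : quat P -> exists w1 z1 a w2 z2,
  [/\ W w1, z1 + conjC z1 = - herm w1 w1, 0 < a, W w2 & z2 + conjC z2 = - herm w2 w2] /\
  let P' := actq P (unip w1 z1 *m dg n a *m unip w2 z2) in quat P' /\ P' *m J = J *m P'.
Proof.
move=> qP; have [w1 [Ww1 [u [mu u0 ju]]]] := quat_move_middle qP.
set z1 := - _ in ju; have zz1 : z1 + conjC z1 = - herm w1 w1 by exact: herm_half.
have mw1 := Wmid Ww1; have hu1 := unip_unit z1 mw1.
have qP1 := quat_act (unip_isom mw1 zz1) qP hu1.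
have [a a0 [aJ ja]] := quat_normalize qP1 mu u0 ju.
have an0 : a != 0 by rewrite gt_eqF.
have aR : conjC a = a by apply/CrealP; rewrite gtr0_real.
have qP2 := quat_act (dg_isom an0 aR) qP1 (dg_unit an0).
have mau : mid (a *: u) by case: mu => h0 hM; split; rewrite mxE ?h0 ?hM mulr0.
have [w2 [z2 [Ww2 zz2 j3 j3']]] := quat_move_first qP2 mau aJ ja.
have mw2 := Wmid Ww2; have hu2 := unip_unit z2 mw2.
have qP3 := quat_act (unip_isom mw2 zz2) qP2 hu2.
exists w1, z1, a, w2, z2; split=> //=.
rewrite -!actqM ?unitmx_mul ?hu1 ?hu2 ?dg_unit//.
by split=> //; exact: quat_commutes qP3 mau aJ j3 j3'.
Qed.

End QuaternionicStructures.

(** * The Lie algebra and the group law in the coordinates w, z, a *)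

Section LieAlgebra.
Variables (C : numClosedFieldType) (n : nat).
Local Notation M := 'M[C]_n.+2.
Local Notation V := 'rV[C]_n.+2.
Local Notation e0 := (e0 C n).
Local Notation eM := (eM C n).
Implicit Types (v w : V) (s t z a : C).

Definition nilmx w s : M := e0^T *m w - hcol w *m eM + s *: (e0^T *m eM).
Definition dilmx : M := e0^T *m e0 - eM^T *m eM.

Lemma unip_nilmx w z : unip w z = 1%:M + nilmx w z.
Proof. by rewrite /unip /nilmx !addrA. Qed.

Lemma row_nilmx v w s :
  v *m nilmx w s = v 0 ord0 *: w - herm v w *: eM + (s * v 0 ord0) *: eM.
Proof.
rewrite /nilmx mulmxDr mulmxBr -scalemxAr (mulmxA v e0^T w) (mulmxA v (hcol w)).
by rewrite (mulmxA v e0^T eM) mulE mul_hcol !mul_scalar_mx scalerA.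
Qed.

Lemma row_dilmx v : v *m dilmx = v 0 ord0 *: e0 - v 0 ord_max *: eM.
Proof. by rewrite /dilmx mulmxBr !mulmxA mulE mulEM !mul_scalar_mx. Qed.

Lemma row_E0M v : v *m (e0^T *m eM) = v 0 ord0 *: eM.
Proof. by rewrite mulmxA mulE mul_scalar_mx. Qed.

Lemma nilmx_sqr w s : mid w -> nilmx w s *m nilmx w s = - herm w w *: (e0^T *m eM).
Proof.
move=> [w0 wM]; apply: mx_rowP => v; rewrite mulmxA -scalemxAr row_E0M !row_nilmx.
rewrite !(hermDl, hermNl, hermZl) herm_eMl w0 rmorph0.
by apply/rowP => j; rewrite !mxE w0 /=; ring.
Qed.

Lemma nilmx_cube w s : mid w -> nilmx w s *m nilmx w s *m nilmx w s = 0.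
Proof.
move=> mw; rewrite nilmx_sqr//; apply: mx_rowP => v.
rewrite mulmxA -scalemxAr row_E0M row_nilmx mulmx0 !(hermZl, herm_eMl) mxE mxE eM0.
by case: mw => -> _; rewrite rmorph0 !(mulr0, scale0r, addr0, subr0).
Qed.

(** The dilation acts on w with weight 1 and on the corner with weight 2, so for t different from 0
    the nilpotent part can be conjugated away, with denominators t and 2 t. This replaces the
    exponential of a mixed element by that of a diagonal one. *)
Lemma dil_conj t w s : mid w -> t != 0 -> conjC t = t ->
  let U := unip (- t^-1 *: w) (- (s + herm w w / t) / (2 * t)) in
  (t *: dilmx + nilmx w s) *m U = U *m (t *: dilmx).
Proof.
move=> [w0 wM] t0 tR /=; apply: mx_rowP => v.
have vX : v *m (t *: dilmx + nilmx w s) = t *: (v 0 ord0 *: e0 - v 0 ord_max *: eM) +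
    (v 0 ord0 *: w - herm v w *: eM + (s * v 0 ord0) *: eM).
  by rewrite mulmxDr -scalemxAr row_nilmx row_dilmx.
rewrite [LHS]mulmxA [RHS]mulmxA -scalemxAr vX !row_unip row_dilmx.
rewrite !(hermZr, hermZl, hermDl, hermNl, herm_eMl, herm_e0l).
rewrite rmorphN /= fmorphV /= tR.
rewrite !mxE w0 wM !eqxx /= !rmorph0.
by apply/rowP => j; rewrite !mxE /=; field.
Qed.

Lemma unipV w z : mid w -> z + conjC z = - herm w w ->
  unip w z *m unip (- w) (conjC z) = 1%:M.
Proof.
move=> mw zz; rewrite unipD//; last by case: mw => w0 wM; split; rewrite mxE ?w0 ?wM oppr0.
by rewrite subrr hermNr opprK zz addNr unip00.
Qed.

Lemma dgV a : a != 0 -> dg n a *m dg n a^-1 = 1%:M.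
Proof. by move=> a0; rewrite dgM ?invr_eq0// divff// dg1. Qed.

Lemma midZ a w : mid w -> mid (a *: w).
Proof. by move=> [w0 wM]; split; rewrite mxE ?w0 ?wM mulr0. Qed.

Lemma horo_mul w z a w' z' a' : mid w -> mid w' ->
  z + conjC z = - herm w w -> z' + conjC z' = - herm w' w' ->
  a != 0 -> a' != 0 -> conjC a = a ->
  let w2 := w + a *: w' in let z2 := z + a ^+ 2 * z' - herm w (a *: w') in
  z2 + conjC z2 = - herm w2 w2 /\
  unip w z *m dg n a *m (unip w' z' *m dg n a') = unip w2 z2 *m dg n (a * a').
Proof.
move=> mw mw' zz zz' a0 a'0 aR; split; last first.
  rewrite mulmxA -[_ *m unip w' z']mulmxA dg_unip// mulmxA unipD//; last exact: midZ.
  by rewrite -mulmxA dgM.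
rewrite !(hermDl, hermDr, hermZl, hermZr) !(rmorphB, rmorphD, rmorphM) /= aR.
rewrite (herm_conj w w') aR.
have -> : conjC z = - herm w w - z by rewrite -zz; ring.
have -> : conjC z' = - herm w' w' - z' by rewrite -zz'; ring.
ring.
Qed.

Lemma horo_inv w z a : mid w -> z + conjC z = - herm w w -> a != 0 -> conjC a = a ->
  let w2 := a^-1 *: - w in let z2 := a^-1 ^+ 2 * conjC z in
  z2 + conjC z2 = - herm w2 w2 /\
  unip w z *m dg n a *m (unip w2 z2 *m dg n a^-1) = 1%:M.
Proof.
move=> mw zz a0 aR; have aVR : conjC a^-1 = a^-1 by rewrite fmorphV /= aR.
split.
  rewrite hermZl hermZr hermNl hermNr opprK rmorphM /= conjCK rmorphXn /= aVR.
  have -> : herm w w = - (z + conjC z) by rewrite zz opprK.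
  ring.
have mNw : mid (- w) by rewrite -scaleN1r; exact: midZ.
rewrite -dg_unip ?invr_eq0// mulmxA -[_ *m dg n a^-1]mulmxA dgV// mulmx1.
by rewrite unipV.
Qed.

End LieAlgebra.

(** * Exponential series of nilpotent and of diagonal elements *)

Section Exponential.
Variables (R : realType) (n : nat).
Local Notation C := R[i].
Local Notation M := 'M[C]_n.+2.
Local Open Scope complex_scope.

Lemma cvg_mxP T (F : set_system T) {FF : Filter F} (f : T -> M) (A : M) :
  (forall i j, f x i j @[x --> F] --> A i j) -> f x @[x --> F] --> A.
Proof.
move=> fA B [P PA PB]; have : F [set x | forall i j, P i j (f x i j)].
  apply: filter_forall => i; apply: filter_forall => j.
  exact: (fA i j _ (PA i j)).
move=> FP; change (F [set x | B (f x)]).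
by apply: filterS FP => x Px; exact: PB.
Qed.

Definition exp_series (X : M) := series (fun k => (k`!%:R : C)^-1 *: X ^+ k).

Lemma expmx_lim (X A : M) : exp_series X @ \oo --> A -> expmx X = A.
Proof. by move=> XA; apply: cvg_lim XA; exact: norm_hausdorff. Qed.

Lemma exp_series_conj (X Y U V : M) (A : M) : U *m V = 1%:M -> X *m U = U *m Y ->
  exp_series Y @ \oo --> A -> exp_series X @ \oo --> U *m A *m V.
Proof.
move=> UV XU YA.
have XE k : X ^+ k = U *m Y ^+ k *m V.
  elim: k => [|k IH]; first by rewrite !expr0 mulmx1 UV.
  rewrite exprSr IH exprSr -[X in _ * X](mulmx1 X) -UV -!mulmxE !mulmxA.
  rewrite -[_ *m V *m X *m U]mulmxA XU !mulmxA -[_ *m V *m U]mulmxA.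
  by rewrite (mulmx1C UV) mulmx1.
have -> : exp_series X = fun k => U *m exp_series Y k *m V.
  apply/funext => k; rewrite /exp_series /series /= mulmx_sumr mulmx_suml.
  by apply: eq_bigr => l _; rewrite XE -scalemxAr -scalemxAl.
have Yc i j : exp_series Y k i j @[k --> \oo] --> A i j.
  exact: (cvg_comp _ _ YA (@coord_continuous C _ _ i j A)).
apply: cvg_mxP => i j.
rewrite mxE [X in X @ _](_ : _ = fun k => \sum_l (U *m exp_series Y k) i l * V l j).
  apply: cvgC_sum => l; apply: cvgCM; last exact: cvgCcst.
  rewrite mxE [X in X @ _](_ : _ = fun k => \sum_l' U i l' * exp_series Y k l' l).
    by apply: cvgC_sum => l'; apply: cvgCM; [exact: cvgCcst|exact: Yc].
  by apply/funext => k; rewrite mxE.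
by apply/funext => k; rewrite mxE.
Qed.

(** The cube of [nilmx w s] is 0 and its square sits in the corner, so the series stops after the
    quadratic term, which contributes [- herm w w / 2]. *)
Lemma exp_series_nil w s : mid w ->
  exp_series (nilmx w s) @ \oo --> unip w (s - herm w w / 2).
Proof.
move=> mw; apply: cvg_near_cst; exists 3%N => // -[|[|[|k]]]// _.
rewrite /exp_series /series /=.
rewrite !big_nat_recl// [X in _ + (_ + (_ + X))]big1 ?addr0; last first.
  by move=> l _; rewrite !exprS -!mulmxE !mulmxA nilmx_cube// mul0mx scaler0.
rewrite expr0 expr1 expr2 -mulmxE nilmx_sqr//.
rewrite unip_nilmx !fact0 invr1 !scale1r; congr (_ + _).
rewrite /nilmx scalerA -addrA; congr (_ + _); rewrite -scalerDl; congr (_ *: _).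
by rewrite mulrN [in LHS]mulrC.
Qed.

Lemma exp_series_dil (t : R) :
  exp_series (t%:C *: dilmx C n) @ \oo --> dg n (expR t)%:C.
Proof.
pose r (i : 'I_n.+2) : R := if i == ord0 then t else if i == ord_max then - t else 0.
have XE : t%:C *: dilmx C n = diag_mx (\row_i (r i)%:C).
  rewrite /dilmx -scaleN1r -[X in X + _]scale1r diag_corner -linearZ /=.
  congr diag_mx; apply/rowP => i; rewrite !mxE /r.
  by case: ifP => _; [|case: ifP => _]; rewrite ?mulr1 ?mulrN1 ?mulr0 ?rmorphN ?rmorph0.
have DE : dg n (expR t)%:C = diag_mx (\row_i (expR (r i))%:C).
  rewrite dg_diag; congr diag_mx; apply/rowP => i; rewrite !mxE /r.
  by case: ifP => _; [|case: ifP => _]; rewrite ?expRN ?expR0 ?fmorphV ?rmorph1.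
have XkE k : (diag_mx (\row_i (r i)%:C) : M) ^+ k = diag_mx (\row_i (r i ^+ k)%:C).
  elim: k => [|k IH].
    rewrite expr0; apply/matrixP => i j; rewrite !mxE expr0.
    by case: eqP.
  rewrite exprS IH -mulmxE mulmx_diag; congr diag_mx.
  by apply/rowP => i; rewrite !mxE -rmorphM exprS.
rewrite XE DE; apply: cvg_mxP => i j.
have expc : (series (exp_coeff (r i)) k)%:C @[k --> \oo] --> (expR (r i))%:C.
  have expr' : series (exp_coeff (r i)) k @[k --> \oo] --> expR (r i).
    exact: is_cvg_series_exp_coeff.
  exact: (cvg_comp _ _ expr' (@real_complex_continuous R _)).
have [ij|ij] := eqVneq i j; last first.
  rewrite !mxE (negPf ij) mulr0n [X in X @ _](_ : _ = fun=> 0); first exact: cvgCcst.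
  apply/funext => k; rewrite /exp_series /series /= summxE big1// => l _.
  by rewrite XkE !mxE (negPf ij) mulr0n mulr0.
rewrite -ij !mxE eqxx mulr1n [X in X @ _](_ : _ = fun k => (series (exp_coeff (r i)) k)%:C) //.
apply/funext => k; rewrite /exp_series /series /= summxE rmorph_sum; apply: eq_bigr => l _.
rewrite XkE !mxE eqxx mulr1n /exp_coeff /= rmorphM /= fmorphV rmorph_nat mulrC.
by [].
Qed.

End Exponential.

(** * Comparison with the entrywise description of the Lie algebra *)

Section LieAlgebraEntries.
Variables (C : numClosedFieldType) (n : nat).

Lemma lie_entry (t s : C) (w : 'rV[C]_n.+2) i j :
  (t *: dilmx C n + nilmx w s) i j =
  t * ((i == ord0)%:R * (j == ord0)%:R - (i == ord_max)%:R * (j == ord_max)%:R) +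
  (i == ord0)%:R * w 0 j - conjC (w 0 (tau i)) * (j == ord_max)%:R
  + s * (i == ord0)%:R * (j == ord_max)%:R.
Proof.
have -> : (t *: dilmx C n + nilmx w s) i j =
    ((delta_mx 0 i : 'rV_n.+2) *m (t *: dilmx C n + nilmx w s)) 0 j.
  by rewrite -rowE [RHS]mxE.
rewrite mulmxDr -scalemxAr row_dilmx row_nilmx herm_conj herm_delta.
by rewrite !mxE !eqxx !(eq_sym ord0) !(eq_sym ord_max) /=; ring.
Qed.

Lemma lie_matrix (t phi eta s : C) (x : seq C) : (1 < n)%N ->
  \matrix_(i < n.+2, j < n.+2)
    (if (i == 0 :> nat)%N then
       if (j == 0 :> nat)%N then t
       else if (j == 1 :> nat)%N then phi
       else if (j < n)%N then x`_(j - 2)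
       else if (j == n :> nat)%N then eta
       else s
     else if (j == n.+1 :> nat)%N then
       if (i == 1 :> nat)%N then - conjC eta
       else if (i < n)%N then - conjC x`_(i - 2)
       else if (i == n :> nat)%N then - conjC phi
       else - t
     else 0) =
  t *: dilmx C n + nilmx (\row_j (if (j == 0 :> nat)%N then 0
    else if (j == 1 :> nat)%N then phi
    else if (j < n)%N then x`_(j - 2) else if (j == n :> nat)%N then eta else 0)) s.
Proof.
move=> n1; apply/matrixP => i j; rewrite lie_entry !mxE.
have -> : (tau i : nat) = if (2 <= i < n)%N then i : nat else (n.+1 - i)%N.
  by rewrite /tau; case: ifP => //= _; rewrite subSS.
rewrite -!val_eqE /=; have := ltn_ord i; have := ltn_ord j.
move: (i : nat) (j : nat) => {}i {}j jn inn.
have h1 : (n.+1 < n)%N = false by lia.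
have h2 : (n.+1 == n) = false by lia.
have h3 : (n == n.+1) = false by lia.
have h4 : (1%N == n.+1) = false by lia.
have h5 : (1 < n)%N = true by lia.
have h6 : (n == 1%N) = false by lia.
have h7 : (n == 0%N) = false by lia.
have h8 : (n.+1 == 1%N) = false by lia.
have [->|i0] := eqVneq i 0%N.
  rewrite /= subn0 h1 h2 h8 /= rmorph0.
  have [->|j0] := eqVneq j 0%N; first by rewrite /=; ring.
  have [->|j1] := eqVneq j 1%N; first by rewrite h4 /=; ring.
  have [jlt|jge] := ltnP j n; first by rewrite (_ : (j == n.+1) = false) /=; [ring|lia].
  have [->|jN] := eqVneq j n; first by rewrite h3 /=; ring.
  by rewrite (_ : j = n.+1) ?eqxx /=; [ring|lia].
have [->|jN] := eqVneq j n.+1; last by rewrite /=; ring.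
have [->|i1] := eqVneq i 1%N.
  by rewrite /= subn1 /= h4 h6 h7 ltnn eqxx /=; ring.
have [ilt|ige] := ltnP i n.
  rewrite (_ : (1 < i)%N) /=; last by lia.
  by rewrite (negPf i0) (negPf i1) ilt (_ : (i == n.+1) = false) /=; [ring|lia].
rewrite andbF.
have [->|iN] := eqVneq i n.
  by rewrite subSnn /= h3 /=; ring.
rewrite (_ : i = n.+1); last by lia.
by rewrite subnn eqxx /= rmorph0; ring.
Qed.

End LieAlgebraEntries.

(** * Explicit description of H_[c] *)

Section ConnectedSubgroup.
Variables (R : realType) (n : nat) (c : R).
Hypotheses (n_gt1 : (1 < n)%N).
Local Notation C := R[i].
Local Notation M := 'M[C]_n.+2.
Local Notation V := 'rV[C]_n.+2.
Local Open Scope complex_scope.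
Local Notation o1 := (Ordinal (isT : 1 < n.+2)%N).
Local Notation on := (tau o1).

(** The map from phi to eta in the definition of H_[c]. It is linear over the reals, so [Wset] is
    taken as a real subspace. *)
Definition sig (z : C) : C := complex.Re z +i* (c * complex.Im z).

Definition Wset : set V := [set w | mid w /\ w 0 on = sig (w 0 o1)].

Lemma sigD y z : sig (y + z) = sig y + sig z.
Proof. by case: y z => [a b] [a' b']; rewrite /sig /=; simpc; congr (_ +i* _); ring. Qed.

Lemma sigZ (t : R) z : sig (t%:C * z) = t%:C * sig z.
Proof. by case: z => a b; rewrite /sig /=; simpc; congr (_ +i* _); ring. Qed.

Lemma WsetD v w : Wset v -> Wset w -> Wset (v + w).
Proof.
move=> [[v0 vM] vs] [[w0 wM] ws].
by split; [split|]; rewrite !mxE ?v0 ?vM ?w0 ?wM ?addr0// vs ws -sigD.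
Qed.

Lemma WsetZ (t : R) w : Wset w -> Wset (t%:C *: w).
Proof.
by move=> [[w0 wM] ws]; split; [split|]; rewrite !mxE ?w0 ?wM ?mulr0// ws -sigZ.
Qed.

Lemma WsetN w : Wset w -> Wset (- w).
Proof. by move=> /(WsetZ (-1)); rewrite rmorphN rmorph1 scaleN1r. Qed.

Lemma Wset0 : Wset 0.
Proof. by split; [split|]; rewrite !mxE// /sig /= mulr0. Qed.

Definition row_of (phi eta : C) (x : (n - 2).-tuple C) : V :=
  \row_j (if (j == 0 :> nat)%N then 0 else if (j == 1 :> nat)%N then phi
           else if (j < n)%N then x`_(j - 2) else if (j == n :> nat)%N then eta else 0).

Lemma HmxE t phi eta x s :
  Hmx t phi eta x s = t%:C *: dilmx C n + nilmx (row_of phi eta x) s.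
Proof.
rewrite -lie_matrix//.
Qed.

Lemma row_of_W phi x : Wset (row_of phi (sig phi) x).
Proof.
have vn : val on = n by exact/val_on/ltnW.
split; [split|]; rewrite !mxE ?vn //=.
- have h1 : (n.+1 < n)%N = false by lia.
  have h2 : (n.+1 == n) = false by lia.
  have h3 : (n.+1 == 1%N) = false by lia.
  by rewrite h3 h1 h2.
- have h1 : (n == 1%N) = false by lia.
  have h2 : (n == 0%N) = false by lia.
  by rewrite h2 h1 ltnn eqxx.
Qed.

Lemma row_of_ex w : Wset w -> exists x, w = row_of (w 0 o1) (sig (w 0 o1)) x.
Proof.
move=> [[w0 wM] ws]; exists [tuple w 0 (inord (k + 2)) | k < n - 2].
apply/rowP => j; rewrite mxE.
case: ifPn => [/eqP j0|j0]; first by rewrite -w0; congr (w _ _); apply: val_inj.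
case: ifPn => [/eqP j1|j1]; first by congr (w _ _); apply: val_inj.
case: ifPn => jn.
  have jn2 : (j - 2 < n - 2)%N by lia.
  rewrite -[(j - 2)%N]/(val (Ordinal jn2)) -tnth_nth tnth_mktuple /= subnK; last by lia.
  by rewrite inord_val.
case: ifPn => [/eqP jn'|jn'].
  by rewrite -ws; congr (w _ _); apply: val_inj; exact: etrans jn' (esym (val_on (ltnW n_gt1))).
by rewrite -wM; congr (w _ _); apply: val_inj => /=; have := ltn_ord j; lia.
Qed.

Lemma H_lieP X : @H_lie R n c X <-> exists t w s,
  Wset w /\ X = t%:C *: dilmx C n + nilmx w (s *i).
Proof.
split=> [[t [phi [x [s ->]]]]|[t [w [s [Ww ->]]]]].
  exists t, (row_of phi (sig phi) x), s; split; first exact: row_of_W.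
  by rewrite HmxE.
have [x wE] := row_of_ex Ww; exists t, (w 0 o1), x, s.
by rewrite HmxE -/(sig _) -wE.
Qed.

Lemma JformE : Jform R n = Jmx C n.
Proof.
apply/matrixP => i j; rewrite !mxE /tau; case: ifP => hi; first by rewrite eq_sym.
congr ((_ : bool)%:R); rewrite -val_eqE /=.
by apply/eqP/eqP; have := ltn_ord i; have := ltn_ord j; lia.
Qed.

Definition Hset : set (SU R n) := [set g | exists w z a,
  [/\ Wset w, z + conjC z = - herm w w, 0 < a & \val g = unip w z *m dg n a]].

Lemma Wmid w : Wset w -> mid w. Proof. by case. Qed.

Lemma unip_SU w z : Wset w -> z + conjC z = - herm w w -> SU_set (unip w z).
Proof.
move=> /Wmid mw zz; split; last exact: det_unip.
by rewrite JformE unip_isom.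
Qed.

Lemma dg_SU (a : C) : 0 < a -> SU_set (dg n a).
Proof.
move=> a0; have an0 : a != 0 by rewrite gt_eqF.
split; last exact: det_dg.
by rewrite JformE dg_isom//; apply/CrealP; rewrite gtr0_real.
Qed.

Lemma posC (a : C) : 0 < a -> exists2 b : R, 0 < b & a = b%:C.
Proof.
move=> a0; exists (complex.Re a); last by rewrite RRe_real// gtr0_real.
by rewrite -ltcR RRe_real// gtr0_real.
Qed.

Lemma Hset_subgroup : is_subgroup Hset.
Proof.
have realdg (a : C) : 0 < a -> a != 0 /\ conjC a = a.
  by move=> a0; rewrite gt_eqF//; split=> //; apply/CrealP; rewrite gtr0_real.
split.
- exists 0, 0, 1; split.
  + exact: Wset0.
  + by rewrite -[X in herm X _](scale0r 0) hermZl mul0r rmorph0 addr0 oppr0.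
  + exact: ltr01.
  + by rewrite unip00 dg1 mulmx1.
- move=> g h [w [z [a [Ww zz a0 gE]]]] [w' [z' [a' [Ww' zz' a0' hE]]]].
  have [an0 aR] := realdg _ a0; have [an0' _] := realdg _ a0'.
  have [b b0 ab] := posC a0.
  have [zz2 E2] := horo_mul (Wmid Ww) (Wmid Ww') zz zz' an0 an0' aR.
  exists (w + a *: w'), (z + a ^+ 2 * z' - herm w (a *: w')), (a * a').
  split; [|exact: zz2|exact: mulr_gt0|].
    by apply: WsetD => //; rewrite ab; exact: WsetZ.
  by rewrite -E2 -gE -hE.
- move=> g [w [z [a [Ww zz a0 gE]]]].
  have [an0 aR] := realdg _ a0; have [b b0 ab] := posC a0.
  have [zz2 E2] := horo_inv (Wmid Ww) zz an0 aR.
  exists (a^-1 *: - w), (a^-1 ^+ 2 * conjC z), a^-1; split.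
  + have -> : a^-1 = (b^-1)%:C by rewrite fmorphV ab.
    exact/WsetZ/WsetN.
  + exact: zz2.
  + by rewrite invr_gt0.
  + have gu := SU_unit (SUP g).
    by rewrite -[RHS](mulKmx gu) [X in _ *m X](_ : _ = 1%:M) ?mulmx1// gE.
Qed.

(** For t = 0 the series is finite. Otherwise [dil_conj] exhibits the exponential as a conjugate,
    inside [Hset], of a diagonal element, and the subgroup property yields the normal form without
    computing it. *)
Lemma expmx_lie t w s : Wset w -> exists w' z a, [/\ Wset w', z + conjC z = - herm w' w',
  0 < a & expmx (t%:C *: dilmx C n + nilmx w (s *i)) = unip w' z *m dg n a].
Proof.
move=> Ww; have mw := Wmid Ww.
have si : conjC (s *i) = - (s *i) :> C by rewrite /=; simpc.
have wwR : conjC (herm w w) = herm w w by rewrite -herm_conj.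
have [->|t0] := eqVneq t 0.
  exists w, (s *i - herm w w / 2), 1; split; [by []| |exact: ltr01|].
    by rewrite rmorphB /= si rmorphM /= wwR fmorphV rmorph_nat; field.
  rewrite rmorph0 scale0r add0r dg1 mulmx1.
  exact: expmx_lim (@exp_series_nil R n w (s *i) mw).
have tc0 : t%:C != 0 by rewrite fmorph_eq0.
have tR : conjC t%:C = t%:C by exact: conjc_real.
have XU := dil_conj (s *i) mw tc0 tR.
set w1 := - _ *: w in XU; set z1 := _ / _ in XU.
have W1 : Wset w1 by rewrite /w1 -fmorphV -rmorphN; exact: WsetZ.
have zz1 : z1 + conjC z1 = - herm w1 w1.
  rewrite /z1 /w1 hermZl hermZr !(rmorphM, rmorphN, rmorphD) /= !fmorphV !rmorphM /= si wwR tR.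
  by rewrite rmorph_nat; field.
have E := expmx_lim (exp_series_conj (unipV (Wmid W1) zz1) XU (@exp_series_dil R n t)).
have e0 : 0 < (expR t)%:C by rewrite ltcR expR_gt0.
have hA : Hset (SU_of (unip_SU W1 zz1)).
  by exists w1, z1, 1; split; [| |exact: ltr01|rewrite dg1 mulmx1].
have hD : Hset (SU_of (dg_SU e0)).
  exists 0, 0, (expR t)%:C; split; [exact: Wset0| |by []|by rewrite unip00 mul1mx].
  by rewrite -[X in herm X _](scale0r 0) hermZl mul0r rmorph0 addr0 oppr0.
have [_ HM HV] := Hset_subgroup.
have [w' [z' [a' [W' zz' a0' E']]]] := HM _ _ (HM _ _ hA hD) (HV _ hA).
exists w', z', a'; split; [exact: W'|exact: zz'|exact: a0'|].
rewrite E -E'; congr (_ *m _).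
rewrite /= -[LHS](mulKmx (SU_unit (unip_SU W1 zz1))) unipV//; first by rewrite mulmx1.
exact: Wmid.
Qed.

(** [Hset] is a subgroup containing the generators. Conversely each factor of an element of it is a
    single exponential: the logarithm of [unip w z] has corner i Im z, because Re z is
    [- herm w w / 2], and that of [dg n a] is ln a times [dilmx]. *)
Lemma HcE : Hc c = Hset.
Proof.
apply/seteqP; split.
  apply: smallest_sub; first exact: Hset_subgroup.
  move=> g [X /H_lieP[t [w [s [Ww ->]]]] gE].
  by have [w' [z [a [Ww' zz a0 E]]]] := expmx_lie t s Ww; exists w', z, a; rewrite gE E.
move=> g [w [z [a [Ww zz a0 gE]]]] K [[_ KM _] LK].
have [b b0 ab] := posC a0.
have -> : g = (SU_of (unip_SU Ww zz) * SU_of (dg_SU a0))%g by apply: val_inj; rewrite /= gE.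
apply: KM; apply: LK.
  exists (0%:C *: dilmx C n + nilmx w ((complex.Im z) *i)).
    by apply/H_lieP; exists 0, w, (complex.Im z).
  rewrite rmorph0 scale0r add0r /=.
  rewrite (expmx_lim (@exp_series_nil R n w _ (Wmid Ww))); congr unip.
  have -> : herm w w = - (z + conjC z) by rewrite zz opprK.
  rewrite mulNr opprK addcJ mulrC mulKf ?pnatr_eq0//.
  by case: (z) => x y /=; simpc.
exists ((ln b)%:C *: dilmx C n + nilmx 0 (0 *i)).
  by apply/H_lieP; exists (ln b), 0, 0; split=> //; exact: Wset0.
rewrite (_ : nilmx 0 _ = 0); last first.
  have /eqP := @unip_nilmx C n 0 0; rewrite unip00 eq_sym -subr_eq0 addrAC subrr add0r => /eqP h.
  exact: h.
by rewrite addr0 (expmx_lim (@exp_series_dil R n _)) lnK// -ab.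
Qed.

End ConnectedSubgroup.

(** * Two-sided estimates of the 2 x 2 minors *)

Section HorosphericalMinors.
Variables (C : numClosedFieldType) (n : nat).
Hypothesis n_gt3 : (3 < n)%N.
Local Notation M := 'M[C]_n.+2.
Local Notation V := 'rV[C]_n.+2.
Local Notation o1 := (Ordinal (isT : 1 < n.+2)%N).
Local Notation on := (tau o1).
Implicit Types (i j k l : 'I_n.+2) (w : V).

Definition mnr (h : M) i j k l : C := h i k * h j l - h i l * h j k.

Let n_gt1 : (1 < n)%N. Proof. by apply: leq_trans n_gt3. Qed.

Lemma on_val : val on = n. Proof. by apply/val_on/ltnW. Qed.

Lemma tau_eq0 i : (tau i == ord0) = (i == ord_max).
Proof. by rewrite -(inj_eq (inv_inj (@tauK n)) i) tau_max. Qed.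

Lemma tau_eqM i : (tau i == ord_max) = (i == ord0).
Proof. by rewrite -(inj_eq (inv_inj (@tauK n)) i) tau0. Qed.

Lemma sum_edges (F : 'I_n.+2 -> C) : F ord0 = 0 -> F ord_max = 0 ->
  \sum_i F i = \sum_(i : 'I_n.+2 | (2 <= i < n)%N) F i + (F o1 + F on).
Proof.
move=> F0 FM; rewrite (bigID (fun i : 'I_n.+2 => (2 <= i < n)%N)) /=; congr (_ + _).
have vn := on_val.
rewrite (bigD1 o1)//= (bigD1 on)/=; last first.
  by rewrite (eq_sym on) o1_on// andbT subn2 /= ltnn andbF.
rewrite big1 ?addr0// => i /andP[/andP[imid i1] iN].
have [->//|i0] := eqVneq i ord0; have [->//|iM] := eqVneq i ord_max.
move: imid i0 iM i1 iN; rewrite -!val_eqE vn /=; have := ltn_ord i; lia.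
Qed.

Lemma herm_mid w : mid w -> herm w w =
  \sum_(i : 'I_n.+2 | (2 <= i < n)%N) `|w 0 i| ^+ 2 +
  (w 0 on * conjC (w 0 o1) + w 0 o1 * conjC (w 0 on)).
Proof.
move=> [w0 wM]; rewrite herm_sum sum_edges ?w0 ?wM ?rmorph0 ?mulr0// tauK.
by congr (_ + _); apply: eq_bigr => i imid; rewrite tau_mid// normCK.
Qed.

(** n >= 4 enters here: there are two middle indices, so one remains beside any given index. *)
Lemma mid_other i : exists2 k : 'I_n.+2, (2 <= k < n)%N & k != i.
Proof.
have h2 : (2 < n.+2)%N by lia.
have h3 : (3 < n.+2)%N by lia.
have [i2|i2] := eqVneq i (Ordinal h2).
  by exists (Ordinal h3); rewrite /= ?n_gt3// i2 -val_eqE.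
by exists (Ordinal h2); rewrite 1?eq_sym//= ltnW.
Qed.

Section Entries.
Variables (w : V) (z a : C).
Hypotheses (mw : mid w) (zz : z + conjC z = - herm w w) (a_gt0 : 0 < a).
Let h : M := unip w z *m dg n a.

Lemma horo_entry i j : h i j =
  if j == ord0 then a * (i == ord0)%:R
  else if j == ord_max then
    a^-1 * ((i == ord_max)%:R - conjC (w 0 (tau i)) + z * (i == ord0)%:R)
  else (i == j)%:R + (i == ord0)%:R * w 0 j.
Proof.
have [w0 wM] := mw.
have -> : h i j = ((delta_mx 0 i : V) *m h) 0 j by rewrite -rowE [RHS]mxE.
rewrite /h mulmxA row_dg row_unip herm_conj herm_delta !mxE !eqxx w0 wM /=.
rewrite (eq_sym ord0 i) (eq_sym ord_max i) (eq_sym j i).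
have [->|j0] := eqVneq j ord0; first by rewrite w0 /=; ring.
have [->|jM] := eqVneq j ord_max; last by rewrite /=; ring.
by rewrite wM /=; ring.
Qed.

Lemma entry_colM i : h i ord_max =
  a^-1 * ((i == ord_max)%:R - conjC (w 0 (tau i)) + z * (i == ord0)%:R).
Proof. by rewrite horo_entry (_ : (ord_max == ord0) = false) // eqxx. Qed.

Lemma entry_corner : h ord0 ord_max = z / a.
Proof.
have [w0 wM] := mw; rewrite entry_colM tau0 wM rmorph0 /=.
by rewrite rmorph0 subr0 add0r mulr1 mulrC.
Qed.

Let mid_neq i : (2 <= i < n)%N -> (i == ord0 = false) * (i == ord_max = false).
Proof.
move=> imid; split; apply/negbTE; rewrite -val_eqE /=; lia.
Qed.

Lemma entry_mid i : (2 <= i < n)%N -> h i i = 1.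
Proof. by move=> /mid_neq[i0 iM]; rewrite horo_entry i0 iM eqxx mul0r addr0. Qed.

Lemma entry_mid0 i j : (2 <= j < n)%N -> i != j -> i != ord0 -> h i j = 0.
Proof.
by move=> /mid_neq[j0 jM] ij i0; rewrite horo_entry j0 jM (negPf ij) (negPf i0) mul0r addr0.
Qed.

Lemma entry_inner i j : j != ord_max -> i != ord0 -> i != j -> h i j = 0.
Proof.
move=> jM i0 ij; rewrite horo_entry (negPf i0) mulr0 (negPf jM) (negPf ij) mul0r addr0.
by case: ifP.
Qed.

Section Lower.
Variable m : C.
Hypothesis hm : forall i j k l, `|mnr h i j k l| <= m.

Let m_ge0 : 0 <= m.
Proof. exact: le_trans (normr_ge0 _) (hm ord0 ord0 ord0 ord0). Qed.

Let m5 (x : C) : `|x| <= m -> `|x| <= 5 * m.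
Proof. by move/le_trans; apply; rewrite ler_peMl// ler1n. Qed.

(** Up to sign, the minor on rows 0, i and columns i, last is A i = (w_i conj w_(tau i) + z) / a.
    The real part of z is tied to w, so A o1 + A on together with the imaginary part of A k, k a
    middle index, gives S / a, where S is the sum of the middle squares. This costs 4 m, and z / a =
    A k - |w_k|^2 / a costs one more. *)
Lemma corner_bound : `|h ord0 ord_max| <= 5 * m.
Proof.
have [w0 wM] := mw; have [k kmid _] := mid_other ord0.
have [k0 kM] := mid_neq kmid.
have aR : conjC a = a by apply/CrealP; rewrite gtr0_real.
have an0 : a != 0 by rewrite gt_eqF.
have h0M := entry_corner.
have minE i : i != ord0 -> i != ord_max ->
    mnr h ord0 i i ord_max = - (w 0 i * conjC (w 0 (tau i)) + z) / a.
  move=> i0 iM; rewrite /mnr h0M entry_colM !horo_entry !(negPf i0) !(negPf iM) !eqxx (eq_sym ord0 i) (negPf i0) /=.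
  by field.
pose A i := (w 0 i * conjC (w 0 (tau i)) + z) / a.
have Am i : i != ord0 -> i != ord_max -> `|A i| <= m.
  by move=> i0 iM; rewrite -normrN -mulNr -minE.
have A1 : `|A o1| <= m by apply: Am; rewrite -val_eqE //=; lia.
have An : `|A on| <= m by apply: Am; rewrite -val_eqE on_val //=; lia.
have Ak : `|A k| <= m by apply: Am; rewrite ?k0 ?kM.
pose S := \sum_(i : 'I_n.+2 | (2 <= i < n)%N) `|w 0 i| ^+ 2.
have S0 : 0 <= S by apply: sumr_ge0 => i _; rewrite exprn_ge0.
have Sk : `|w 0 k| ^+ 2 <= S.
  by rewrite /S (bigD1 k)//= lerDl sumr_ge0// => i _; rewrite exprn_ge0.
have SE : S / a = (A k - conjC (A k)) - (A o1 + A on).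
  have -> : S = - (z + conjC z) - (w 0 on * conjC (w 0 o1) + w 0 o1 * conjC (w 0 on)).
    by rewrite zz herm_mid// -/S; ring.
  rewrite /A tauK (tau_mid kmid) rmorphM rmorphD /= rmorphM /= conjCK fmorphV /= aR.
  by field.
have S4 : S / a <= 4 * m.
  rewrite -[S / a]ger0_norm; last by rewrite divr_ge0// ltW.
  rewrite SE (le_trans (ler_normB _ _))//.
  rewrite (_ : 4 * m = (m + m) + (m + m)); last by ring.
  apply: lerD; first by apply: le_trans (ler_normB _ _) _; rewrite lerD ?norm_conjC.
  by apply: le_trans (ler_normD _ _) _; rewrite lerD.
have -> : h ord0 ord_max = A k - `|w 0 k| ^+ 2 / a.
  by rewrite h0M /A (tau_mid kmid) normCK; field.
rewrite (le_trans (ler_normB _ _))// (_ : 5 * m = m + 4 * m); last by ring.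
rewrite lerD// (le_trans _ S4)// ger0_norm ?divr_ge0 ?exprn_ge0 ?(ltW a_gt0)//.
by rewrite ler_pM2r ?invr_gt0.
Qed.

(** Away from the corner the entry is itself a minor: a middle index k supplies a diagonal entry 1,
    and the complementary product vanishes. *)
Lemma horo_lower i j : `|h i j| <= 5 * m.
Proof.
have [iM|iM] := eqVneq i ord0; last first.
  have [k kmid ki] := mid_other i; have [k0 kM] := mid_neq kmid.
  have [->|jM] := eqVneq j ord_max.
    apply: m5; have := hm k i k ord_max.
    have E2 : h i k = 0 by apply: entry_mid0; rewrite // eq_sym.
    by rewrite /mnr (entry_mid kmid) E2 mul1r mulr0 subr0.
  have [<-|ij] := eqVneq i j; last by rewrite entry_inner// normr0 mulr_ge0.
  apply: m5; have := hm k i k i.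
  have E2 : h i k = 0 by apply: entry_mid0; rewrite // eq_sym.
  by rewrite /mnr (entry_mid kmid) E2 mul1r mulr0 subr0.
rewrite iM; have [->|jM] := eqVneq j ord_max; first exact: corner_bound.
have [k kmid kj] := mid_other j; have [k0 kM] := mid_neq kmid.
apply: m5; have := hm ord0 k j k.
have E2 : h k j = 0 by apply: entry_inner; rewrite ?k0.
by rewrite /mnr (entry_mid kmid) E2 mulr1 mulr0 subr0.
Qed.

End Lower.

Section Upper.
Variables (kap B : C).
Hypotheses (kap1 : 1 <= kap) (wkap : forall i, `|w 0 i| ^+ 2 <= kap * herm w w)
  (hB : forall i j, `|h i j| <= B).

Let aR : conjC a = a. Proof. by apply/CrealP; rewrite gtr0_real. Qed.
Let an0 : a != 0. Proof. by rewrite gt_eqF. Qed.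

Let B0 : 0 <= B. Proof. exact: le_trans (normr_ge0 _) (hB ord0 ord0). Qed.

Let kB : B <= 2 * kap * B.
Proof. by rewrite ler_peMl// mulr_ege1// ler1n. Qed.

Let B1 : 1 <= B.
Proof.
have [k kmid _] := mid_other ord0.
by have := hB k k; rewrite entry_mid// normr1.
Qed.

(** This controls the terms of a minor that are quadratic in w. By [wkap] they are dominated by
    [herm w w], which is minus twice the real part of z, and z / a is the corner entry. *)
Lemma ww_bound i j : `|w 0 i| * `|w 0 j| / a <= 2 * kap * B.
Proof.
have [w0 wM] := mw.
have w2 : `|w 0 i| * `|w 0 j| <= kap * herm w w.
  case: (real_leP (normr_real (w 0 i)) (normr_real (w 0 j))) => [ij|/ltW ij].
    by apply: le_trans (wkap j); rewrite expr2 ler_wpM2r.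
  by apply: le_trans (wkap i); rewrite expr2 ler_wpM2l.
have hz : `|herm w w| <= 2 * `|z|.
  by rewrite -normrN -zz (le_trans (ler_normD _ _))// norm_conjC mulr2n mulrDl !mul1r.
have h0M : `|z| / a <= B.
  by have := hB ord0 ord_max; rewrite entry_corner normrM normfV (gtr0_norm a_gt0).
have wge0 : 0 <= herm w w.
  have : 0 <= kap * herm w w by apply: le_trans (wkap i); rewrite exprn_ge0.
  by rewrite pmulr_rge0// (lt_le_trans ltr01).
apply: (@le_trans _ _ (2 * kap * (`|z| / a))); last first.
  by rewrite ler_wpM2l// mulr_ge0// (le_trans ler01).
rewrite mulrA ler_pM2r ?invr_gt0//; apply: le_trans w2 _.
rewrite mulrAC mulrC ler_wpM2r ?(le_trans ler01)//.
by rewrite -[herm w w]ger0_norm.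
Qed.

(** Each of the two products in a minor is already linear in B, with no cancellation between them.
    The conditions on k and l can always be arranged by exchanging the two factors, since k and l
    differ. *)
Lemma horo_upper_aux i j k l : i != j -> k != l -> l != ord0 -> k != ord_max ->
  `|h i k * h j l| <= 2 * kap * B.
Proof.
move=> ij kl l0 kM; have [w0 wM] := mw.
have [iE|i0] := eqVneq i ord0; last first.
  have [ik|ik] := eqVneq i k; last first.
    by rewrite entry_inner// mul0r normr0 (le_trans B0).
  have -> : h i k = 1 by rewrite ik horo_entry (negPf kM) -ik (negPf i0) eqxx mul0r addr0.
  by rewrite mul1r (le_trans (hB _ _)).
have j0 : j != ord0 by rewrite -iE eq_sym.
have [jl|jl] := eqVneq j l.
  have [lM|lM] := eqVneq l ord_max; last first.
    have -> : h j l = 1 by rewrite jl horo_entry (negPf lM) (negPf l0) eqxx mul0r addr0.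
    by rewrite mulr1 (le_trans (hB _ _)).
  rewrite jl lM iE entry_colM eqxx tau_max w0 rmorph0 /=.
  rewrite horo_entry (negPf kM); have [k0|k0] := eqVneq k ord0.
    rewrite (_ : _ * _ = 1) ?normr1 ?(le_trans B1)//.
    by rewrite /=; field.
  have := hB (tau k) ord_max; rewrite entry_colM tauK.
  rewrite tau_eqM tau_eq0 (negPf k0) (negPf kM) /= => hk.
  rewrite (le_trans _ (le_trans hk kB))// !mulr0 !addr0 subr0 mulr1 mul1r add0r sub0r.
  by rewrite !normrM normrN norm_conjC mulrC.
have [lM|lM] := eqVneq l ord_max; last first.
  by rewrite [h j l]entry_inner// mulr0 normr0 (le_trans B0).
have jM : j != ord_max by rewrite -lM.
have -> : h j l = - (conjC (w 0 (tau j)) / a).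
  by rewrite lM entry_colM (negPf jM) (negPf j0) /=; field.
have [k0|k0] := eqVneq k ord0.
  rewrite k0 iE horo_entry /= !mulr1 mulrN mulrCA divff// mulr1 normrN norm_conjC.
  have := hB ord0 (tau j); rewrite horo_entry tau_eq0 (negPf jM) tau_eqM (negPf j0) eq_sym tau_eq0 (negPf jM) /=.
  by rewrite add0r mul1r => /le_trans; apply.
rewrite iE horo_entry (negPf k0) (negPf kM) eq_sym (negPf k0) /= add0r mul1r.
rewrite mulrN normrN mulrA !normrM norm_conjC normfV (gtr0_norm a_gt0).
exact: ww_bound.
Qed.

Lemma horo_upper i j k l : `|mnr h i j k l| <= 2 * (2 * kap * B).
Proof.
have K0 : 0 <= 2 * kap * B by apply: le_trans kB.
have [->|ij] := eqVneq i j; first by rewrite /mnr mulrC subrr normr0 mulr_ge0.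
have [->|kl] := eqVneq k l; first by rewrite /mnr subrr normr0 mulr_ge0.
have prod (i' j' k' l' : 'I_n.+2) : i' != j' -> k' != l' -> `|h i' k' * h j' l'| <= 2 * kap * B.
  move=> ij' kl'; have [l0|l0] := eqVneq l' ord0.
    rewrite mulrC; have [kM|kM] := eqVneq k' ord0; first by rewrite kM l0 eqxx in kl'.
    by apply: horo_upper_aux; rewrite // 1?eq_sym// l0.
  have [kM|kM] := eqVneq k' ord_max; last exact: horo_upper_aux.
  rewrite mulrC; have [lM|lM] := eqVneq l' ord_max; first by rewrite kM lM eqxx in kl'.
  by apply: horo_upper_aux; rewrite // 1?eq_sym// kM.
rewrite /mnr (le_trans (ler_normB _ _))// mulr2n mulrDl mul1r lerD//; apply: prod => //.
by rewrite eq_sym.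
Qed.

End Upper.

End Entries.

End HorosphericalMinors.

(** * Position of W relative to isotropic vectors *)

Section Wgeometry.
Variables (R : realType) (n : nat) (c : R).
Hypotheses (n_gt3 : (3 < n)%N) (c_gt0 : 0 < c) (c_le1 : c <= 1).
Local Notation C := R[i].
Local Notation V := 'rV[C]_n.+2.
Local Open Scope complex_scope.
Local Notation o1 := (Ordinal (isT : 1 < n.+2)%N).
Local Notation on := (tau o1).
Local Notation W := (@Wset R n c).
Implicit Types u w q : V.

Let n_gt1 : (1 < n)%N. Proof. by apply: leq_trans n_gt3. Qed.

Lemma herm_mid_parts w : mid w -> exists2 S : R,
  herm w w = (S + 2 * (complex.Re (w 0 o1) * complex.Re (w 0 on) +
                       complex.Im (w 0 o1) * complex.Im (w 0 on)))%:C &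
  forall k : 'I_n.+2, (2 <= k < n)%N -> `|w 0 k| ^+ 2 <= S%:C.
Proof.
move=> mw; rewrite herm_mid//; set T := \sum_(i | _) _.
have Tk (k : 'I_n.+2) : (2 <= k < n)%N -> `|w 0 k| ^+ 2 <= T.
  by move=> kmid; rewrite /T (bigD1 k)//= lerDl sumr_ge0// => i _; rewrite exprn_ge0.
have TR : T = (complex.Re T)%:C.
  by rewrite RRe_real// ger0_real// sumr_ge0// => i _; rewrite exprn_ge0.
exists (complex.Re T); last by rewrite -TR.
rewrite rmorphD /= -TR; congr (_ + _).
case: (w 0 o1) => a b; case: (w 0 on) => d e /=.
by apply/eqP; rewrite eq_complex /=; apply/andP; split; apply/eqP; ring.
Qed.

(** [herm u u] is 2 (a d + b e) plus a nonnegative contribution of the middle coordinates, so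
    isotropy fixes the sign of a d + b e. These inequalities decide the determinants in [Wsolve] and
    [Wtransverse]. *)
Lemma isotropic_parts u : mid u -> herm u u = 0 -> u != 0 ->
  let a := complex.Re (u 0 o1) in let b := complex.Im (u 0 o1) in
  let d := complex.Re (u 0 on) in let e := complex.Im (u 0 on) in
  [/\ a * d + b * e <= 0, 0 < c * (a ^+ 2 + b ^+ 2) + (d ^+ 2 + e ^+ 2) &
   (forall k : 'I_n.+2, (2 <= k < n)%N -> u 0 k = 0) -> a * d + b * e = 0].
Proof.
move=> mu uu u0 a b d e; have [S uE Sk] := herm_mid_parts mu.
have SE : S + 2 * (a * d + b * e) = 0.
  by move: uE; rewrite uu => /(congr1 (@complex.Re R)).
have [k2 kmid2 _] := @mid_other n n_gt3 ord0.
have S0 : 0 <= S by rewrite -lecR (le_trans _ (Sk _ kmid2))// exprn_ge0.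
split; first by lra.
  rewrite lt0r addr_ge0 ?andbT; last by rewrite addr_ge0 ?sqr_ge0.
    apply: contra_neq u0 => abde.
    have ca : 0 <= c * (a ^+ 2 + b ^+ 2) by rewrite mulr_ge0 ?(ltW c_gt0)// addr_ge0 ?sqr_ge0.
    have [d2 e2] : 0 <= d ^+ 2 /\ 0 <= e ^+ 2 by rewrite !sqr_ge0.
    have [a2 b2] : 0 <= a ^+ 2 /\ 0 <= b ^+ 2 by rewrite !sqr_ge0.
    have d0 : d = 0 by apply/eqP; rewrite -sqrf_eq0; apply/eqP; lra.
    have e0 : e = 0 by apply/eqP; rewrite -sqrf_eq0; apply/eqP; lra.
    have ab0 : a ^+ 2 + b ^+ 2 = 0.
      by have : c * (a ^+ 2 + b ^+ 2) = 0 by [lra]; move/eqP; rewrite mulf_eq0 gt_eqF//= => /eqP.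
    have a0 : a = 0 by apply/eqP; rewrite -sqrf_eq0; apply/eqP; lra.
    have b0 : b = 0 by apply/eqP; rewrite -sqrf_eq0; apply/eqP; lra.
    have S00 : S = 0 by move: SE; rewrite a0 b0; lra.
    have [u00 uM] := mu.
    apply/rowP => i; rewrite mxE.
    have [imid|inmid] := boolP (2 <= i < n)%N.
      have := Sk i imid; rewrite S00 rmorph0 => h.
      have : `|u 0 i| ^+ 2 = 0 by apply/le_anti; rewrite h exprn_ge0.
      by move/eqP; rewrite expf_eq0 /= normr_eq0 => /eqP.
    have [->//|i0] := eqVneq i ord0; have [->//|iM] := eqVneq i ord_max.
    have [->|i1] := eqVneq i o1.
      by apply/eqP; rewrite eq_complex -/a -/b a0 b0 /= !eqxx.
    have [->|iN] := eqVneq i on.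
      by apply/eqP; rewrite eq_complex -/d -/e d0 e0 /= !eqxx.
    exfalso; move: inmid i0 iM i1 iN; rewrite -!val_eqE (on_val n_gt3) /=.
    by have := ltn_ord i; lia.
  by rewrite mulr_ge0 ?(ltW c_gt0)// addr_ge0 ?sqr_ge0.
move=> uk; have : herm u u = (2 * (a * d + b * e))%:C.
  rewrite herm_mid// big1 ?add0r => [|i imid]; last by rewrite uk// normr0 expr0n.
  rewrite /a /b /d /e; case: (u 0 o1) => a' b'; case: (u 0 on) => d' e' /=.
  by apply/eqP; rewrite eq_complex /=; apply/andP; split; apply/eqP; ring.
by rewrite uu => /(congr1 (@complex.Re R)) /= h; lra.
Qed.

Lemma solve2 (A B C' D y1 y2 : R) : A * D - B * C' != 0 ->
  exists p q : R, A * p + B * q = y1 /\ C' * p + D * q = y2.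
Proof.
move=> d0; exists ((y1 * D - B * y2) / (A * D - B * C')), ((A * y2 - y1 * C') / (A * D - B * C')).
by split; field.
Qed.

(** A nonzero middle coordinate of u suffices, as W leaves the middle coordinates free. If there is
    none, a d + b e = 0, and the real 2 x 2 system for the coordinate of w at [o1] has determinant -
    (c (a^2 + b^2) + d^2 + e^2). *)
Lemma Wsolve u (y : C) : mid u -> herm u u = 0 -> u != 0 ->
  exists2 w, W w & herm u w = y.
Proof.
move=> mu uu u0; have [neg pos zero] := isotropic_parts mu uu u0.
have [[k kmid uk]|noK] := pselect (exists2 k : 'I_n.+2, (2 <= k < n)%N & u 0 k != 0).
  exists ((conjC (y / u 0 k)) *: delta_mx 0 k).
    have kon : (k == on) = false.
      by apply/negbTE; rewrite -val_eqE (on_val n_gt3) /=; lia.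
    split; [split|]; rewrite !mxE eqxx /= 1?eq_sym.
    - by rewrite (_ : (k == ord0) = false) ?mulr0//; apply/negbTE; rewrite -val_eqE /=; lia.
    - by rewrite (_ : (k == ord_max) = false) ?mulr0//; apply/negbTE; rewrite -val_eqE /=; lia.
    - rewrite kon mulr0 (_ : (o1 == k) = false); last by apply/negbTE; rewrite -val_eqE /=; lia.
      by rewrite mulr0 /sig /= mulr0.
  by rewrite hermZr conjCK herm_delta (tau_mid kmid) divfK.
have uk0 (k : 'I_n.+2) : (2 <= k < n)%N -> u 0 k = 0.
  by move=> kmid; apply: contrapT => /eqP uk; apply: noK; exists k.
move: pos (zero uk0) => {neg zero}; case E1: (u 0 o1) => [a b]; case En: (u 0 on) => [d e] /= pos zero.
have [|p [q [h1 h2]]] := @solve2 (d + a) (e + c * b) (e + b) (- (d + c * a)) (complex.Re y) (complex.Im y).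
  have -> : (d + a) * - (d + c * a) - (e + c * b) * (e + b) =
    - (c * (a ^+ 2 + b ^+ 2) + (d ^+ 2 + e ^+ 2)) - (1 + c) * (a * d + b * e) by ring.
  by rewrite zero mulr0 subr0 oppr_eq0 gt_eqF.
have o1n := o1_on n_gt1.
exists ((p +i* q) *: delta_mx 0 o1 + (p +i* (c * q)) *: delta_mx 0 on).
  split; [split|]; rewrite !mxE !eqxx /= ?o1n ?(eq_sym on) ?o1n ?mulr0 ?mulr1 ?addr0 ?add0r//.
  - rewrite (_ : (ord0 == on) = false) ?mulr0//; apply/negbTE; rewrite -val_eqE (on_val n_gt3) /=; lia.
  - rewrite (_ : (ord_max == on) = false) ?mulr0//; last by apply/negbTE; rewrite -val_eqE (on_val n_gt3) /=; lia.
    by rewrite (_ : (ord_max == o1) = false) ?mulr0 ?addr0//; apply/negbTE; rewrite -val_eqE /=; lia.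
rewrite hermDr !hermZr !herm_delta tauK E1 En.
apply/eqP; rewrite eq_complex /= -h1 -h2.
by apply/andP; split; apply/eqP; ring.
Qed.

(** Membership of q + k u in W is a real 2 x 2 system in k, with determinant c (a^2 + b^2) + d^2 +
    e^2 - (1 + c) (a d + b e); isotropy makes the last term nonnegative, so the determinant is
    positive. *)
Lemma Wtransverse u q : mid u -> mid q -> herm u u = 0 -> u != 0 ->
  exists k : C, W (q + k *: u).
Proof.
move=> mu [q0 qM] uu u0; have [neg pos _] := isotropic_parts mu uu u0; have [u00 uM] := mu.
move: neg pos; case E1: (u 0 o1) => [a b]; case En: (u 0 on) => [d e] /= neg pos.
pose y : C := sig c (q 0 o1) - q 0 on.
have [|p [r [h1 h2]]] := @solve2 (d - a) (b - e) (e - c * b) (d - c * a) (complex.Re y) (complex.Im y).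
  have -> : (d - a) * (d - c * a) - (b - e) * (e - c * b) =
    (c * (a ^+ 2 + b ^+ 2) + (d ^+ 2 + e ^+ 2)) - (1 + c) * (a * d + b * e) by ring.
  have : (1 + c) * (a * d + b * e) <= 0 by rewrite mulr_ge0_le0// addr_ge0// ltW.
  by move=> ?; rewrite gt_eqF//; lra.
exists (p +i* r); split; [split|]; rewrite !mxE ?q0 ?qM ?u00 ?uM ?mulr0 ?addr0//.
have yE : (p +i* r) * (d +i* e) - sig c ((p +i* r) * (a +i* b)) = y.
  apply/eqP; rewrite eq_complex /= -h1 -h2.
  by apply/andP; split; apply/eqP; ring.
have yq : sig c (q 0 o1) = y + q 0 on by rewrite subrK.
by rewrite sigD E1 En yq -yE addrAC subrK addrC.
Qed.

(** On W the form equals S + 2 a^2 + 2 c b^2, with a + b i the coordinate at [o1] and S the middle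
    contribution; dividing by c <= 1 makes every coefficient at least 1. *)
Lemma W_bound w i : W w -> `|w 0 i| ^+ 2 <= (c^-1)%:C * herm w w.
Proof.
move=> [mw ws]; have [S hwE Sk] := herm_mid_parts mw; have [w0 wM] := mw.
have [k2 kmid2 _] := @mid_other n n_gt3 ord0.
have S0 : 0 <= S by rewrite -lecR (le_trans _ (Sk _ kmid2))// exprn_ge0.
rewrite hwE ws; rewrite /sig /= -rmorphM /=.
case E1: (w 0 o1) => [a b] /=.
set T := S + _.
have a2 := sqr_ge0 a; have b2 := sqr_ge0 b.
have cV1 : 1 <= c^-1 by rewrite invf_ge1.
have cVc : c^-1 * c = 1 by rewrite mulVf// gt_eqF.
have TE : c^-1 * T = c^-1 * S + 2 * c^-1 * a ^+ 2 + 2 * b ^+ 2.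
  by rewrite /T -!expr2; have -> : b * (c * b) = c * b ^+ 2 by [ring]; field; rewrite gt_eqF.
have ST : S <= c^-1 * T by rewrite TE; nra.
have abT : a ^+ 2 + b ^+ 2 <= c^-1 * T by rewrite TE; nra.
have T0 : 0 <= c^-1 * T by apply: le_trans ST.
have [imid|inmid] := boolP (2 <= i < n)%N.
  by apply: le_trans (Sk i imid) _; rewrite lecR.
have [->|i0] := eqVneq i ord0; first by rewrite w0 normr0 expr0n /= lecR.
have [->|iM] := eqVneq i ord_max; first by rewrite wM normr0 expr0n /= lecR.
have [->|i1] := eqVneq i o1; first by rewrite -add_Re2_Im2 E1 /= lecR.
have [->|iN] := eqVneq i on.
  rewrite ws E1 -add_Re2_Im2 /sig /= lecR; apply: le_trans abT.
  by rewrite lerD2l exprMn ler_piMl// expr_le1// ltW.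
exfalso; move: inmid i0 iM i1 iN; rewrite -!val_eqE (on_val n_gt3) /=.
by have := ltn_ord i; lia.
Qed.

End Wgeometry.

(** * The comparison of rho h with h *)

Section RhoAsymp.
Variables (R : realType) (n : nat) (c : R).
Hypotheses (n_gt3 : (3 < n)%N) (c_gt0 : 0 < c) (c_le1 : c <= 1).
Local Notation C := R[i].
Local Open Scope complex_scope.

Lemma mx_norm_le p q (A : 'M[C]_(p, q)) (b : C) : 0 <= b ->
  (mx_norm A <= b) <-> mxbd b A.
Proof.
move=> b0; rewrite -[b]/((NngNum b0)%:num) mx_normE num_le; split=> [/bigmax_leP[_ h] i j|h].
  by have := h (i, j) isT; rewrite -num_le.
apply/bigmax_leP; split=> [|[i j] _]; first by rewrite -num_le.
by rewrite -num_le /=; exact: h.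
Qed.

Lemma mxbd_norm p q (A : 'M[C]_(p, q)) : mxbd (mx_norm A) A.
Proof. by apply/mx_norm_le => //; rewrite mx_normE. Qed.

Lemma rho_mxbd (h : 'M[C]_n.+2) (b : C) : 0 <= b ->
  mxbd b (rho h) <-> forall i j k l, `|mnr h i j k l| <= b.
Proof.
move=> b0; split=> [hb|hb p q]; last by rewrite mxE; exact: hb.
have ord (i j k l : 'I_n.+2) : (i < j)%N -> (k < l)%N -> `|mnr h i j k l| <= b.
  move=> ij kl.
  have p_in : (i, j) \in wedge_index n by rewrite inE.
  have q_in : (k, l) \in wedge_index n by rewrite inE.
  have := hb (enum_rank_in p_in (i, j)) (enum_rank_in p_in (k, l)).
  by rewrite mxE /minor2 !enum_rankK_in.
move=> i j k l.
have swr : mnr h j i k l = - mnr h i j k l by rewrite /mnr; ring.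
have swc i' j' : mnr h i' j' l k = - mnr h i' j' k l by rewrite /mnr; ring.
case: (ltngtP i j) => [ij|ij|/val_inj ->]; last by rewrite /mnr mulrC subrr normr0.
  case: (ltngtP k l) => [kl|kl|/val_inj ->]; last by rewrite /mnr subrr normr0.
    exact: ord.
  by rewrite -normrN -swc; exact: ord.
rewrite -normrN -swr.
case: (ltngtP k l) => [kl|kl|/val_inj ->]; last by rewrite /mnr subrr normr0.
  exact: ord.
by rewrite -normrN -swc; exact: ord.
Qed.

Lemma Hc_upper (g : SU R n) (b : C) : Hc c g -> 0 <= b -> mxbd b (\val g) ->
  forall i j k l, `|mnr (\val g) i j k l| <= 2 * (2 * (c^-1)%:C * b).
Proof.
rewrite HcE ?(leq_trans _ n_gt3)// => -[w [z [a [Ww zz a0 ->]]]] b0 gb i j k l.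
apply: horo_upper; [exact: n_gt3|exact: Wmid Ww|exact: zz|exact: a0| | |exact: gb].
  by rewrite (_ : 1 = (1 : R)%:C) // lecR invf_ge1.
by move=> i'; exact: W_bound.
Qed.

Lemma rho_asymp_Hc : rho_asymp [set \val h | h in (Hc c : set (SU R n))].
Proof.
have cV1 : 1 <= c^-1 by rewrite invf_ge1.
(* 5 is the constant of [horo_lower], and 4 / c that of [horo_upper] with kap = 1 / c. *)
exists (5 + 4 * c^-1); first by lra.
exists 0 => _ [g Hg <-] _.
have K0 : 0 < 5 + 4 * c^-1 by lra.
have g0 : 0 <= mx_norm (\val g) by rewrite mx_normE.
have r0 : 0 <= mx_norm (rho (\val g)) by rewrite mx_normE.
have up : mx_norm (rho (\val g)) <= (4 * c^-1)%:C * mx_norm (\val g).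
  have up0 : 0 <= (4 * c^-1)%:C * mx_norm (\val g).
    by rewrite mulr_ge0// lecR; lra.
  apply/mx_norm_le => //; apply/rho_mxbd => // i j k l.
  apply: le_trans (Hc_upper Hg g0 (mxbd_norm _) i j k l) _.
  by rewrite rmorphM /= rmorph_nat !mulrA -natrM.
have lo : mx_norm (\val g) <= 5 * mx_norm (rho (\val g)).
  apply/mx_norm_le; first by rewrite mulr_ge0.
  move: Hg; rewrite HcE ?(leq_trans _ n_gt3)// => -[w [z [a [Ww zz a0 gE]]]].
  rewrite gE => i j.
  apply: horo_lower; [exact: n_gt3|exact: Wmid Ww|exact: zz|exact: a0|].
  by rewrite -gE; apply/rho_mxbd => //; exact: mxbd_norm.
apply/andP; split.
  rewrite fmorphV ler_pdivrMl ?ltcR//; apply: le_trans lo _.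
  rewrite ler_wpM2r// rmorphD rmorph_nat lerDl lecR; lra.
apply: le_trans up _; rewrite ler_wpM2r// lecR; lra.
Qed.

End RhoAsymp.

(** * The standard quaternionic structure and its commutant *)

Section Quaternions.
Variables (C : numClosedFieldType) (n : nat).
Hypotheses (n_gt1 : (1 < n)%N) (n_even : ~~ odd n).
Local Notation d := n.+2.
Local Notation M := 'M[C]_d.
Local Notation J := (Jmx C n).
Implicit Types (i j k l : 'I_d).

(** Exchanges 2k and 2k + 1. As n is even, [tau] interchanges the pairs {0, 1} and {n, n + 1} and
    respects this pairing. *)
Definition partner_nat (i : nat) : nat := if odd i then i.-1 else i.+1.
Definition partner i : 'I_d := inord (partner_nat i).

Lemma partner_val i : partner i = partner_nat i :> nat.
Proof.
rewrite inordK// /partner_nat; have := ltn_ord i.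
case: ifP => oi; first by case: (i : nat) oi => //= k _; lia.
rewrite leq_eqVlt => /orP[/eqP[iE]|]; last by lia.
by move: oi n_even; rewrite iE /= => ->.
Qed.

Lemma partnerK : involutive partner.
Proof.
move=> i; apply: val_inj; rewrite /= !partner_val /partner_nat.
case: (boolP (odd i)) => oi /=; last by rewrite oi.
by case: (i : nat) oi => //= k /negbTE ->.
Qed.

Lemma partner_block i : ((partner i < 2)%N = (i < 2)%N) * ((partner i < n)%N = (i < n)%N).
Proof.
rewrite !partner_val /partner_nat; case: ifP => oi; split.
- by case: (i : nat) oi => [|[|[|k]]].
- by apply/idP/idP => h; [case: (ltngtP i n) => // in'; [lia|move: oi; rewrite in' (negPf n_even)]|lia].
- by case: (i : nat) oi => [|[|k]].
- by apply/idP/idP => h; [lia|case: (ltngtP i.+1 n) => //; [lia|move=> iE; move: n_even; rewrite -iE /= oi]].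
Qed.

Lemma tau_val i : tau i = (if (2 <= i < n)%N then i : nat else n.+1 - i)%N :> nat.
Proof. by rewrite /tau; case: ifP => //= _; rewrite subSS. Qed.

Lemma tau_partner i : tau (partner i) = partner (tau i).
Proof.
apply: val_inj; rewrite /= partner_val !tau_val leqNgt !partner_block -leqNgt.
case: ifP => imid; first by rewrite partner_val.
rewrite partner_val /partner_nat oddB ?oddS ?n_even /=; last by have := ltn_ord i; lia.
have := ltn_ord i.
by case: ifP => oi /=; case: (i : nat) oi imid => [|k] //=; lia.
Qed.

(** Outside the middle [tau] reverses parity, because n + 1 is odd; the extra sign on the last pair
    compensates for this, so that [Q] commutes with [J]. *)
Definition qsign i : C := (-1) ^+ (odd i + (n <= i))%N.

Lemma qsign_partner i : qsign (partner i) = - qsign i.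
Proof.
rewrite /qsign leqNgt partner_block -leqNgt partner_val /partner_nat.
rewrite !exprD -mulNr; congr (_ * _); case: ifP => oi; last by rewrite /= oi; ring.
by case: (i : nat) oi => //= k /negbTE -> /=; ring.
Qed.

Lemma qsign_sqr i : qsign i * qsign i = 1.
Proof. by rewrite -expr2 /qsign sqrr_sign. Qed.

Lemma qsign_conj i : conjC (qsign i) = qsign i.
Proof. by rewrite /qsign rmorphXn /= rmorphN rmorph1. Qed.

Lemma qsign_tau i : qsign (tau i) = qsign i.
Proof.
rewrite /qsign tau_val; case: ifP => // imid.
rewrite -signr_odd -[RHS]signr_odd; congr (_ ^+ nat_of_bool _).
rewrite !oddD oddB /=; last by have := ltn_ord i; lia.
rewrite (negbTE n_even) !oddb /=.
have -> : (n <= n.+1 - i)%N = (i < 2)%N by have := ltn_ord i; lia.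
have -> : (n <= i)%N = ~~ (i < 2)%N by move: imid; lia.
by case: (odd i); case: (i < 2)%N.
Qed.

Definition Qmx : M := \matrix_(i, j) (qsign i * (j == partner i)%:R).
Local Notation Q := Qmx.

Lemma eq_partner i j : (j == partner i) = (i == partner j).
Proof. by rewrite -(inj_eq (inv_inj partnerK)) partnerK eq_sym. Qed.

Lemma mulQmx p (A : 'M[C]_(d, p)) i (j : 'I_p) : (Q *m A) i j = qsign i * A (partner i) j.
Proof.
rewrite mxE (bigD1 (partner i))//= big1 ?addr0 => [|k kj]; rewrite !mxE ?eqxx ?mulr1//.
by rewrite (negPf kj) mulr0 mul0r.
Qed.

Lemma mulmxQ p (A : 'M[C]_(p, d)) (i : 'I_p) j :
  (A *m Q) i j = - qsign j * A i (partner j).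
Proof.
rewrite mxE (bigD1 (partner j))//= big1 ?addr0 => [|k kj]; rewrite !mxE.
  by rewrite partnerK eqxx mulr1 qsign_partner mulrC.
by rewrite eq_partner (negPf kj) !mulr0.
Qed.

Lemma QQ : Q *m Q = - 1%:M.
Proof.
apply/matrixP => i j; rewrite mulQmx !mxE qsign_partner partnerK mulrA mulrN qsign_sqr.
by rewrite mulN1r eq_sym.
Qed.

Lemma trQ : Q^T = - Q.
Proof.
apply/matrixP => i j; rewrite !mxE (eq_partner i j).
have [->|_] := eqVneq i (partner j); last by rewrite !mulr0 oppr0.
by rewrite qsign_partner mulNr opprK.
Qed.

Lemma conjQ : map_mx conjC Q = Q.
Proof. by apply/matrixP => i j; rewrite !mxE rmorphM /= qsign_conj rmorph_nat. Qed.

Lemma QJ : Q *m J = J *m Q.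
Proof.
apply/matrixP => i j; rewrite mulQmx mulJmx !mxE qsign_tau; congr (_ * _%:R).
by rewrite tau_partner.
Qed.

Lemma quatQ : quat Q.
Proof.
split; last by rewrite conjQ QQ.
rewrite (_ : Q^t* = - Q); last by rewrite trQ map_mxN conjQ.
by rewrite mulmxN QJ -mulmxA QQ mulmxN mulmx1 opprK.
Qed.

Lemma Q_unit : Q \in unitmx.
Proof.
have : Q *m - Q = 1%:M by rewrite mulmxN QQ opprK.
by case/mulmx1_unit.
Qed.

Definition quaternionic (g : M) := map_mx conjC g *m Q = Q *m g.

Lemma quaternionic_entry g i j : quaternionic g ->
  g (partner i) (partner j) = qsign i * qsign j * conjC (g i j).
Proof.
move=> /matrixP/(_ i (partner j)); rewrite mulQmx mulmxQ partnerK mxE qsign_partner opprK.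
move=> h; rewrite -mulrA h mulrA qsign_sqr mul1r//.
Qed.

Lemma quaternionic_minor g i j : quaternionic g ->
  mnr g i (partner i) j (partner j) =
  qsign i * qsign j * (`|g i j| ^+ 2 + `|g i (partner j)| ^+ 2).
Proof.
move=> qg; rewrite /mnr quaternionic_entry//.
have := quaternionic_entry i (partner j) qg; rewrite partnerK qsign_partner => ->.
by rewrite !normCK; ring.
Qed.

(* The minor on rows i, partner i and columns j, partner j of a quaternionic matrix
   is the norm of a quaternion entry. *)
Lemma quaternionic_minor_bound g i j : quaternionic g ->
  `|g i j| ^+ 2 <= `|mnr g i (partner i) j (partner j)|.
Proof.
move=> qg; rewrite quaternionic_minor// !normrM /qsign !normrX normrN1 !expr1n !mul1r.
by rewrite ger0_norm ?lerDl ?addr_ge0 ?exprn_ge0.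
Qed.

(** conj g = Q g Q^-1 makes the determinant real, and the isometry condition makes its square 1. *)
Lemma quaternionic_det g : quaternionic g -> g *m J *m g^t* = J -> \det g = 1 \/ \det g = -1.
Proof.
move=> qg gJ.
have detc : conjC (\det g) = \det g.
  have := congr1 determinant qg; rewrite !det_mulmx det_map_mx mulrC.
  by apply: mulfI; rewrite -unitfE -unitmxE Q_unit.
have := congr1 determinant gJ; rewrite !det_mulmx det_map_mx det_tr /= detc.
rewrite mulrAC => /(canRL (mulfK _)); rewrite -unitfE -unitmxE J_unit => /(_ isT).
rewrite divff -?unitfE -?unitmxE ?J_unit// -expr2 => /eqP.
by rewrite sqrf_eq1 => /orP[/eqP|/eqP]; [left|right].
Qed.

End Quaternions.

(** * Minors of products with bounded matrices *)

Section MinorBounds.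
Variables (C : numClosedFieldType) (n : nat).
Local Notation d := n.+2.
Local Notation M := 'M[C]_d.
Implicit Types (A B : M) (a m : C).

Definition minorbd m A := forall i j k l, `|mnr A i j k l| <= m.

Lemma mnr_mull A B i j k l :
  mnr (A *m B) i j k l = \sum_p \sum_q A i p * A j q * mnr B p q k l.
Proof.
rewrite /mnr !mxE !mulr_suml -sumrB; apply: eq_bigr => p _.
by rewrite !mulr_sumr -sumrB; apply: eq_bigr => q _; ring.
Qed.

Lemma mnr_tr A i j k l : mnr A^T i j k l = mnr A k l i j.
Proof. by rewrite /mnr !mxE; ring. Qed.

Lemma minorbd_mull A B a m : (forall i j, `|A i j| <= a) -> minorbd m B ->
  minorbd (d%:R ^+ 2 * a ^+ 2 * m) (A *m B).
Proof.
move=> Aa Bm i j k l; rewrite mnr_mull.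
apply: le_trans (ler_norm_sum _ _ _) _.
apply: (@le_trans _ _ (\sum_(p < d) \sum_(q < d) a ^+ 2 * m)); last first.
  rewrite (_ : \sum_(p < d) _ = d%:R * (d%:R * (a ^+ 2 * m))); first by rewrite (expr2 d%:R) !mulrA.
  by rewrite !sumr_const !card_ord !mulr_natl.
apply: ler_sum => p _; apply: le_trans (ler_norm_sum _ _ _) _; apply: ler_sum => q _.
by rewrite !normrM expr2 ler_pM ?mulr_ge0 ?ler_pM.
Qed.

Lemma minorbd_mulr A B a m : (forall i j, `|A i j| <= a) -> minorbd m B ->
  minorbd (d%:R ^+ 2 * a ^+ 2 * m) (B *m A).
Proof.
move=> Aa Bm i j k l; rewrite -mnr_tr trmx_mul.
by apply: minorbd_mull => [p q|p q r s]; rewrite ?mxE ?mnr_tr.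
Qed.

End MinorBounds.

(** * Arithmetic of Z[sqrt 2, i] with its Galois conjugation *)

Section QuadraticIntegers.
Variable C : numClosedFieldType.
Implicit Types x y : C.

Definition r2 : C := sqrtC 2.

Lemma r2_sqr : r2 ^+ 2 = 2. Proof. exact: sqrtCK. Qed.
Lemma r2_gt0 : 0 < r2. Proof. by rewrite sqrtC_gt0. Qed.
Lemma r2_real : conjC r2 = r2.
Proof. by apply/CrealP; rewrite gtr0_real// r2_gt0. Qed.

(* [x] is an element of Z[sqrt 2, i] and [y] is its image under the Galois
   conjugation [sqrt 2 |-> - sqrt 2] fixing [i]. *)
Definition zpair x y := exists a b c d : int,
  x = a%:~R + b%:~R * r2 + 'i * (c%:~R + d%:~R * r2) /\
  y = a%:~R - b%:~R * r2 + 'i * (c%:~R - d%:~R * r2).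

Lemma zpairD x y x' y' : zpair x y -> zpair x' y' -> zpair (x + x') (y + y').
Proof.
move=> [a [b [c [d [-> ->]]]]] [a' [b' [c' [d' [-> ->]]]]].
by exists (a + a'), (b + b'), (c + c'), (d + d'); rewrite !rmorphD; split; ring.
Qed.

Lemma zpairM x y x' y' : zpair x y -> zpair x' y' -> zpair (x * x') (y * y').
Proof.
move=> [a [b [c [d [-> ->]]]]] [a' [b' [c' [d' [-> ->]]]]].
exists (a * a' + (b * b' + b * b') - c * c' - (d * d' + d * d')), (a * b' + b * a' - c * d' - d * c'),
  (a * c' + c * a' + (b * d' + d * b' + (b * d' + d * b'))), (a * d' + d * a' + b * c' + c * b').
have h2 : r2 * r2 = 2 by rewrite -expr2 r2_sqr.
have hi : 'i * 'i = -1 :> C by rewrite -expr2 sqrCi.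
rewrite !(rmorphD, rmorphN, rmorphM) /=; split.
- transitivity (a%:~R * a'%:~R + (r2 * r2) * b%:~R * b'%:~R
    + ('i * 'i) * (c%:~R * c'%:~R + (r2 * r2) * d%:~R * d'%:~R)
    + (a%:~R * b'%:~R + b%:~R * a'%:~R + ('i * 'i) * (c%:~R * d'%:~R + d%:~R * c'%:~R)) * r2
    + 'i * (a%:~R * c'%:~R + c%:~R * a'%:~R + (r2 * r2) * (b%:~R * d'%:~R + d%:~R * b'%:~R)
    + (a%:~R * d'%:~R + d%:~R * a'%:~R + b%:~R * c'%:~R + c%:~R * b'%:~R) * r2) : C); first by ring.
  by rewrite h2 hi; ring.
- transitivity (a%:~R * a'%:~R + (r2 * r2) * b%:~R * b'%:~R
    + ('i * 'i) * (c%:~R * c'%:~R + (r2 * r2) * d%:~R * d'%:~R)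
    - (a%:~R * b'%:~R + b%:~R * a'%:~R + ('i * 'i) * (c%:~R * d'%:~R + d%:~R * c'%:~R)) * r2
    + 'i * (a%:~R * c'%:~R + c%:~R * a'%:~R + (r2 * r2) * (b%:~R * d'%:~R + d%:~R * b'%:~R)
    - (a%:~R * d'%:~R + d%:~R * a'%:~R + b%:~R * c'%:~R + c%:~R * b'%:~R) * r2) : C); first by ring.
  by rewrite h2 hi; ring.
Qed.

Lemma zpair_int (a : int) : zpair a%:~R a%:~R.
Proof. by exists a, 0, 0, 0; rewrite !rmorph0; split; ring. Qed.
Lemma zpair0 : zpair 0 0. Proof. exact: (zpair_int 0). Qed.
Lemma zpair1 : zpair 1 1. Proof. exact: (zpair_int 1). Qed.
Lemma zpair2 : zpair 2 2. Proof. exact: (zpair_int 2). Qed.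
Lemma zpairi : zpair 'i 'i.
Proof. by exists 0, 0, 1, 0; rewrite !rmorph0 rmorph1; split; ring. Qed.
Lemma zpairr2 : zpair r2 (- r2).
Proof. by exists 0, 1, 0, 0; rewrite !rmorph0 rmorph1; split; ring. Qed.

Lemma zpairN x y : zpair x y -> zpair (- x) (- y).
Proof.
by rewrite -(mulN1r x) -(mulN1r y); apply: zpairM; have := zpair_int (-1); rewrite rmorphN rmorph1.
Qed.

Lemma zpair_conj x y : zpair x y -> zpair (conjC x) (conjC y).
Proof.
move=> [a [b [c [d [-> ->]]]]]; exists a, b, (- c), (- d).
have ii : conjC ('i : C) = - 'i by rewrite conjCi.
rewrite !(rmorphD, rmorphN, rmorphM) /= ii r2_real !rmorph_int.
by split; ring.
Qed.

Lemma zpair_sum (I : finType) (F G : I -> C) :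
  (forall i, zpair (F i) (G i)) -> zpair (\sum_i F i) (\sum_i G i).
Proof.
move=> FG; elim/big_rec2: _ => [|i x y _ xy]; first exact: zpair0.
exact: zpairD.
Qed.

(** For nonzero integers the 2-adic valuation of a^2 is even and that of 2 b^2 is odd. *)
Lemma int_sqrt2 (a b : int) : a ^+ 2 = 2 * b ^+ 2 -> a = 0 /\ b = 0.
Proof.
move=> ab; have nab : (`|a| ^ 2 = 2 * `|b| ^ 2)%N.
  by have := congr1 absz ab; rewrite abszM !abszX.
have [b0|b0] := eqVneq `|b|%N 0%N.
  move: nab; rewrite b0 muln0 => /eqP; rewrite expn_eq0 andbT => /eqP a0.
  by split; apply/eqP; rewrite -absz_eq0 ?a0 ?b0.
have a0 : `|a|%N != 0%N.
  by apply: contra_neq b0 => a0; move: nab; rewrite a0 exp0n// => /eqP; rewrite eq_sym muln_eq0 expn_eq0 /= andbT => /eqP.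
have := congr1 (logn 2) nab; rewrite lognX lognM ?expn_gt0 ?lt0n ?b0// lognX (pfactorK 1)//.
by move=> /(congr1 odd); rewrite oddD !oddM.
Qed.

Lemma sqrt2_irrational (a b : int) : a%:~R + b%:~R * r2 = 0 -> a = 0 /\ b = 0.
Proof.
move=> /eqP; rewrite addr_eq0 => /eqP ab; apply: int_sqrt2; apply: (@intr_inj C).
rewrite mulr_natl mulr2n rmorphD !expr2 !rmorphM /= ab mulrNN.
transitivity (b%:~R * b%:~R * (r2 * r2) : C); first by ring.
by rewrite -[r2 * r2]expr2 r2_sqr; ring.
Qed.

Lemma sqrt2_irrational' (a b : int) : a%:~R - b%:~R * r2 = 0 -> a = 0 /\ b = 0.
Proof.
move=> ab; have := @sqrt2_irrational a (- b); rewrite rmorphN mulNr => /(_ ab)[-> /eqP].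
by rewrite oppr_eq0 => /eqP.
Qed.

Lemma zpair_real_split (s t : C) : conjC s = s -> conjC t = t -> s + 'i * t = 0 ->
  s = 0 /\ t = 0.
Proof.
move=> sR tR st; have := congr1 conjC st; rewrite rmorphD rmorphM /= conjCi sR tR rmorph0 => st'.
have s0 : 2 * s = 0.
  have : 2 * s = (s + 'i * t) + (s + - 'i * t) by ring.
  by rewrite st st' addr0.
have s00 : s = 0 by apply/eqP; move/eqP: s0; rewrite mulf_eq0 pnatr_eq0.
split=> //; move: st; rewrite s00 add0r => /eqP.
by rewrite mulf_eq0 (negPf (neq0Ci C)) => /eqP.
Qed.

Lemma intr2_real (a b : int) : conjC (a%:~R + b%:~R * r2) = a%:~R + b%:~R * r2 :> C.
Proof. by rewrite rmorphD rmorphM /= r2_real !rmorph_int. Qed.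

Lemma intr2_real' (a b : int) : conjC (a%:~R - b%:~R * r2) = a%:~R - b%:~R * r2 :> C.
Proof. by rewrite rmorphB rmorphM /= r2_real !rmorph_int. Qed.

(* A nonzero element of Z[sqrt 2] has norm at least 1 in absolute value. *)
Lemma zpair_norm (x y : C) : zpair x y -> conjC x = x -> 0 < y -> 1 <= `|x| + y.
Proof.
move=> [a [b [c [d [xE yE]]]]] xR y0.
have xIm : a%:~R + b%:~R * r2 + 'i * (c%:~R + d%:~R * r2) =
           a%:~R + b%:~R * r2 - 'i * (c%:~R + d%:~R * r2).
  by rewrite -xE -{1}xR xE rmorphD rmorphM /= conjCi !intr2_real; ring.
have cd : c%:~R + d%:~R * r2 = 0.
  have : 0 + 'i * (2 * (c%:~R + d%:~R * r2)) = 0 :> C.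
    apply: (addrI (a%:~R + b%:~R * r2 - 'i * (c%:~R + d%:~R * r2))).
    by rewrite addr0 -[in RHS]xIm; ring.
  move=> /zpair_real_split[||_ /eqP].
  - by rewrite rmorph0.
  - by rewrite rmorphM /= intr2_real rmorph_nat.
  - by rewrite mulf_eq0 pnatr_eq0 /= => /eqP.
have [c0 d0] := sqrt2_irrational cd.
have {}xE : x = a%:~R + b%:~R * r2 by rewrite xE cd mulr0 addr0.
have {}yE : y = a%:~R - b%:~R * r2 by rewrite yE c0 d0 !rmorph0; ring.
have xy : x * y = (a ^+ 2 - 2 * b ^+ 2)%:~R.
  rewrite mulr_natl mulr2n rmorphB rmorphD !expr2 !rmorphM /= xE yE.
  transitivity (a%:~R * a%:~R - b%:~R * b%:~R * (r2 * r2) : C); first by ring.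
  by rewrite -[r2 * r2]expr2 r2_sqr; ring.
have ab0 : a ^+ 2 - 2 * b ^+ 2 != 0.
  apply: contraTneq y0 => /eqP; rewrite subr_eq0 => /eqP /int_sqrt2[a0 b0].
  by rewrite yE a0 b0 !rmorph0 mul0r subr0 ltxx.
have nxy : 1 <= `|x| * y.
  rewrite -[X in _ * X]gtr0_norm// -normrM xy -intr_norm.
  by rewrite ler1z -gtz0_ge1 normr_gt0.
have [y1|/ltW y1] := real_leP (real1 C) (gtr0_real y0).
  by rewrite (le_trans y1)// lerDr.
apply: le_trans nxy _; rewrite (@le_trans _ _ `|x|)//; last by rewrite lerDl ltW.
by rewrite ler_piMr.
Qed.

(** Four times each of a, b sqrt 2, c, d sqrt 2 is a sum of x, y and their complex conjugates with
    unit coefficients. Hence bounds in both embeddings leave finitely many elements. *)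
Lemma zpair_bound (K x y : C) : `|x| <= K -> `|y| <= K -> zpair x y ->
  exists a b c d : int, [/\ `|a%:~R : C| <= K, `|b%:~R : C| <= K, `|c%:~R : C| <= K & `|d%:~R : C| <= K] /\
  x = a%:~R + b%:~R * r2 + 'i * (c%:~R + d%:~R * r2) /\
  y = a%:~R - b%:~R * r2 + 'i * (c%:~R - d%:~R * r2).
Proof.
move=> xK yK [a [b [c [d [xE yE]]]]]; exists a, b, c, d; split=> //.
have quarter (u : C) (s : C) : 4 * u = s -> `|s| <= 4 * K -> `|u| <= K.
  by move=> <-; rewrite normrM normr_nat ler_pM2l.
have r21 : 1 <= r2.
  by rewrite -sqrtC1 /r2 ler_sqrtC ?nnegrE ?ler01 ?ler0n// ler1n.
have bd (u : C) : `|u * r2| <= K -> `|u| <= K.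
  by apply: le_trans; rewrite normrM ler_peMr// (ger0_norm (ltW r2_gt0)).
have xc : conjC x = a%:~R + b%:~R * r2 - 'i * (c%:~R + d%:~R * r2).
  by rewrite xE rmorphD rmorphM /= conjCi !intr2_real; ring.
have yc : conjC y = a%:~R - b%:~R * r2 - 'i * (c%:~R - d%:~R * r2).
  by rewrite yE rmorphD rmorphM /= conjCi !intr2_real'; ring.
have K4 (p q r s : C) : `|p| <= K -> `|q| <= K -> `|r| <= K -> `|s| <= K -> `|p + q + (r + s)| <= 4 * K.
  move=> hp hq hr hs; rewrite (_ : 4 * K = K + K + (K + K)); last by ring.
  by rewrite (le_trans (ler_normD _ _))// lerD// (le_trans (ler_normD _ _))// lerD.
have ii : 'i * 'i = -1 :> C by rewrite -expr2 sqrCi.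
split.
- by apply: (quarter _ (x + conjC x + (y + conjC y))); [rewrite xc yc xE yE; ring|apply: K4; rewrite ?norm_conjC].
- apply: bd; apply: (quarter _ (x + conjC x + (- y - conjC y))); [rewrite xc yc xE yE; ring|].
  by apply: K4; rewrite ?normrN ?norm_conjC.
- apply: (quarter _ (- 'i * x + 'i * conjC x + (- 'i * y + 'i * conjC y))).
    rewrite xc yc xE yE; transitivity (- ('i * 'i) * 4 * c%:~R : C); first by rewrite ii; ring.
    by ring.
  by apply: K4; rewrite normrM ?normrN normCi mul1r ?norm_conjC.
- apply: bd; apply: (quarter _ (- 'i * x + 'i * conjC x + ('i * y - 'i * conjC y))).
    rewrite xc yc xE yE; transitivity (- ('i * 'i) * 4 * (d%:~R * r2) : C); first by rewrite ii; ring.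
    by ring.
  by apply: K4; rewrite ?normrN normrM ?normrN normCi mul1r ?norm_conjC.
Qed.

End QuadraticIntegers.

(** * The lattice and its conjugate form *)

Section ArithmeticForm.
Variables (C : numClosedFieldType) (n : nat).
Hypotheses (n_gt1 : (1 < n)%N) (n_even : ~~ odd n).
Local Notation d := n.+2.
Local Notation M := 'M[C]_d.
Local Notation J := (Jmx C n).
Local Notation Q := (Qmx C n).
Local Notation r2 := (r2 C).
Implicit Types (i j k l : 'I_d).

(** The fourth root of 2. It is not in Z[sqrt 2, i], but in Gram matrices only its square appears:
    it scales the two norms -2 of the negative plane to -2 sqrt 2, whose Galois conjugate is
    positive. *)
Definition al : C := sqrtC r2.

Lemma al_sqr : al * al = r2. Proof. by rewrite -expr2 sqrtCK. Qed.
Lemma al_gt0 : 0 < al. Proof. by rewrite sqrtC_gt0 r2_gt0. Qed.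
Lemma al_real : conjC al = al.
Proof. by apply/CrealP; rewrite gtr0_real// al_gt0. Qed.

Definition dx i : C := if (i < 2)%N then al else 1.
Definition dy i : C := if (i < 2)%N then - al else if (i < n)%N then 0 else 1.
Definition e2 i : C := if (i < 2)%N then r2 * al else if (i < n)%N then 1 else r2.
Definition dl i : C := if (i < 2)%N then - 2 * r2 else if (i < n)%N then 1 else 2.
Definition dl2 i : C := if (i < 2)%N then 2 * r2 else if (i < n)%N then 1 else 2.

(* The rows of [Dmx] span over Z[sqrt 2, i] a lattice on which the hermitian form
   [J] is diag(-2 sqrt 2, -2 sqrt 2, 1, ..., 1, 2, 2); its Galois conjugate is
   positive definite and is realized by [D2mx]. *)
Definition Dmx : M := \matrix_(i, j) (dx i * (j == i)%:R + dy i * (j == tau i)%:R).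
Definition D2mx : M := diag_mx (\row_i e2 i).

Lemma dx_real i : conjC (dx i) = dx i.
Proof. by rewrite /dx; case: ifP; rewrite ?al_real ?rmorph1. Qed.
Lemma dy_real i : conjC (dy i) = dy i.
Proof. by rewrite /dy; case: ifP; rewrite ?rmorphN /= ?al_real//; case: ifP; rewrite ?rmorph0 ?rmorph1. Qed.
Lemma e2_gt0 i : 0 < e2 i.
Proof. by rewrite /e2; case: ifP; rewrite ?mulr_gt0 ?r2_gt0 ?al_gt0//; case: ifP; rewrite ?ltr01 ?r2_gt0. Qed.
Lemma e2_real i : conjC (e2 i) = e2 i.
Proof. by apply/CrealP; rewrite gtr0_real// e2_gt0. Qed.

Lemma herm_rows (A B : M) i k : (A *m J *m B^t*) i k = herm (row i A) (row k B).
Proof. by rewrite herm_sum mxE; apply: eq_bigr => j _; rewrite mulmxJ !mxE. Qed.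

Lemma DJD : Dmx *m J *m Dmx^t* = diag_mx (\row_i dl i).
Proof.
apply/matrixP => i k; rewrite herm_rows.
have -> : row k Dmx = dx k *: delta_mx 0 k + dy k *: delta_mx 0 (tau k).
  by apply/rowP => j; rewrite !mxE eqxx.
rewrite hermDr !hermZr !herm_delta tauK dx_real dy_real !mxE.
rewrite (inj_eq (inv_inj (@tauK n))) -(inj_eq (inv_inj (@tauK n)) _ i) tauK.
have [ki|ki] := eqVneq k i.
  rewrite -ki /= mulr1n; have [tk|tk] := eqVneq k (tau k).
    have kmid : (2 <= k < n)%N.
      apply: contraT => kmid; have := tau_val k; rewrite -tk (negbTE kmid) => /(congr1 odd).
      have := ltn_ord k; rewrite ltnS => kn; rewrite oddB//= (negbTE n_even).
      by case: (odd k).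
    by move: kmid => /andP[k2 kn]; rewrite /dl /dx /dy ltnNge k2 kn /=; ring.
  rewrite /dl /dx /dy; case: ifP => k2 /=; first by rewrite -al_sqr; ring.
  case: ifP => kn /=; last by ring.
  by rewrite tau_mid ?eqxx // in tk; rewrite leqNgt k2.
rewrite /= mulr0n.
have [ik'|ik'] := eqVneq k (tau i); last by rewrite /=; ring.
have kv : (k : nat) = (if (2 <= i < n)%N then i : nat else n.+1 - i)%N by rewrite ik' tau_val.
have imid : (2 <= i < n)%N = false.
  by apply/negbTE; apply: contra ki => imid; rewrite ik' tau_mid.
rewrite /dx /dy kv imid; move: imid; case: (ltnP i 2) => i2 /= imid.
  have -> : (n.+1 - i < 2)%N = false by lia.
  have -> : (n.+1 - i < n)%N = false by lia.
  by ring.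
rewrite imid; have -> : (n.+1 - i < 2)%N by have := ltn_ord i; lia.
by ring.
Qed.

Lemma D2D2 : D2mx *m D2mx^t* = diag_mx (\row_i dl2 i).
Proof.
have -> : D2mx^t* = D2mx.
  rewrite /D2mx tr_diag_mx map_diag_mx; congr diag_mx; apply/rowP => i.
  by rewrite mxE mxE; exact: e2_real.
rewrite mulmx_diag; congr diag_mx; apply/rowP => i; rewrite !mxE /e2 /dl2.
have h2 : r2 * r2 = 2 by rewrite -expr2 r2_sqr.
case: ifP => _; last by case: ifP => _; rewrite ?h2 ?mulr1.
transitivity ((r2 * r2) * (al * al)); first by ring.
by rewrite h2 al_sqr.
Qed.

Lemma dl_zpair i : zpair (dl i) (dl2 i).
Proof.
rewrite /dl /dl2; case: ifP => _.
  by rewrite -[2 * r2]mulrNN; apply: zpairM; [exact/zpairN/zpair2|exact: zpairr2].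
by case: ifP => _; [exact: zpair1|exact: zpair2].
Qed.

Lemma DQ : Dmx *m Q = Q *m Dmx.
Proof.
apply/matrixP => i j; rewrite mulmxQ// mulQmx !mxE /dx /dy !(partner_block n_gt1 n_even).
rewrite tau_partner// !(eq_partner n_gt1 n_even _ j) !(eq_sym (partner j)).
have [ij|ij] := eqVneq i (partner j).
  by rewrite ij qsign_partner//; ring.
have [tij|tij] := eqVneq (tau i) (partner j); last by rewrite /=; ring.
by rewrite -(qsign_tau C n_gt1 n_even i) tij qsign_partner//; ring.
Qed.

Lemma D2Q : D2mx *m Q = Q *m D2mx.
Proof.
apply/matrixP => i j; rewrite mulmxQ// mulQmx !mxE (eq_sym (partner i)) (eq_partner n_gt1 n_even).
rewrite /e2 !(partner_block n_gt1 n_even).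
have [->|ij] := eqVneq j (partner i); last by rewrite !mulr0n !mulr0.
by rewrite qsign_partner// opprK.
Qed.

Lemma D_unit : Dmx \in unitmx.
Proof.
have dlu : diag_mx (\row_i dl i) \in unitmx.
  rewrite unitmxE det_diag unitfE; apply/prodf_neq0 => i _; rewrite mxE /dl.
  case: ifP => _; first by rewrite mulf_neq0// ?oppr_eq0 ?pnatr_eq0// gt_eqF// r2_gt0.
  by case: ifP => _; rewrite ?oner_eq0 ?pnatr_eq0.
by move: dlu; rewrite -DJD !unitmx_mul => /andP[/andP[]].
Qed.

Lemma D2_unit : D2mx \in unitmx.
Proof.
rewrite unitmxE det_diag unitfE; apply/prodf_neq0 => i _.
by rewrite mxE gt_eqF// e2_gt0.
Qed.

(* The rows are a Z-basis of the lattice spanned by the rows of [Dmx] over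
   Z[sqrt 2, i], respectively of its Galois conjugate. *)
Definition Emx : 'M[C]_(d + d + (d + d), d) :=
  col_mx (col_mx Dmx ('i *: Dmx)) (col_mx (r2 *: Dmx) (('i * r2) *: Dmx)).
Definition E2mx : 'M[C]_(d + d + (d + d), d) :=
  col_mx (col_mx D2mx ('i *: D2mx)) (col_mx (- r2 *: D2mx) (- ('i * r2) *: D2mx)).

Lemma Emx_row (r : 'I_(d + d + (d + d))) : exists l (c c' : C),
  [/\ zpair c c', row r Emx = c *: row l Dmx & row r E2mx = c' *: row l D2mx].
Proof.
have z1 := zpair1 C; have zi := zpairi C; have zr := zpairr2 C.
case: (split_ordP r) => [r1 ->|r1 ->]; case: (split_ordP r1) => [l ->|l ->]; exists l.
- by exists 1, 1; rewrite /Emx /E2mx !rowKu !scale1r.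
- by exists 'i, 'i; rewrite /Emx /E2mx !rowKu !rowKd !linearZ.
- by exists r2, (- r2); rewrite /Emx /E2mx !rowKd !rowKu !linearZ.
- exists ('i * r2), (- ('i * r2)); rewrite -[X in zpair _ X]mulrN.
  by split; [exact: zpairM|rewrite /Emx !rowKd !linearZ|rewrite /E2mx !rowKd !linearZ].
Qed.

Lemma gram_rows (A X : 'M[C]_d) p (Y : 'M[C]_(p, d)) r s l l' (c c' : C) :
  row r Y = c *: row l X -> row s Y = c' *: row l' X ->
  ((Y *m A *m Y^t*) r s = c * conjC c' * (X *m A *m X^t*) l l') *
  ((Y *m A *m Y^T) r s = c * c' * (X *m A *m X^T) l l').
Proof.
move=> /rowP rY /rowP sY.
have YA j : (Y *m A) r j = c * (X *m A) l j.
  rewrite !mxE mulr_sumr; apply: eq_bigr => k _.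
  by have := rY k; rewrite !mxE => ->; rewrite mulrA.
have Ys j : Y s j = c' * X l' j by have := sY j; rewrite !mxE.
split; rewrite [LHS]mxE [X in _ = _ * X]mxE mulr_sumr; apply: eq_bigr => j _; rewrite YA.
  have -> : (Y^t*) j s = conjC (Y s j) by rewrite mxE mxE.
  have -> : (X^t*) j l' = conjC (X l' j) by rewrite mxE mxE.
  by rewrite Ys rmorphM /=; ring.
have -> : Y^T j s = Y s j by rewrite mxE.
have -> : X^T j l' = X l' j by rewrite mxE.
by rewrite Ys; ring.
Qed.

(** The second Gram matrix encodes the quaternionic structure bilinearly: v J Q^T w^T is
    [herm v (jmap Q w)]. *)
Lemma Emx_gram r s :
  zpair ((Emx *m J *m Emx^t*) r s) ((E2mx *m E2mx^t*) r s) /\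
  zpair ((Emx *m (J *m Q^T) *m Emx^T) r s) ((E2mx *m Q^T *m E2mx^T) r s).
Proof.
have [l [c [c' [zc cE cE2]]]] := Emx_row r.
have [l' [b [b' [zb bE bE2]]]] := Emx_row s.
have zQ : zpair (Q^T l l') (Q^T l l').
  rewrite !mxE /qsign; apply: zpairM; last by have := zpair_int C (l == partner l').
  by have := zpair_int C ((-1) ^+ (odd l' + (n <= l'))); rewrite rmorphXn /= rmorphN rmorph1.
have D1 : (Dmx *m J *m Dmx^t*) l l' = (dl l) *+ (l == l') by rewrite DJD !mxE.
have D2 : (D2mx *m 1%:M *m D2mx^t*) l l' = (dl2 l) *+ (l == l').
  by rewrite mulmx1 D2D2 !mxE.
have conjD : map_mx conjC Dmx = Dmx.
  by apply/matrixP => i j; rewrite !mxE rmorphD !rmorphM /= dx_real dy_real !rmorph_nat.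
have conjD2 : map_mx conjC D2mx = D2mx.
  rewrite /D2mx map_diag_mx; congr diag_mx; apply/rowP => i.
  by rewrite mxE mxE; exact: e2_real.
have QD : Q^T *m Dmx^T = Dmx^T *m Q^T by rewrite -!trmx_mul DQ.
have QD2 : Q^T *m D2mx^T = D2mx^T *m Q^T by rewrite -!trmx_mul D2Q.
have Dt : Dmx^t* = Dmx^T by rewrite -map_trmx conjD.
have D2t : D2mx^t* = D2mx^T by rewrite -map_trmx conjD2.
have DQ1 : (Dmx *m (J *m Q^T) *m Dmx^T) l l' = dl l * Q^T l l'.
  by rewrite mulmxA -mulmxA QD mulmxA -Dt DJD mul_diag_mx !mxE.
have DQ2 : (D2mx *m Q^T *m D2mx^T) l l' = dl2 l * Q^T l l'.
  by rewrite -mulmxA QD2 mulmxA -D2t D2D2 mul_diag_mx !mxE.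
have E21 : E2mx *m E2mx^t* = E2mx *m 1%:M *m E2mx^t* by rewrite mulmx1.
rewrite E21.
rewrite (gram_rows J cE bE) (gram_rows 1%:M cE2 bE2) D1 D2.
rewrite (gram_rows (J *m Q^T) cE bE) (gram_rows Q^T cE2 bE2) DQ1 DQ2.
have zl := dl_zpair l.
split; last by apply: zpairM; apply: zpairM.
apply: zpairM; first by apply: zpairM => //; exact: zpair_conj.
by case: eqP => _; rewrite ?mulr1n ?mulr0n //; exact: zpair0.
Qed.

End ArithmeticForm.

(** * The positive definite form attached to g *)

Section LatticeForm.
Variables (C : numClosedFieldType) (n : nat).
Hypotheses (n_gt1 : (1 < n)%N) (n_even : ~~ odd n).
Local Notation d := n.+2.
Local Notation M := 'M[C]_d.
Local Notation J := (Jmx C n).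
Local Notation r2 := (r2 C).
Local Notation E := (Emx C n).
Local Notation E2 := (E2mx C n).
Local Notation N := (d + d + (d + d))%N.
Local Notation zi := (map_mx (intr : int -> C)).
Implicit Types (g : M).

Definition nrm2 p (v : 'rV[C]_p) : C := \sum_i `|v 0 i| ^+ 2.

Lemma nrm2E p (v : 'rV[C]_p) : v *m v^t* = (nrm2 v)%:M.
Proof.
rewrite [LHS]mx11_scalar; congr (_%:M).
by rewrite mxE; apply: eq_bigr => i _; rewrite !mxE normCK.
Qed.

Lemma nrm2_ge0 p (v : 'rV[C]_p) : 0 <= nrm2 v.
Proof. by apply: sumr_ge0 => i _; rewrite exprn_ge0. Qed.

Lemma nrm2_real p (v : 'rV[C]_p) : conjC (nrm2 v) = nrm2 v.
Proof. by apply/CrealP; rewrite ger0_real// nrm2_ge0. Qed.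

Lemma nrm2_entry p (v : 'rV[C]_p) i : `|v 0 i| ^+ 2 <= nrm2 v.
Proof. by rewrite /nrm2 (bigD1 i)//= lerDl sumr_ge0// => k _; rewrite exprn_ge0. Qed.

Lemma nrm2_gt0 p (v : 'rV[C]_p) : v != 0 -> 0 < nrm2 v.
Proof.
move=> v0; rewrite lt_def nrm2_ge0 andbT; apply: contra_neq v0 => v0.
apply/rowP => i; have := nrm2_entry v i; rewrite v0 mxE => h.
have : `|v 0 i| ^+ 2 = 0 by apply/le_anti; rewrite h exprn_ge0.
by move/eqP; rewrite expf_eq0 /= normr_eq0 => /eqP.
Qed.

Lemma herm_nrm2 (v : 'rV[C]_d) : `|herm v v| <= nrm2 v.
Proof.
rewrite herm_sum (le_trans (ler_norm_sum _ _ _))//.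
have h i : `|v 0 (tau i) * conjC (v 0 i)| <= (`|v 0 (tau i)| ^+ 2 + `|v 0 i| ^+ 2) / 2.
  rewrite normrM norm_conjC ler_pdivlMr// -subr_ge0.
  rewrite (_ : _ - _ = (`|v 0 (tau i)| - `|v 0 i|) ^+ 2); last by ring.
  by rewrite -realEsqr rpredB// normr_real.
apply: le_trans (ler_sum _ (fun i _ => h i)) _.
have tv : \sum_i `|v 0 (tau i)| ^+ 2 = nrm2 v.
  by rewrite [RHS](reindex_inj (inv_inj (@tauK n))).
rewrite -big_distrl /= big_split /= tv -/(nrm2 v).
by rewrite (_ : _ / 2 = nrm2 v)//; field.
Qed.

(** Adjoining the complex conjugates makes the matrix square of size 4 d and its Gram matrix
    real. *)
Definition Cmx g : 'M[C]_N :=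
  row_mx (row_mx (E *m g) (map_mx conjC (E *m g))) (row_mx E2 (map_mx conjC E2)).

(* The real quadratic form k |-> |k E g|^2 + |k E2|^2 on integer rows [k]. *)
Definition Smx g : 'M[C]_N := 2^-1 *: (Cmx g *m (Cmx g)^t*).

Lemma mul_row_adj p q r (A : 'M[C]_(p, q)) (B : 'M[C]_(p, r)) :
  row_mx A B *m (row_mx A B)^t* = A *m A^t* + B *m B^t*.
Proof. by rewrite tr_row_mx map_col_mx mul_row_col. Qed.

Lemma conj_gram p q (A : 'M[C]_(p, q)) :
  map_mx conjC A *m (map_mx conjC A)^t* = map_mx conjC (A *m A^t*).
Proof. by rewrite map_mxM; congr (_ *m _); apply/matrixP => i j; rewrite !mxE. Qed.

Lemma Smx_expand g : Smx g = 2^-1 *: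
  (E *m g *m (E *m g)^t* + map_mx conjC (E *m g *m (E *m g)^t*) +
   (E2 *m E2^t* + map_mx conjC (E2 *m E2^t*))).
Proof. by rewrite /Smx /Cmx !mul_row_adj !conj_gram. Qed.

Lemma Smx_conj g : map_mx conjC (Smx g) = Smx g.
Proof.
rewrite Smx_expand map_mxZ !map_mxD !map_conjK /= fmorphV rmorph_nat.
by congr (_ *: (_ + _)); rewrite addrC.
Qed.

Lemma Smx_tr g : (Smx g)^T = Smx g.
Proof.
have St : (Smx g)^t* = Smx g.
  by rewrite /Smx linearZ /= map_mxZ /= fmorphV /= rmorph_nat adj_mul adjK.
by rewrite -[in RHS]St -map_trmx Smx_conj.
Qed.

(** [Cmx g] is [Cmx 1] times the block diagonal matrix of g, conj g and 1, and both g and conj g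
    have determinant 1. *)
Lemma Smx_det g : \det g = 1 -> \det (Smx g) = \det (Smx 1%:M).
Proof.
move=> dg; have CE : Cmx g = Cmx 1%:M *m
    block_mx (block_mx g 0 0 (map_mx conjC g)) 0 0 1%:M.
  rewrite /Cmx !mulmx1 mul_row_block !mulmx0 mulmx1 addr0 add0r mul_row_block.
  by rewrite !mulmx0 addr0 add0r map_mxM.
have detC : \det (Cmx g) = \det (Cmx 1%:M).
  by rewrite CE det_mulmx !det_ublock det1 dg det_map_mx dg rmorph1 !mulr1.
by rewrite /Smx !detZ !det_mulmx !det_map_mx !det_tr detC.
Qed.

Lemma zi_conj p q (k : 'M[int]_(p, q)) : map_mx conjC (zi k) = zi k.
Proof. by apply/matrixP => i j; rewrite !mxE rmorph_int. Qed.

Lemma zi_adj p q (k : 'M[int]_(p, q)) : (zi k)^t* = (zi k)^T.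
Proof. by rewrite -map_trmx zi_conj. Qed.

Lemma Smx_value g (k : 'rV[int]_N) :
  zi k *m Smx g *m (zi k)^T = (nrm2 (zi k *m E *m g) + nrm2 (zi k *m E2))%:M.
Proof.
have gram p (A : 'M[C]_(N, p)) : zi k *m (A *m A^t*) *m (zi k)^T = (nrm2 (zi k *m A))%:M.
  by rewrite -nrm2E adj_mul zi_adj !mulmxA.
have gramc p (A : 'M[C]_(N, p)) :
    zi k *m map_mx conjC (A *m A^t*) *m (zi k)^T = (nrm2 (zi k *m A))%:M.
  have -> : zi k *m map_mx conjC (A *m A^t*) *m (zi k)^T = map_mx conjC (zi k *m (A *m A^t*) *m (zi k)^T).
    by rewrite -{1}(zi_conj k) -{2}(zi_conj k) map_trmx -!map_mxM.
  rewrite gram.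
  by apply/matrixP => i j; rewrite !mxE rmorphMn /= nrm2_real.
rewrite Smx_expand -scalemxAr -scalemxAl !mulmxDr !mulmxDl !gram !gramc.
rewrite !mulmxA; apply/matrixP => i j; rewrite !mxE (ord1 i) (ord1 j) eqxx !mulr1n.
by field.
Qed.

Lemma zpair_congr p q (U : 'M[int]_(p, q)) (A B : 'M[C]_q) :
  (forall i j, zpair (A i j) (B i j)) -> forall i j,
  zpair ((zi U *m A *m (zi U)^T) i j) ((zi U *m B *m (zi U)^T) i j).
Proof.
move=> AB i j; rewrite [in X in zpair X _]mxE [in X in zpair _ X]mxE.
apply: zpair_sum => k; rewrite [in X in zpair X _]mxE [in X in zpair _ X]mxE [(zi U)^T k j]mxE.
apply: zpairM; last by rewrite mxE; exact: zpair_int.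
by apply: zpair_sum => l; apply: zpairM => //; rewrite mxE; exact: zpair_int.
Qed.

Lemma zi_rows p (U : 'M[int]_(p, N)) g i :
  row i (zi U *m E *m g) = zi (row i U) *m E *m g /\
  row i (zi U *m E2) = zi (row i U) *m E2.
Proof. by rewrite map_row !row_mul. Qed.

(** 1, sqrt 2, i and i sqrt 2 are linearly independent over Z. *)
Lemma E2_injective (k : 'rV[int]_N) : zi k *m E2 = 0 -> k = 0.
Proof.
move=> k0; rewrite -[k]hsubmxK -(hsubmxK (lsubmx k)) -(hsubmxK (rsubmx k)) in k0 *.
set k1 := lsubmx (lsubmx k) in k0 *; set k2 := rsubmx (lsubmx k) in k0 *.
set k3 := lsubmx (rsubmx k) in k0 *; set k4 := rsubmx (rsubmx k) in k0 *.
have : (zi k1 + 'i *: zi k2 + (- r2 *: zi k3 + - ('i * r2) *: zi k4)) *m D2mx C n = 0.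
  rewrite -k0 /E2mx !map_row_mx !mul_row_col -!scalemxAr !mulmxDl -!scalemxAl//.
move=> /(congr1 (fun X => X *m invmx (D2mx C n))); rewrite mulmxK ?D2_unit// mul0mx => /matrixP h.
have hz j : k1 0 j = 0 /\ k2 0 j = 0 /\ k3 0 j = 0 /\ k4 0 j = 0.
  move: (h 0 j); clear h k0; move: k1 k2 k3 k4 => l1 l2 l3 l4; rewrite !mxE => hj.
  have : ((l1 0 j)%:~R - (l3 0 j)%:~R * r2) + 'i * ((l2 0 j)%:~R - (l4 0 j)%:~R * r2) = 0.
    by rewrite -hj; ring.
  move=> /zpair_real_split[||/sqrt2_irrational'[-> ->] /sqrt2_irrational'[-> ->]//]; exact: intr2_real'.
suff [-> -> -> ->] : [/\ k1 = 0, k2 = 0, k3 = 0 & k4 = 0] by rewrite !row_mx0.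
by split; apply/rowP => j; have [h1 [h2 [h3 h4]]] := hz j; rewrite ?h1 ?h2 ?h3 ?h4 mxE.
Qed.

(** The value [herm] takes on k E g does not depend on the isometry g and lies in Z[sqrt 2, i]; its
    Galois conjugate is |k E2|^2 > 0, and its absolute value is at most |k E g|^2. So [zpair_norm]
    applies. *)
Lemma Smx_min g (k : 'rV[int]_N) : g *m J *m g^t* = J -> k != 0 ->
  1 <= nrm2 (zi k *m E *m g) + nrm2 (zi k *m E2).
Proof.
move=> gJ k0; have v0 : 0 < nrm2 (zi k *m E2).
  by apply: nrm2_gt0; apply: contra_neq k0; exact: E2_injective.
have gram i j := proj1 (Emx_gram C n_gt1 n_even i j).
have := zpair_congr k gram 0 0.
have -> : zi k *m (E *m J *m E^t*) *m (zi k)^T = (herm (zi k *m E *m g) (zi k *m E *m g))%:M.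
  rewrite -hermE [(zi k *m E *m g)^t*]adj_mul !mulmxA -[_ *m g *m J]mulmxA.
  by rewrite -[_ *m (g *m J) *m _]mulmxA gJ adj_mul zi_adj !mulmxA.
have -> : zi k *m (E2 *m E2^t*) *m (zi k)^T = (nrm2 (zi k *m E2))%:M.
  by rewrite -nrm2E adj_mul zi_adj !mulmxA.
rewrite !mxE eqxx !mulr1n => zp.
apply: le_trans (zpair_norm zp _ v0) _; last by rewrite lerD2r herm_nrm2.
by rewrite -herm_conj.
Qed.

End LatticeForm.

(** * Reduced lattice bases with bounds uniform in g *)

Section LatticeReducedBasis.
Variables (R : realType) (n : nat).
Hypotheses (n_gt1 : (1 < n)%N) (n_even : ~~ odd n).
Local Notation C := R[i].
Local Notation d := n.+2.
Local Notation M := 'M[C]_d.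
Local Notation J := (Jmx C n).
Local Notation E := (Emx C n).
Local Notation E2 := (E2mx C n).
Local Notation N := (d + d + (d + d))%N.
Local Notation zi := (map_mx (intr : int -> C)).
Local Open Scope complex_scope.

Lemma lattice_reduction : exists b : C, forall g : M,
  g *m J *m g^t* = J -> \det g = 1 -> exists U : 'M[int]_N,
  [/\ U \in unitmx, mxbd b (zi U *m E *m g) & mxbd b (zi U *m E2)].
Proof.
have [D detS] : exists D : C, forall g : M, \det g = 1 -> \det (Smx g) = D.
  by exists (\det (@Smx C n 1%:M)) => g; exact: Smx_det.
(* The lower bound 1 comes from [Smx_min]; as D is the same for all g, so is K. *)
have [K HK] := @reduced_basis R N 1 (complex.Re D) ltr01.
exists (1 + `|K|)%:C => g gJ dg.
pose S : 'M[R]_N := map_mx (@complex.Re R) (Smx g).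
have SE : map_mx (real_complex R) S = Smx g.
  apply/matrixP => i j; rewrite [LHS]mxE [S i j]mxE; apply: RRe_real; apply/CrealP.
  by move: (Smx_conj g) => /matrixP/(_ i j); rewrite [X in X = _ -> _]mxE.
have qE (k : 'rV[int]_N) : (qform S (map_mx intr k))%:C =
    nrm2 (zi k *m E *m g) + nrm2 (zi k *m E2).
  have kE : map_mx (real_complex R) (map_mx intr k) = zi k.
    by apply/matrixP => i j; rewrite !mxE rmorph_int.
  have := Smx_value g k => /matrixP/(_ 0 0); rewrite [in X in _ = X -> _]mxE eqxx mulr1n => <-.
  by rewrite -SE -kE map_trmx -!map_mxM [RHS]mxE.
have Ssym : S^T = S by rewrite /S map_trmx Smx_tr.
have Smin (k : 'rV[int]_N) : k != 0 -> 1 <= qform S (map_mx intr k).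
  by move=> k0; rewrite -lecR qE; exact: Smx_min.
have Sdet : \det S <= complex.Re D.
  by rewrite -(detS g dg) -SE det_map_mx.
have [U Uu UK] := HK S Ssym Smin Sdet; exists U.
have sqr_bd (x y : C) : `|x| ^+ 2 <= y -> y <= K%:C -> `|x| <= (1 + `|K|)%:C.
  move=> xy yK; rewrite rmorphD /= rmorph1; have := normr_ge0 x.
  have KK : K%:C <= `|K|%:C by rewrite lecR ler_norm.
  have [x1|x1] := real_leP (normr_real x) (real1 C) => x0.
    by apply: le_trans x1 _; rewrite lerDl; rewrite (_ : 0 = 0%:C)// lecR.
  apply: le_trans (_ : _ <= `|x| ^+ 2) _; first by rewrite expr2 ler_peMr// ltW.
  by apply: le_trans xy (le_trans yK (le_trans KK _)); rewrite lerDr ler01.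
have UKC i : nrm2 (row i (zi U *m E *m g)) + nrm2 (row i (zi U *m E2)) <= K%:C.
  have [-> ->] := zi_rows U g i; rewrite -qE lecR; exact: UK.
split=> //.
- move=> i j; apply: (sqr_bd _ (nrm2 (row i (zi U *m E *m g)))).
    by have := nrm2_entry (row i (zi U *m E *m g)) j; rewrite mxE.
  by apply: le_trans (UKC i); rewrite lerDl nrm2_ge0.
- move=> i j; apply: (sqr_bd _ (nrm2 (row i (zi U *m E2)))).
    by have := nrm2_entry (row i (zi U *m E2)) j; rewrite mxE.
  by apply: le_trans (UKC i); rewrite lerDr nrm2_ge0.
Qed.

End LatticeReducedBasis.

(** * Automorphisms of the lattice *)

Section ArithmeticGroup.
Variables (C : numClosedFieldType) (n : nat).
Hypotheses (n_gt1 : (1 < n)%N) (n_even : ~~ odd n).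
Local Notation d := n.+2.
Local Notation M := 'M[C]_d.
Local Notation J := (Jmx C n).
Local Notation Q := (Qmx C n).
Local Notation E := (Emx C n).
Local Notation E2 := (E2mx C n).
Local Notation N := (d + d + (d + d))%N.
Local Notation zi := (map_mx (intr : int -> C)).
Implicit Types (g : M) (U V : 'M[int]_N).

Definition Eleft : 'M[C]_(d, N) := row_mx (row_mx (invmx (Dmx C n)) 0) 0.
Definition E2left : 'M[C]_(d, N) := row_mx (row_mx (invmx (D2mx C n)) 0) 0.

Lemma EleftK : Eleft *m E = 1%:M.
Proof. by rewrite !mul_row_col !mul0mx !addr0 mulVmx ?D_unit. Qed.

Lemma E2leftK : E2left *m E2 = 1%:M.
Proof. by rewrite !mul_row_col !mul0mx !addr0 mulVmx ?D2_unit. Qed.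

(* Cancelling [v^t*] and [X^t*] shows that [v *m X] factors through [X]. *)
Lemma stabilizer_factor p q (L : 'M[C]_(q, p)) (X : 'M[C]_(p, q)) (F : 'M[C]_q)
    (v : 'M[C]_p) : L *m X = 1%:M -> F \in unitmx -> v^t* \in unitmx ->
  v *m (X *m F *m X^t*) *m v^t* = X *m F *m X^t* -> v *m X = X *m (L *m v *m X).
Proof.
move=> LX Fu vu vX; pose Z := F *m X^t* *m invmx (v^t*) *m L^t* *m invmx F.
have XL : X^t* *m L^t* = 1%:M by rewrite -adj_mul LX trmx1 map_mx1.
have vXZ : v *m X = X *m Z.
  have h : v *m X *m F *m X^t* = X *m F *m X^t* *m invmx (v^t*).
    by rewrite -vX mulmxK // !mulmxA.
  have := congr1 (fun Y => Y *m L^t* *m invmx F) h.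
  by rewrite -(mulmxA (v *m X *m F)) XL mulmx1 mulmxK // /Z !mulmxA.
by rewrite -(mulmxA L) vXZ (mulmxA L) LX mul1mx.
Qed.

Lemma stabilizer_form p q (L : 'M[C]_(q, p)) (X : 'M[C]_(p, q)) (F : 'M[C]_q)
    (v : 'M[C]_p) (g : 'M[C]_q) : L *m X = 1%:M -> v *m X = X *m g ->
  (v *m (X *m F *m X^t*) *m v^t* = X *m F *m X^t* -> g *m F *m g^t* = F) *
  (v *m (X *m F *m X^T) *m v^T = X *m F *m X^T -> g *m F *m g^T = F).
Proof.
move=> LX vX.
have XL : X^t* *m L^t* = 1%:M by rewrite -adj_mul LX trmx1 map_mx1.
have XL' : X^T *m L^T = 1%:M by rewrite -trmx_mul LX trmx1.
have vX' : X^t* *m v^t* = g^t* *m X^t* by rewrite -!adj_mul vX.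
have vX'' : X^T *m v^T = g^T *m X^T by rewrite -!trmx_mul vX.
have can (A B : 'M[C]_q) (Y : 'M[C]_(q, p)) (Y' : 'M[C]_(p, q)) : Y *m Y' = 1%:M ->
    X *m A *m Y = X *m B *m Y -> A = B.
  move=> YY /(congr1 (fun Z => L *m Z *m Y')).
  by rewrite -!(mulmxA X) !(mulmxA L) LX !mul1mx -!mulmxA YY !mulmx1.
split=> h.
  apply: (can _ _ _ _ XL); rewrite -[RHS]h !mulmxA vX -(mulmxA _ (X^t*)) vX' !mulmxA //.
apply: (can _ _ _ _ XL'); rewrite -[RHS]h !mulmxA vX -(mulmxA _ (X^T)) vX'' !mulmxA //.
Qed.

Lemma zi_unit V : V \in unitmx -> zi V \in unitmx.
Proof. by move=> Vu; rewrite unitmxE det_map_mx rmorph_unit. Qed.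

(** The second form is [herm v (jmap Q w)]; a map preserving it as well as the nondegenerate [herm]
    commutes with j. *)
Lemma quaternionic_form g : g *m J *m g^t* = J -> g *m (J *m Q^T) *m g^T = J *m Q^T ->
  quaternionic g.
Proof.
move=> gJ gQ.
have gJc : map_mx conjC g *m J *m g^T = J.
  have := congr1 (map_mx conjC) gJ; rewrite !map_mxM conjJ map_conjK //.
have gu : map_mx conjC g \in unitmx.
  by move: (J_unit C n); rewrite -[X in X \in _]gJc !unitmx_mul => /andP[/andP[]].
have gT : J *m g^T = invmx (map_mx conjC g) *m J.
  by apply: (canRL (mulKmx gu)); rewrite mulmxA.
move: gQ; rewrite trQ // (mulmxN J) -(QJ C n_gt1 n_even) mulmxN mulNmx => /oppr_inj.
rewrite mulmxA -(mulmxA _ J) gT !mulmxA => /(congr1 (fun X => X *m J)).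
rewrite -!(mulmxA _ J) JJ !mulmx1 => gQ.
have {}gQ : g *m Q = Q *m map_mx conjC g by rewrite -[in RHS]gQ mulmxKV.
have := congr1 (map_mx conjC) gQ; rewrite !map_mxM map_conjK conjQ //.
Qed.

(* Automorphisms of the lattice which commute with the quaternionic structure and
   whose Galois conjugate [g2] lies in the compact group of the definite form. *)
Definition arithmetic_mx g := quaternionic g /\ exists (V : 'M[int]_N) (g2 : M),
  [/\ V \in unitmx, zi V *m E = E *m g, zi V *m E2 = E2 *m g2 & g2 *m g2^t* = 1%:M].

Definition lattice_aut V : M := Eleft *m zi V *m E.

(** The rows of E are linearly dependent over C, so an integral V does not automatically induce a
    linear map of the space; invariance of the Gram matrices forces it to, by [stabilizer_factor],
    in both embeddings. *)
Lemma lattice_aut_arithmetic V : V \in unitmx ->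
  zi V *m (E *m J *m E^t*) *m (zi V)^T = E *m J *m E^t* ->
  zi V *m (E2 *m E2^t*) *m (zi V)^T = E2 *m E2^t* ->
  zi V *m (E *m (J *m Q^T) *m E^T) *m (zi V)^T = E *m (J *m Q^T) *m E^T ->
  [/\ arithmetic_mx (lattice_aut V), lattice_aut V *m J *m (lattice_aut V)^t* = J
    & zi V *m E = E *m lattice_aut V].
Proof.
move=> Vu VJ V2 VQ.
have vu : (zi V)^t* \in unitmx by rewrite zi_adj unitmx_tr zi_unit.
have VE : zi V *m E = E *m lattice_aut V.
  by apply: (stabilizer_factor EleftK (J_unit C n) vu); rewrite zi_adj.
pose g2 := E2left *m zi V *m E2.
have VE2 : zi V *m E2 = E2 *m g2.
  apply: (stabilizer_factor (F := 1%:M) E2leftK (unitmx1 _ _) vu).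
  by rewrite zi_adj mulmx1.
have gJ : lattice_aut V *m J *m (lattice_aut V)^t* = J.
  by apply: (stabilizer_form J EleftK VE).1; rewrite zi_adj.
have g2g2 : g2 *m g2^t* = 1%:M.
  have := (stabilizer_form 1%:M E2leftK VE2).1; rewrite zi_adj !mulmx1; exact.
split=> //; split; last by exists V, g2.
apply: quaternionic_form => //; exact: (stabilizer_form _ EleftK VE).2.
Qed.

Lemma lattice_autM U V g : zi V *m E = E *m g ->
  lattice_aut (U *m V) = lattice_aut U *m g.
Proof. by move=> VE; rewrite /lattice_aut map_mxM -!mulmxA VE. Qed.

(** Relative to the bases [Dmx] and [D2mx], the same integral combination has Galois conjugate
    coordinates. *)
Lemma zpair_rows p (V : 'M[int]_(p, N)) i j :
  zpair ((zi V *m (E *m invmx (Dmx C n))) i j) ((zi V *m (E2 *m invmx (D2mx C n))) i j).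
Proof.
rewrite [X in zpair X _]mxE [X in zpair _ X]mxE; apply: zpair_sum => r.
apply: zpairM; first by rewrite mxE; exact: zpair_int.
have [l [c [c' [cc cE cE2]]]] := Emx_row C r.
have -> : (E *m invmx (Dmx C n)) r j = c * (1%:M : M) l j.
  transitivity (row r (E *m invmx (Dmx C n)) 0 j); first by rewrite [RHS]mxE.
  by rewrite row_mul cE -scalemxAl -row_mul mulmxV ?D_unit // 2!mxE.
have -> : (E2 *m invmx (D2mx C n)) r j = c' * (1%:M : M) l j.
  transitivity (row r (E2 *m invmx (D2mx C n)) 0 j); first by rewrite [RHS]mxE.
  by rewrite row_mul cE2 -scalemxAl -row_mul mulmxV ?D2_unit // 2!mxE.
by apply: zpairM => //; rewrite mxE; case: eqP => _; [exact: zpair1|exact: zpair0].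
Qed.

Lemma arithmetic1 : arithmetic_mx 1%:M.
Proof.
split; first by rewrite /quaternionic map_mx1 mul1mx mulmx1.
exists 1%:M, 1%:M; split; rewrite ?unitmx1 ?map_mx1 ?mul1mx ?mulmx1 //.
by rewrite trmx1 map_mx1.
Qed.

Lemma arithmeticM g h : arithmetic_mx g -> arithmetic_mx h -> arithmetic_mx (g *m h).
Proof.
move=> [qg [V [g2 [Vu VE VE2 gg]]]] [qh [U [h2 [Uu UE UE2 hh]]]]; split.
  by rewrite /quaternionic map_mxM -mulmxA qh mulmxA qg mulmxA.
exists (V *m U), (g2 *m h2); split.
- by rewrite unitmx_mul Vu.
- by rewrite map_mxM -mulmxA UE mulmxA VE mulmxA.
- by rewrite map_mxM -mulmxA UE2 mulmxA VE2 mulmxA.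
- by rewrite adj_mul mulmxA -(mulmxA g2) hh mulmx1.
Qed.

Lemma arithmeticV g : g \in unitmx -> arithmetic_mx g -> arithmetic_mx (invmx g).
Proof.
move=> gu [qg [V [g2 [Vu VE VE2 gg]]]]; split.
  have gu' : map_mx conjC g \in unitmx by rewrite map_unitmx.
  apply: (can_inj (mulKmx gu')).
  by rewrite map_invmx mulKVmx // mulmxA qg mulmxK.
have g2u : g2 \in unitmx by case/mulmx1_unit: gg.
have VV : zi (invmx V) *m zi V = 1%:M by rewrite -map_mxM mulVmx // map_mx1.
have inv q (X : 'M[C]_(N, q)) (h : 'M[C]_q) : h \in unitmx -> zi V *m X = X *m h ->
    zi (invmx V) *m X = X *m invmx h.
  move=> hu VX; apply: (canRL (mulmxK hu)).
  by rewrite -mulmxA -VX mulmxA VV mul1mx.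
exists (invmx V), (invmx g2); split; [by rewrite unitmx_inv|exact: inv|exact: inv|].
have -> : invmx g2 = g2^t* by apply: (can_inj (mulKmx g2u)); rewrite mulmxV // gg.
by rewrite adjK; apply: mulmx1C.
Qed.

Lemma unitary_bound g : g *m g^t* = 1%:M -> forall i j, `|g i j| <= 1.
Proof.
move=> gg i j; have : `|g i j| ^+ 2 <= 1.
  have /matrixP/(_ i i) := gg; rewrite !mxE eqxx mulr1n => <-.
  rewrite (bigD1 j) //= !mxE -normCK lerDl sumr_ge0 // => k _.
  by rewrite !mxE -normCK exprn_ge0.
by rewrite expr_le1.
Qed.

End ArithmeticGroup.

(** * Gram matrices of lattice bases *)

Section LatticeGram.
Variables (C : numClosedFieldType) (n : nat).
Local Notation d := n.+2.
Local Notation M := 'M[C]_d.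
Local Notation J := (Jmx C n).
Local Notation Q := (Qmx C n).
Local Notation E := (Emx C n).
Local Notation N := (d + d + (d + d))%N.
Local Notation zi := (map_mx (intr : int -> C)).
Implicit Types (g : M) (U : 'M[int]_N).

Lemma gram_quotient U0 U (X : 'M[C]_N) : U0 \in unitmx ->
  zi U *m X *m (zi U)^T = zi U0 *m X *m (zi U0)^T ->
  zi (invmx U0 *m U) *m X *m (zi (invmx U0 *m U))^T = X.
Proof.
move=> U0u XX; have VV : zi (invmx U0) *m zi U0 = 1%:M by rewrite -map_mxM mulVmx // map_mx1.
rewrite map_mxM trmx_mul !mulmxA -(mulmxA _ (zi U)) -(mulmxA _ (zi U *m X)) XX.
by rewrite !mulmxA VV mul1mx -mulmxA -trmx_mul VV trmx1 mulmx1.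
Qed.

Lemma lattice_aut_quotient U0 U g :
  lattice_aut C (invmx U0 *m U) *m g = Eleft C n *m zi (invmx U0) *m (zi U *m E *m g).
Proof. by rewrite /lattice_aut map_mxM !mulmxA. Qed.

Lemma commuting_unitary (P : M) : quat P -> P *m J = J *m P -> P *m P^t* = 1%:M.
Proof.
case=> PJ _ PJ'; have : J *m (P *m P^t*) = J by rewrite mulmxA -PJ' PJ.
by move/(canRL (mulKmx (J_unit C n))); rewrite mulVmx ?J_unit.
Qed.

(** Expresses the Gram matrices of the lattice rows Y through the rows Y g, which lattice reduction
    bounds. The price is that Q becomes P, and P is unitary when it commutes with J; this is how the
    normal form enters cocompactness. *)
Lemma gram_commuting p (Y : 'M[C]_(p, d)) g (P := actq Q g) :
    g *m J *m g^t* = J -> g \in unitmx -> quat P ->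
  (Y *m J *m Y^t* = Y *m g *m J *m (Y *m g)^t*) *
  (Y *m (J *m Q^T) *m Y^T = Y *m g *m (J *m P^t*) *m (Y *m g)^T).
Proof.
move=> gJ gu [_ PP].
have gu' : map_mx conjC g \in unitmx by rewrite map_unitmx.
have Qg : Q *m g = map_mx conjC g *m P.
  by rewrite /P /actq map_invmx !mulmxA mulmxV // mul1mx.
clearbody P; split; first by rewrite adj_mul !mulmxA -(mulmxA _ g) -(mulmxA _ (g *m J)) gJ.
have Qg' : Q *m map_mx conjC g = g *m map_mx conjC P.
  have := congr1 (map_mx conjC) Qg; rewrite !map_mxM conjQ map_conjK; exact.
have JQ : J *m Q^T = g *m (J *m P^t*) *m g^T.
  have gQ : g^t* *m Q^T = P^t* *m g^T.
    by have := congr1 trmx Qg'; rewrite !trmx_mul !map_trmx.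
  by rewrite -{1}gJ -!(mulmxA g) -!(mulmxA J) gQ.
by rewrite JQ trmx_mul !mulmxA.
Qed.

Lemma inverse_entry g i j : g \in unitmx -> g *m J *m g^t* = J ->
  invmx g i j = conjC (g (tau j) (tau i)).
Proof.
move=> gu gJ; have -> : invmx g = J *m g^t* *m J.
  by apply: (can_inj (mulKmx gu)); rewrite mulmxV // !mulmxA gJ JJ.
by rewrite mulmxJ mulJmx mxE mxE.
Qed.

End LatticeGram.

(** * Finite codes for bounded algebraic data *)

Section FiniteCodes.

Lemma finite_set_coded (A : Type) (T : finType) (S : set A) (r : T -> A -> Prop) :
  (forall x, S x -> exists t, r t x) ->
  (forall t x y, S x -> S y -> r t x -> r t y -> x = y) -> finite_set S.
Proof.
move=> rS rI; have [->|/set0P[x0 Sx0]] := eqVneq S set0; first exact: finite_set0.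
have /choice[f hf] : forall t, exists x, (exists2 y, S y & r t y) -> S x /\ r t x.
  by move=> t; have [[y Sy ry]|no] := pselect (exists2 y, S y & r t y); [exists y|exists x0].
apply: (@sub_finite_set _ _ (f @` [set: T])); last exact/finite_image/finite_finset.
move=> x Sx; have [t rt] := rS _ Sx; exists t => //.
have [|Sf rf] := hf t; first by exists x.
exact: (rI t).
Qed.

Lemma uniform_nat_bound (A : Type) (T : finType) (P : A -> Prop) (r : T -> A -> Prop)
    (q : nat -> A -> Prop) :
  (forall k l x, (k <= l)%N -> q k x -> q l x) ->
  (forall x, P x -> exists t, r t x) ->
  (forall t, exists k, forall x, P x -> r t x -> q k x) ->
  exists k, forall x, P x -> q k x.
Proof.
move=> qS rP /choice[f hf]; exists (\max_t f t)%N => x Px; have [t rt] := rP _ Px.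
by apply: qS (hf t x Px rt); exact: leq_bigmax.
Qed.

Variable R : realType.
Local Notation C := R[i].

Lemma zpair_code (K : C) : exists (T : finType) (f1 f2 : T -> C), forall x y,
  zpair x y -> `|x| <= K -> `|y| <= K -> exists t, x = f1 t /\ y = f2 t.
Proof.
have [k Kk] := complex_nat_bound K.
(* The ordinals below 2k + 1, shifted by k, number the integers from -k to k. *)
pose z (i : 'I_(k + k).+1) : C := (i%:Z - k%:Z)%:~R.
have zP (a : int) : `|a%:~R : C| <= K -> exists i, a%:~R = z i.
  move=> aK; have ak : `|a| < k%:Z.
    rewrite -(ltr_int C) intr_norm; apply: (le_lt_trans aK).
    by rewrite -(ger0_norm (le_trans (normr_ge0 _) aK)).
  have ik : (absz (a + k%:Z)%R < (k + k).+1)%N by lia.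
  by exists (Ordinal ik); rewrite /z /=; congr (_%:~R); lia.
pose I := 'I_(k + k).+1; exists ((I * I) * (I * I))%type.
exists (fun t => z t.1.1 + z t.1.2 * r2 C + 'i * (z t.2.1 + z t.2.2 * r2 C)).
exists (fun t => z t.1.1 - z t.1.2 * r2 C + 'i * (z t.2.1 - z t.2.2 * r2 C)).
move=> x y xy xK yK; have [a [b [c [e [[aK bK cK eK] [-> ->]]]]]] := zpair_bound xK yK xy.
have [ia ->] := zP a aK; have [ib ->] := zP b bK.
have [ic ->] := zP c cK; have [ie ->] := zP e eK.
by exists ((ia, ib), (ic, ie)).
Qed.

Lemma zpair_code_mx (K : C) : exists (T : finType) (f1 f2 : T -> C),
  forall p q (A B : 'M[C]_(p, q)), (forall i j, zpair (A i j) (B i j)) ->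
  mxbd K A -> mxbd K B -> exists t : 'M[T]_(p, q), A = map_mx f1 t /\ B = map_mx f2 t.
Proof.
have [T [f1 [f2 fP]]] := zpair_code K; exists T, f1, f2 => p q A B AB AK BK.
have /choice[t ht] : forall ij : 'I_p * 'I_q, exists t,
    A ij.1 ij.2 = f1 t /\ B ij.1 ij.2 = f2 t.
  by move=> [i j]; apply: fP; [exact: AB|exact: AK|exact: BK].
exists (\matrix_(i, j) t (i, j)).
by split; apply/matrixP => i j; rewrite mxE mxE; case: (ht (i, j)).
Qed.

End FiniteCodes.

(** * Finiteness, cocompactness and properness of the arithmetic group *)

Section Tessellation.
Variables (R : realType) (n : nat).
Hypotheses (n_gt1 : (1 < n)%N) (n_even : ~~ odd n).
Local Notation C := R[i].
Local Notation d := n.+2.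
Local Notation M := 'M[C]_d.
Local Notation J := (Jmx C n).
Local Notation Q := (Qmx C n).
Local Notation E := (Emx C n).
Local Notation E2 := (E2mx C n).
Local Notation N := (d + d + (d + d))%N.
Local Notation zi := (map_mx (intr : int -> C)).
Implicit Types (g : M) (U V : 'M[int]_N).

Lemma mxbd_ex p q (A : 'M[C]_(p, q)) : exists b, mxbd b A.
Proof. by have [k kA] := mxbd_exists A; exists k%:R => i j; exact/ltW/kA. Qed.

Lemma mxbd_le p q (A : 'M[C]_(p, q)) a b : a <= b -> mxbd a A -> mxbd b A.
Proof. by move=> ab Aa i j; exact: le_trans (Aa i j) ab. Qed.

Lemma mxbd_norm_le p q (A : 'M[C]_(p, q)) a b : `|a| <= b -> mxbd a A -> mxbd b A.
Proof.
move=> ab Aa i j; apply: le_trans ab; apply: le_trans (Aa i j) _.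
by apply: real_ler_norm; rewrite ger0_real // (le_trans _ (Aa i j)).
Qed.

Lemma mxbd_tr p q (A : 'M[C]_(p, q)) b : mxbd b A -> mxbd b A^T.
Proof. by move=> Ab i j; rewrite mxE; exact: Ab. Qed.

Lemma mxbd_adj p q (A : 'M[C]_(p, q)) b : mxbd b A -> mxbd b (A^t*).
Proof. by move=> Ab i j; rewrite mxE mxE norm_conjC; exact: Ab. Qed.

(** g is determined by E g D^-1, whose entries lie in Z[sqrt 2, i]. They are bounded with g, and
    their Galois conjugates are bounded because g2 is unitary. *)
Lemma arithmetic_finite (b : C) :
  finite_set [set g : SU R n | arithmetic_mx (\val g) /\ mxbd b (\val g)].
Proof.
have [e Ee] := mxbd_ex E; have [f Ef] := mxbd_ex (invmx (Dmx C n)).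
have [e' Ee'] := mxbd_ex E2; have [f' Ef'] := mxbd_ex (invmx (D2mx C n)).
pose K1 : C := d%:R * (d%:R * (e * b) * f).
pose K2 : C := d%:R * (d%:R * (e' * 1) * f').
have [T [f1 [f2 fP]]] := zpair_code_mx (`|K1| + `|K2|).
pose r (t : 'M[T]_(N, d)) (g : SU R n) := E *m \val g *m invmx (Dmx C n) = map_mx f1 t.
apply: (@finite_set_coded _ _ _ r).
  move=> g [[_ [V [g2 [_ VE VE2 gg]]]] gb].
  have h1 : zi V *m (E *m invmx (Dmx C n)) = E *m \val g *m invmx (Dmx C n).
    by rewrite mulmxA VE.
  have h2 : zi V *m (E2 *m invmx (D2mx C n)) = E2 *m g2 *m invmx (D2mx C n).
    by rewrite mulmxA VE2.
  have B1 : mxbd (`|K1| + `|K2|) (E *m \val g *m invmx (Dmx C n)).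
    apply: mxbd_norm_le (mxbd_mul (mxbd_mul Ee gb) Ef).
    by rewrite lerDl normr_ge0.
  have B2 : mxbd (`|K1| + `|K2|) (E2 *m g2 *m invmx (D2mx C n)).
    apply: mxbd_norm_le (mxbd_mul (mxbd_mul Ee' (unitary_bound gg)) Ef').
    by rewrite lerDr normr_ge0.
  have zp i j : zpair ((E *m \val g *m invmx (Dmx C n)) i j) ((E2 *m g2 *m invmx (D2mx C n)) i j).
    by rewrite -h1 -h2; exact: zpair_rows.
  by have [t [tE _]] := fP _ _ _ _ zp B1 B2; exists t.
move=> t g h _ _ rg rh; apply: val_inj.
have : E *m \val g *m invmx (Dmx C n) = E *m \val h *m invmx (Dmx C n) by rewrite rg rh.
move=> /(congr1 (fun X => Eleft C n *m (X *m Dmx C n))).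
by rewrite !mulmxKV ?D_unit // !mulmxA EleftK // !mul1mx.
Qed.

(* The Gram matrices of a reduced lattice basis take finitely many values, and two
   bases with the same Gram matrices differ by a lattice automorphism. Its
   determinant is 1 or -1; the sign -1 is absorbed by a second representative. *)
Lemma arithmetic_cocompact : exists k : nat, forall g,
    [/\ g *m J *m g^t* = J, \det g = 1, quat (actq Q g) & actq Q g *m J = J *m actq Q g] ->
  exists ga : M, [/\ arithmetic_mx ga, ga *m J *m ga^t* = J, \det ga = 1 & mxbd k%:R (ga *m g)].
Proof.
have [b red] := @lattice_reduction R n n_gt1 n_even.
have [jb Jb] := mxbd_ex J; have [qb Qb] := mxbd_ex Q.
pose X1 U := zi U *m (E *m J *m E^t*) *m (zi U)^T.
pose X2 U := zi U *m (E2 *m E2^t*) *m (zi U)^T.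
pose X3 U := zi U *m (E *m (J *m Q^T) *m E^T) *m (zi U)^T.
pose X4 U := zi U *m (E2 *m Q^T *m E2^T) *m (zi U)^T.
pose K1 : C := d%:R * (d%:R * (b * jb) * b).
pose K2 : C := d%:R * (b * b).
pose K3 : C := d%:R * (d%:R * (b * (d%:R * (jb * 1))) * b).
pose K4 : C := d%:R * (d%:R * (b * qb) * b).
pose K := `|K1| + `|K2| + (`|K3| + `|K4|).
have [K1K K2K K3K K4K] : [/\ `|K1| <= K, `|K2| <= K, `|K3| <= K & `|K4| <= K].
  have := (normr_ge0 K1, normr_ge0 K2, (normr_ge0 K3, normr_ge0 K4)); rewrite /K.
  move: `|K1| `|K2| `|K3| `|K4| => x1 x2 x3 x4 [[x10 x20] [x30 x40]].
  by split; rewrite -subr_ge0; [rewrite (_ : _ - _ = x2 + (x3 + x4))|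
    rewrite (_ : _ - _ = x1 + (x3 + x4))|rewrite (_ : _ - _ = x1 + (x2 + x4))|
    rewrite (_ : _ - _ = x1 + (x2 + x3))]; rewrite ?addr_ge0 //; ring.
have [T [f1 [f2 fP]]] := zpair_code_mx K.
pose P g := [/\ g *m J *m g^t* = J, \det g = 1, quat (actq Q g) & actq Q g *m J = J *m actq Q g].
(* The code t.1 determines both conjugate matrices X1 and X2; X4 is the conjugate of X3, and its
   bound serves to produce the code t.2. *)
pose cls (t : 'M[T]_N * 'M[T]_N) U :=
  [/\ U \in unitmx, X1 U = map_mx f1 t.1, X2 U = map_mx f2 t.1 & X3 U = map_mx f1 t.2].
pose r t g := exists2 U, cls t U & mxbd b (zi U *m E *m g).
pose q (k : nat) g := exists ga : M,
  [/\ arithmetic_mx ga, ga *m J *m ga^t* = J, \det ga = 1 & mxbd k%:R (ga *m g)].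
apply: (@uniform_nat_bound _ _ P r q).
- move=> k l g kl [ga [h1 h2 h3 h4]]; exists ga; split=> //.
  by apply: mxbd_le h4; rewrite ler_nat.
- move=> g [gJ dg Pq PJ]; have [U [Uu U1 U2]] := red g gJ dg.
  have gu : g \in unitmx by rewrite unitmxE dg unitr1.
  have [gm1 gm2] := gram_commuting (zi U *m E) gJ gu Pq.
  have B1 : mxbd K (X1 U).
    apply: mxbd_norm_le K1K _; rewrite /X1.
    have -> : zi U *m (E *m J *m E^t*) *m (zi U)^T = zi U *m E *m J *m (zi U *m E)^t*.
      by rewrite adj_mul zi_adj !mulmxA.
    by rewrite gm1; apply: mxbd_mul; [exact: mxbd_mul|exact: mxbd_adj].
  have B2 : mxbd K (X2 U).
    apply: mxbd_norm_le K2K _; rewrite /X2.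
    have -> : zi U *m (E2 *m E2^t*) *m (zi U)^T = zi U *m E2 *m (zi U *m E2)^t*.
      by rewrite adj_mul zi_adj !mulmxA.
    by apply: mxbd_mul; [|exact: mxbd_adj].
  have B3 : mxbd K (X3 U).
    apply: mxbd_norm_le K3K _; rewrite /X3.
    have -> : zi U *m (E *m (J *m Q^T) *m E^T) *m (zi U)^T =
        zi U *m E *m (J *m Q^T) *m (zi U *m E)^T by rewrite trmx_mul !mulmxA.
    rewrite gm2; apply: mxbd_mul; last exact: mxbd_tr.
    apply: mxbd_mul => //; apply: mxbd_mul => //; apply: mxbd_adj.
    exact: unitary_bound (commuting_unitary Pq PJ).
  have B4 : mxbd K (X4 U).
    apply: mxbd_norm_le K4K _; rewrite /X4.
    have -> : zi U *m (E2 *m Q^T *m E2^T) *m (zi U)^T =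
        zi U *m E2 *m Q^T *m (zi U *m E2)^T by rewrite trmx_mul !mulmxA.
    by apply: mxbd_mul; [apply: mxbd_mul => //; exact: mxbd_tr|exact: mxbd_tr].
  have G := Emx_gram C n_gt1 n_even.
  have [t1 [t11 t12]] := fP _ _ _ _ (zpair_congr U (fun i j => (G i j).1)) B1 B2.
  have [t2 [t21 _]] := fP _ _ _ _ (zpair_congr U (fun i j => (G i j).2)) B3 B4.
  by exists (t1, t2); exists U.
- move=> t.
  have rep U0 : cls t U0 -> exists k : nat, forall g U, cls t U -> mxbd b (zi U *m E *m g) ->
      let ga := lattice_aut C (invmx U0 *m U) in
      [/\ arithmetic_mx ga, ga *m J *m ga^t* = J & mxbd k%:R (ga *m g)].
    move=> [U0u H1 H2 H3]; have [a Aa] := mxbd_ex (Eleft C n *m zi (invmx U0)).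
    have [k Kk] := complex_nat_bound (N%:R * (a * b)).
    exists k => g U [Uu H1' H2' H3'] Ub ga.
    have Vu : invmx U0 *m U \in unitmx by rewrite unitmx_mul unitmx_inv U0u.
    have [h1 h2 h3] := lattice_aut_arithmetic n_gt1 n_even Vu
      (gram_quotient U0u (etrans H1' (esym H1))) (gram_quotient U0u (etrans H2' (esym H2)))
      (gram_quotient U0u (etrans H3' (esym H3))).
    split=> //; rewrite /ga lattice_aut_quotient => i j.
    have h := mxbd_mul Aa Ub i j; have h0 := le_trans (normr_ge0 _) h.
    by apply: (le_trans h); rewrite (le_trans (real_ler_norm (ger0_real h0))) // ltW.
  have [[U0 c0]|no] := pselect (exists U0, cls t U0); last first.
    by exists 0%N => g _ [U cU]; case: no; exists U.
  have [k0 rep0] := rep U0 c0.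
  have [[U1 [c1 d1]]|no] := pselect (exists U1, cls t U1 /\
      \det (lattice_aut C (invmx U0 *m U1)) = -1); last first.
    exists k0 => g _ [U cU Ub]; have [h1 h2 h3] := rep0 g U cU Ub.
    exists (lattice_aut C (invmx U0 *m U)); split=> //.
    by have [//|dU] := quaternionic_det n_gt1 n_even h1.1 h2; case: no; exists U.
  have [k1 rep1] := rep U1 c1.
  exists (k0 + k1)%N => g _ [U cU Ub]; have [h1 h2 h3] := rep0 g U cU Ub.
  have [dU|dU] := quaternionic_det n_gt1 n_even h1.1 h2.
    exists (lattice_aut C (invmx U0 *m U)); split=> //.
    by apply: mxbd_le h3; rewrite ler_nat leq_addr.
  have [e1 e2 e3] := rep1 g U cU Ub.
  have [U0u _ _ _] := c0; have [U1u G1 G2 G3] := c1; have [Uu G1' G2' G3'] := cU.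
  have Vu : invmx U1 *m U \in unitmx by rewrite unitmx_mul unitmx_inv U1u.
  have [_ _ VE] := lattice_aut_arithmetic n_gt1 n_even Vu
      (gram_quotient U1u (etrans G1' (esym G1))) (gram_quotient U1u (etrans G2' (esym G2)))
      (gram_quotient U1u (etrans G3' (esym G3))).
  (* The whole product and its first factor both have determinant -1, so the automorphism comparing
     U with U1 has determinant 1. *)
  have : invmx U0 *m U = (invmx U0 *m U1) *m (invmx U1 *m U) by rewrite mulmxA mulmxK.
  move=> UU; move: dU; rewrite UU (lattice_autM _ VE) det_mulmx d1 mulN1r => /oppr_inj dU.
  exists (lattice_aut C (invmx U1 *m U)); split; [exact: e1|exact: e2|exact: dU|].
  by apply: mxbd_le e3; rewrite ler_nat leq_addl.
Qed.

Lemma isometry_of_SU (g : SU R n) : [/\ \val g *m J *m (\val g)^t* = J, \det (\val g) = 1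
  & \val g \in unitmx].
Proof.
have [gJ dg] := SUP g; rewrite -JformE // gJ dg; split=> //.
by rewrite unitmxE dg unitr1.
Qed.

Lemma mxbd_inv (g : SU R n) b : mxbd b (\val g) -> mxbd b (invmx (\val g)).
Proof.
move=> gb i j; have [gJ _ gu] := isometry_of_SU g.
by rewrite (inverse_entry i j gu gJ) norm_conjC; exact: gb.
Qed.

(* If |k| controls the minors of k linearly, then |ga|^2 <= |minors of ga| <~
   |minors of k| <~ |k| <~ |ga|. *)
Lemma minor_proper (s b : C) : 0 <= s -> exists b' : C, forall ga k c1 c2 : M,
  quaternionic ga -> mxbd b c1 -> mxbd b c2 -> 
  mxbd b (invmx c1) -> mxbd b (invmx c2) -> c1 \in unitmx -> c2 \in unitmx ->
  k = invmx c2 *m ga *m c1 ->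
  (forall a : C, 0 <= a -> mxbd a k -> minorbd (s * a) k) -> mxbd b' ga.
Proof.
(* kap is the cost of multiplying by a bounded matrix on both sides for entries, and on one side for
   minors. It occurs once for |k| in terms of |ga| and twice for the minors of ga in terms of those
   of k. *)
move=> s0; pose kap : C := d%:R ^+ 2 * b ^+ 2.
exists (kap * (kap * (s * kap))) => ga k c1 c2 qga b1 b2 b1' b2' u1 u2 kE km.
have b0 : 0 <= b by apply: le_trans (b1 ord0 ord0); exact: normr_ge0.
have kap0 : 0 <= kap by rewrite mulr_ge0 ?exprn_ge0 ?ler0n.
set mu := kap * _; have mu0 : 0 <= mu by rewrite !mulr_ge0.
pose G : C := mx_norm ga; have Gb : mxbd G ga := mxbd_norm ga.
have G0 : 0 <= G by apply: le_trans (Gb ord0 ord0); exact: normr_ge0.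
have kb : mxbd (kap * G) k.
  have := mxbd_mul (mxbd_mul b2' Gb) b1; rewrite -kE; apply: mxbd_le.
  by rewrite (_ : _ * _ = kap * G) // /kap; ring.
have gaE : ga = c2 *m k *m invmx c1.
  by rewrite kE !mulmxA mulmxV // mul1mx mulmxK.
have gam : minorbd (mu * G) ga.
  have := minorbd_mulr b1' (minorbd_mull b2 (km _ (mulr_ge0 kap0 G0) kb)).
  rewrite -gaE; set x := (X in minorbd X _); suff -> : x = mu * G by [].
  by rewrite /x /mu /kap; ring.
have ent i j : `|ga i j| <= sqrtC (mu * G).
  rewrite -(@ler_pXn2r _ 2) ?nnegrE ?normr_ge0 ?sqrtC_ge0 ?mulr_ge0 // sqrtCK.
  by apply: le_trans (quaternionic_minor_bound n_gt1 n_even i j qga) _; exact: gam.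
have GG : G <= sqrtC (mu * G).
  by apply/mx_norm_le => //; rewrite sqrtC_ge0 mulr_ge0.
have Gmu : G <= mu.
  have := GG; rewrite -(@ler_pXn2r _ 2) ?nnegrE ?sqrtC_ge0 ?mulr_ge0 // sqrtCK expr2.
  have [->|Gn0] := eqVneq G 0; first by [].
  by rewrite ler_pM2r // lt_def Gn0.
exact: mxbd_le Gmu Gb.
Qed.

Lemma quat_SU (g : SU R n) : quat (actq Q (\val g)).
Proof.
have [gJ _ gu] := isometry_of_SU g.
exact: quat_act gJ (quatQ C n_gt1 n_even) gu.
Qed.

End Tessellation.

(** * The crystallographic group for H_[c] *)

Section TessellationOfHc.
Variables (R : realType) (n : nat) (c : R).
Hypotheses (n_gt3 : (3 < n)%N) (n_even : ~~ odd n) (c_gt0 : 0 < c) (c_le1 : c <= 1).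
Local Notation C := R[i].
Local Notation J := (Jmx C n).
Local Notation Q := (Qmx C n).
Local Open Scope complex_scope.

Let n_gt1 : (1 < n)%N. Proof. by apply: leq_trans n_gt3. Qed.

Definition arithmetic_SU : set (SU R n) := [set g | arithmetic_mx (\val g)].

Lemma arithmetic_SU_subgroup : is_subgroup arithmetic_SU.
Proof.
split; first exact: arithmetic1.
- by move=> x y; exact: arithmeticM.
- by move=> x; apply: arithmeticV => //; have [] := isometry_of_SU n_gt1 x.
Qed.

Lemma Hc_normal_form (x : SU R n) : exists2 h, Hc c h &
  actq Q (\val (x * h)%g) *m J = J *m actq Q (\val (x * h)%g).
Proof.
have Wm := @Wmid R n c.
have [w1 [z1 [a [w2 [z2 [[W1 e1 a0 W2 e2] [_ PJ]]]]]]] :=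
  quat_normal_form n_gt1 Wm (Wsolve n_gt3 c_gt0 c_le1) (Wtransverse n_gt3 c_gt0 c_le1)
    (quat_SU n_gt1 n_even x).
have S1 := SU_setM (unip_SU n_gt1 W1 e1) (dg_SU n_gt1 a0).
have S2 := unip_SU n_gt1 W2 e2.
exists (SU_of S1 * SU_of S2)%g.
  rewrite HcE //; have [_ HM _] := @Hset_subgroup R n c.
  apply: HM; first by exists w1, z1, a.
  by exists w2, z2, 1; split=> //; rewrite dg1 mulmx1.
have [_ _ xu] := isometry_of_SU n_gt1 x.
have [_ _ hu] := isometry_of_SU n_gt1 (SU_of S1 * SU_of S2)%g.
by rewrite /= -actqM.
Qed.

Lemma arithmetic_SU_crystallographic : crystallographic arithmetic_SU (Hc c).
Proof.
have Hgrp : is_subgroup (Hc c : set (SU R n)) by rewrite HcE //; exact: Hset_subgroup.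
apply: crystallographic_criterion => //.
- exact: arithmetic_SU_subgroup.
- by move=> b; exact: arithmetic_finite.
- move=> b; have s0 : 0 <= 4 * (c^-1)%:C by rewrite mulr_ge0 ?ler0n // lecR invr_ge0 ltW.
  have [b' hb'] := @minor_proper R n n_gt1 n_even _ b s0; exists b'.
  move=> g c1 c2 h [qg _] Hh b1 b2 cE.
  have [_ _ u1] := isometry_of_SU n_gt1 c1; have [_ _ u2] := isometry_of_SU n_gt1 c2.
  (* Solving for h^-1 places g between bounded factors, while the minors of h^-1 are linear because
     it lies in H_[c]. *)
  have kE : (h^-1 = c2^-1 * g * c1)%g.
    by rewrite cE -mulgA invgM -mulgA mulVg mulg1.
  apply: (hb' _ (\val (h^-1)%g) _ _ qg b1 b2 (mxbd_inv n_gt1 b1) (mxbd_inv n_gt1 b2) u1 u2).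
    by rewrite kE.
  move=> a a0 ha i j k l; have [_ _ HV] := Hgrp.
  rewrite (_ : _ * a = 2 * (2 * (c^-1)%:C * a)); last by ring.
  exact: (Hc_upper n_gt3 c_gt0 c_le1 (HV _ Hh) a0 ha).
- have [k hk] := @arithmetic_cocompact R n n_gt1 n_even; exists k%:R => x.
  have [h Hh PJ] := Hc_normal_form x.
  have [xJ dx _] := isometry_of_SU n_gt1 (x * h)%g.
  (* The reduction is applied to x h, whose structure is unitary, and not to an element of Sp(1,
     m). *)
  have [ga [Aga gaJ dga gb]] := hk _ (And4 xJ dx (quat_SU n_gt1 n_even (x * h)%g) PJ).
  have Sga : SU_set ga by split; rewrite ?JformE.
  exists (SU_of Sga), h; split=> //.
  by rewrite -mulgA.
Qed.

End TessellationOfHc.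

Theorem theorem9p14 (R : realType) (m : nat) (c : R)
    (hm : (2 <= m)%N) (hc : 0 < c <= 1) :
  rho_asymp [set \val h | h in (Hc c : set (SU R (2 * m)))] /\
  has_tessellation (Hc c : set (SU R (2 * m))).
Proof.
have /andP[c0 c1] := hc.
have n_gt3 : (3 < 2 * m)%N by lia.
have n_even : ~~ odd (2 * m) by rewrite oddM.
split; first exact: rho_asymp_Hc.
by exists (@arithmetic_SU R (2 * m)); exact: arithmetic_SU_crystallographic.
Qed.
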